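(* Let $k$ be an algebraically closed field of characteristic $p>0$ and let $C_p$ be the cyclic group of order $p$. Let $A$ and $B$ be two indecomposable, non-semisimple finite dimensional $k$-algebras which are stably equivalent of Morita type. If the tensor product algebras $A\otimes_k kC_p$ and $B\otimes_k kC_p$ are stably equivalent of Morita type, then the Auslander-Reiten conjecture holds for $A$ and $B$, that is, $A$ and $B$ have the same number of isomorphism classes of non-projective simple modules.
   Context: Two finite dimensional $k$-algebras $A$ and $B$ are said to be stably equivalent of Morita type if there are bimodules ${}_AM_B$ and ${}_BN_A$, each projective as a left module and as a right module, such that there are bimodule isomorphisms ${}_AM\otimes_B N_A\simeq {}_AA_A\oplus {}_AP_A$ and ${}_BN\otimes_A M_B\simeq {}_BB_B\oplus {}_BQ_B$, where ${}_AP_A$ and ${}_BQ_B$ are projective bimodules. Modules and bimodules are finite dimensional over $k$, and simple modules are left modules. Here $kC_p$ denotes the group algebra of $C_p$ over $k$. ''Indecomposable'' means indecomposable as an algebra (not a product of two nonzero algebras). The Auslander-Reiten conjecture predicts that two stably equivalent algebras have the same number of isomorphism classes of non-projective simple modules. *)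

(* Defs.v *)
From HB Require Import structures.
From mathcomp Require Import all_boot all_order all_fingroup all_solvable.
From mathcomp Require Import all_algebra all_field.

Set Implicit Arguments.
Unset Strict Implicit.
Unset Printing Implicit Defensive.

Import GRing.Theory.
Local Open Scope ring_scope.

(* Finite dimensional k-algebras are falgType k; note that these have 1 != 0. *)

Definition tensor (k : fieldType) (U V : vectType k) : Type :=
  'M[k]_(\dim {:U}, \dim {:V}).

HB.instance Definition _ (k : fieldType) (U V : vectType k) :=
  Vector.copy (tensor U V) 'M[k]_(\dim {:U}, \dim {:V}).

Definition bilinear_map (k : fieldType) (U V W : vectType k)
    (f : U -> V -> W) : Prop :=
  (forall u, linear (f u)) /\ (forall v, linear (f^~ v)).

Section TensorProduct.

Variables (k : fieldType) (U V : vectType k).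

Definition tens (u : U) (v : V) : tensor U V :=
  \matrix_(i, j) (coord (vbasis {:U}) i u * coord (vbasis {:V}) j v).

Definition tensor_lift (W : vectType k) (f : U -> V -> W) (x : tensor U V) : W :=
  \sum_i \sum_j x i j *: f (vbasis {:U})`_i (vbasis {:V})`_j.

Lemma tens_bilinear : bilinear_map tens.
Proof.
split=> [u a v w|v a u w]; apply/matrixP=> i j; rewrite !mxE linearP /=.
  by rewrite mulrDr mulrCA.
by rewrite mulrDl mulrA.
Qed.

Lemma tensor_lift_linear (W : vectType k) (f : U -> V -> W) :
  linear (tensor_lift f).
Proof.
move=> a x y; rewrite /tensor_lift scaler_sumr -big_split /=.
apply: eq_bigr => i _; rewrite scaler_sumr -big_split /=.
by apply: eq_bigr => j _; rewrite !mxE scalerDl scalerA.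
Qed.

HB.instance Definition _ (W : vectType k) (f : U -> V -> W) :=
  GRing.isSemilinear.Build k (tensor U V) W _ (tensor_lift f)
    (GRing.semilinear_linear (tensor_lift_linear f)).

Lemma bilinear_suml (W : vectType k) (f : U -> V -> W) n (c : 'I_n -> k)
    (u : 'I_n -> U) v : bilinear_map f ->
  f (\sum_i c i *: u i) v = \sum_i c i *: f (u i) v.
Proof.
case=> _ fl; pose g : {linear U -> W} := HB.pack (f^~ v)
  (GRing.isLinear.Build k U W _ (f^~ v) (fl v)).
rewrite -[LHS]/(g _) linear_sum; apply: eq_bigr => i _.
by rewrite linearZ.
Qed.

Lemma bilinear_sumr (W : vectType k) (f : U -> V -> W) n (c : 'I_n -> k)
    (v : 'I_n -> V) u : bilinear_map f ->
  f u (\sum_i c i *: v i) = \sum_i c i *: f u (v i).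
Proof.
case=> fr _; pose g : {linear V -> W} := HB.pack (f u)
  (GRing.isLinear.Build k V W _ (f u) (fr u)).
rewrite -[LHS]/(g _) linear_sum; apply: eq_bigr => i _.
by rewrite linearZ.
Qed.

Lemma tensor_liftE (W : vectType k) (f : U -> V -> W) u v :
  bilinear_map f -> tensor_lift f (tens u v) = f u v.
Proof.
move=> bf; rewrite {2}(coord_vbasis (memvf u)) bilinear_suml //.
apply: eq_bigr => i _; rewrite {2}(coord_vbasis (memvf v)) bilinear_sumr //.
by rewrite scaler_sumr; apply: eq_bigr => j _; rewrite mxE scalerA.
Qed.

Lemma tens_basis (i : 'I_(\dim {:U})) (j : 'I_(\dim {:V})) :
  tens (vbasis {:U})`_i (vbasis {:V})`_j = delta_mx i j.
Proof.
apply/matrixP=> a b; rewrite !mxE !coord_free ?(basis_free (vbasisP _)) //.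
by rewrite -natrM mulnb eq_sym [j == b]eq_sym.
Qed.

Lemma tensor_ind (P : tensor U V -> Prop) :
  P 0 -> (forall a x y, P x -> P y -> P (a *: x + y)) ->
  (forall u v, P (tens u v)) -> forall x, P x.
Proof.
move=> P0 PD Pt x; rewrite [x]matrix_sum_delta.
have PS (I : finType) (F : I -> tensor U V) :
  (forall i, P (F i)) -> P (\sum_i F i).
  move=> PF; elim/big_ind: _ => // y z Py Pz.
  by rewrite -[y]scale1r; apply: PD.
apply: (PS) => i; apply: (PS) => j; rewrite -tens_basis -[_ *: _]addr0.
exact: PD.
Qed.

Lemma tensor_ext (W : vectType k) (f g : {linear tensor U V -> W}) :
  (forall u v, f (tens u v) = g (tens u v)) -> f =1 g.
Proof.
move=> fg; apply: tensor_ind => [|a x y fx fy|]; last exact: fg.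
  by rewrite !linear0.
by rewrite !linearP /= fx fy.
Qed.

Lemma tens_eq0 u v : (tens u v == 0) = (u == 0) || (v == 0).
Proof.
have coord0 (X : vectType k) (x : X) : x != 0 ->
    exists i, coord (vbasis {:X}) i x != 0.
  move=> x0; apply/existsP; apply: contraNT x0 => /existsPn x0.
  rewrite (coord_vbasis (memvf x)) big1 // => i _.
  by move/eqP: (negbNE (x0 i)) => ->; rewrite scale0r.
apply/idP/idP => [|/orP[]/eqP->]; last 2 first.
- by apply/eqP/matrixP=> i j; rewrite !mxE linear0 mul0r.
- by apply/eqP/matrixP=> i j; rewrite !mxE linear0 mulr0.
apply: contraTT; rewrite negb_or => /andP[/coord0[i ui] /coord0[j vj]].
apply/eqP=> /matrixP/(_ i j)/eqP; rewrite !mxE mulf_eq0.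
by rewrite (negPf ui) (negPf vj).
Qed.

End TensorProduct.

Section TensorAlgebra.

Variables (k : fieldType) (A B : falgType k).
Implicit Types (a : A) (b : B) (x y z : tensor A B).

Definition tens_mul x y : tensor A B :=
  tensor_lift (fun a b =>
    tensor_lift (fun a' b' => tens (a * a') (b * b')) y) x.

Let tens_mull_bilinear a b :
  bilinear_map (fun a' b' => tens (a * a') (b * b') : tensor A B).
Proof.
split=> [a' c v w|b' c v w]; rewrite mulrDr -scalerAr.
  exact: (tens_bilinear A B).1.
exact: (tens_bilinear A B).2.
Qed.

Let tens_mulr_bilinear y : bilinear_map (fun a b =>
  tensor_lift (fun a' b' => tens (a * a') (b * b') : tensor A B) y).
Proof.
split=> [a c v w|b c v w]; elim/tensor_ind: y => [|e x y IHx IHy|a' b'].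
- by rewrite !linear0 ?scaler0 addr0.
- rewrite ![tensor_lift _ (e *: x + y)]linearP /= IHx IHy !scalerDr !scalerA.
  by rewrite [e * c]mulrC addrACA.
- rewrite !tensor_liftE //; rewrite mulrDl -scalerAl.
  exact: (tens_bilinear A B).1.
- by rewrite !linear0 ?scaler0 addr0.
- rewrite ![tensor_lift _ (e *: x + y)]linearP /= IHx IHy !scalerDr !scalerA.
  by rewrite [e * c]mulrC addrACA.
- rewrite !tensor_liftE //; rewrite mulrDl -scalerAl.
  exact: (tens_bilinear A B).2.
Qed.

Lemma tens_mulE a b a' b' :
  tens_mul (tens a b) (tens a' b') = tens (a * a') (b * b').
Proof. by rewrite /tens_mul !tensor_liftE. Qed.

Lemma tens_mul_bilinear : bilinear_map tens_mul.
Proof.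
split=> [x c v w|y c v w]; last by rewrite /tens_mul linearP.
elim/tensor_ind: x => [|e x y IHx IHy|a b].
- by rewrite /tens_mul !linear0 ?scaler0 addr0.
- have E z : tens_mul (e *: x + y) z = e *: tens_mul x z + tens_mul y z.
    by rewrite /tens_mul linearP.
  rewrite !E IHx IHy.
  by rewrite !scalerDr !scalerA [e * c]mulrC addrACA.
- by rewrite /tens_mul !tensor_liftE // linearP.
Qed.

Let tens_mul0l y : tens_mul 0 y = 0.
Proof. by rewrite /tens_mul linear0. Qed.

Let tens_mulDl c x x' y :
  tens_mul (c *: x + x') y = c *: tens_mul x y + tens_mul x' y.
Proof. exact: (tens_mul_bilinear.2 y). Qed.

Let tens_mulDr c x y y' :
  tens_mul x (c *: y + y') = c *: tens_mul x y + tens_mul x y'.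
Proof. exact: (tens_mul_bilinear.1 x). Qed.

Let tens_mul0r x : tens_mul x 0 = 0.
Proof.
by have := tens_mulDr (-1) x 0 0; rewrite !scaleN1r !addNr.
Qed.

Lemma tens_mulA : associative tens_mul.
Proof.
move=> x y z; elim/tensor_ind: x => [|c x x' IH IH'|a b].
- by rewrite !tens_mul0l.
- by rewrite !tens_mulDl IH IH'.
elim/tensor_ind: y => [|c y y' IH IH'|a' b'].
- by rewrite !tens_mul0r tens_mul0l tens_mul0r.
- by rewrite !(tens_mulDr, tens_mulDl) IH IH'.
elim/tensor_ind: z => [|c z z' IH IH'|a'' b''].
- by rewrite !tens_mul0r.
- by rewrite !tens_mulDr IH IH'.
by rewrite !tens_mulE !mulrA.
Qed.

Lemma tens_mul1l : left_id (tens 1 1) tens_mul.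
Proof.
elim/tensor_ind=> [|c x x' IH IH'|a b]; first exact: tens_mul0r.
  by rewrite tens_mulDr IH IH'.
by rewrite tens_mulE !mul1r.
Qed.

Lemma tens_mul1r : right_id (tens 1 1) tens_mul.
Proof.
elim/tensor_ind=> [|c x x' IH IH'|a b]; first exact: tens_mul0l.
  by rewrite tens_mulDl IH IH'.
by rewrite tens_mulE !mulr1.
Qed.

Lemma tens_mulDll : left_distributive tens_mul +%R.
Proof. by move=> x y z; rewrite -[x]scale1r tens_mulDl !scale1r. Qed.

Lemma tens_mulDrr : right_distributive tens_mul +%R.
Proof. by move=> x y z; rewrite -[y]scale1r tens_mulDr !scale1r. Qed.

Lemma tens1_neq0 : (tens 1 1 : tensor A B) != 0.
Proof. by rewrite tens_eq0 !oner_eq0. Qed.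

HB.instance Definition _ := GRing.Zmodule_isNzRing.Build (tensor A B)
  tens_mulA tens_mul1l tens_mul1r tens_mulDll tens_mulDrr tens1_neq0.

Lemma tens_scalerAl c x y : c *: (x * y) = (c *: x) * y.
Proof.
rewrite -[RHS]/(tens_mul (c *: x) y) -[c *: x]addr0 tens_mulDl.
by rewrite tens_mul0l addr0.
Qed.

HB.instance Definition _ := GRing.Lmodule_isLalgebra.Build k (tensor A B)
  tens_scalerAl.

Lemma tens_scalerAr c x y : c *: (x * y) = x * (c *: y).
Proof.
rewrite -[RHS]/(tens_mul x (c *: y)) -[c *: y]addr0 tens_mulDr.
by rewrite tens_mul0r addr0.
Qed.

HB.instance Definition _ := GRing.Lalgebra_isAlgebra.Build k (tensor A B)
  tens_scalerAr.

HB.instance Definition _ := Algebra_isFalgebra.Build k (tensor A B).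

End TensorAlgebra.

Definition group_alg (k : fieldType) (gT : finGroupType) : Type :=
  {ffun gT -> k^o}.

HB.instance Definition _ (k : fieldType) (gT : finGroupType) :=
  Vector.copy (group_alg k gT) {ffun gT -> k^o}.

Section GroupAlgebra.

Variables (k : fieldType) (gT : finGroupType).
Implicit Types (f g h : group_alg k gT).

Definition galg_elt (x : gT) : group_alg k gT := [ffun y => (y == x)%:R].

Definition galg_mul f g : group_alg k gT :=
  [ffun x => \sum_y f y * g (y^-1 * x)%g].

Lemma galg_mulA : associative galg_mul.
Proof.
move=> f g h; apply/ffunP=> x; rewrite !ffunE.
under eq_bigr do rewrite ffunE mulr_sumr.
under [RHS]eq_bigr do rewrite ffunE mulr_suml.
rewrite [RHS]exchange_big /=; apply: eq_bigr => z _.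
rewrite [RHS](reindex_inj (mulgI z)) /=; apply: eq_bigr => w _.
by rewrite mulKg invMg mulgA mulrA.
Qed.

Lemma galg_elt_mull x g y : galg_mul (galg_elt x) g y = g (x^-1 * y)%g.
Proof.
rewrite ffunE (bigD1 x) //= ffunE eqxx mul1r big1 ?addr0 // => z /negPf zx.
by rewrite ffunE zx mul0r.
Qed.

Lemma galg_elt_mulr x f y : galg_mul f (galg_elt x) y = f (y * x^-1)%g.
Proof.
rewrite ffunE (bigD1 (y * x^-1)%g) //= ffunE invMg invgK mulgKV eqxx mulr1.
rewrite big1 ?addr0 // => z zx; rewrite ffunE.
rewrite (_ : (_ == x) = false) ?mulr0 //; apply: contraNF zx => /eqP <-.
by rewrite invMg invgK mulKVg.
Qed.

Lemma galg_mul1l : left_id (galg_elt 1%g) galg_mul.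
Proof. by move=> f; apply/ffunP=> x; rewrite galg_elt_mull invg1 mul1g. Qed.

Lemma galg_mul1r : right_id (galg_elt 1%g) galg_mul.
Proof. by move=> f; apply/ffunP=> x; rewrite galg_elt_mulr invg1 mulg1. Qed.

Lemma galg_mulDl : left_distributive galg_mul +%R.
Proof.
move=> f g h; apply/ffunP=> x; rewrite !ffunE -big_split /=.
by apply: eq_bigr => y _; rewrite ffunE mulrDl.
Qed.

Lemma galg_mulDr : right_distributive galg_mul +%R.
Proof.
move=> f g h; apply/ffunP=> x; rewrite !ffunE -big_split /=.
by apply: eq_bigr => y _; rewrite ffunE mulrDr.
Qed.

Lemma galg1_neq0 : galg_elt 1%g != 0.
Proof.
by apply/eqP=> /ffunP/(_ 1%g)/eqP; rewrite !ffunE eqxx oner_eq0.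
Qed.

HB.instance Definition _ := GRing.Zmodule_isNzRing.Build (group_alg k gT)
  galg_mulA galg_mul1l galg_mul1r galg_mulDl galg_mulDr galg1_neq0.

Lemma galg_scalerAl c f g : c *: (f * g) = (c *: f) * g.
Proof.
apply/ffunP=> x; rewrite !ffunE scaler_sumr; apply: eq_bigr => y _.
by rewrite ffunE -scalerAl.
Qed.

HB.instance Definition _ := GRing.Lmodule_isLalgebra.Build k (group_alg k gT)
  galg_scalerAl.

Lemma galg_scalerAr c f g : c *: (f * g) = f * (c *: g).
Proof.
apply/ffunP=> x; rewrite !ffunE scaler_sumr; apply: eq_bigr => y _.
by rewrite ffunE -scalerAr.
Qed.

HB.instance Definition _ := GRing.Lalgebra_isAlgebra.Build k (group_alg k gT)
  galg_scalerAr.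

HB.instance Definition _ := Algebra_isFalgebra.Build k (group_alg k gT).

Lemma galg_eltM x y : galg_elt (x * y)%g = galg_elt x * galg_elt y.
Proof.
apply/ffunP=> z; rewrite [RHS]galg_elt_mull !ffunE.
by rewrite (can2_eq (mulKVg x) (mulKg x)).
Qed.

End GroupAlgebra.

Section TensorMap.

Variables (k : fieldType) (U V : vectType k).

Lemma tensor_lfun_ext (W : vectType k) (f g : 'Hom(tensor U V, W)) :
  (forall u v, f (tens u v) = g (tens u v)) -> f = g.
Proof. by move=> fg; apply/lfunP; apply: tensor_ext. Qed.

Definition tens_map (U' V' : vectType k) (f : 'Hom(U, U')) (g : 'Hom(V, V')) :
    'Hom(tensor U V, tensor U' V') :=
  linfun (tensor_lift (fun u v => tens (f u) (g v))).

Lemma tens_mapE (U' V' : vectType k) (f : 'Hom(U, U')) (g : 'Hom(V, V')) u v :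
  tens_map f g (tens u v) = tens (f u) (g v).
Proof.
rewrite lfunE /= tensor_liftE //; split=> [u' a v' w|v' a u' w] /=.
  by rewrite linearP (tens_bilinear U' V').1.
by rewrite linearP (tens_bilinear U' V').2.
Qed.

Lemma tens_map_linearl (U' V' : vectType k) (g : 'Hom(V, V')) :
  linear (fun f : 'Hom(U, U') => tens_map f g).
Proof.
move=> a f f'; apply: tensor_lfun_ext => u v.
rewrite [RHS]add_lfunE [in RHS]scale_lfunE !tens_mapE add_lfunE scale_lfunE.
by rewrite (tens_bilinear U' V').2.
Qed.

Lemma tens_map_linearr (U' V' : vectType k) (f : 'Hom(U, U')) :
  linear (fun g : 'Hom(V, V') => tens_map f g).
Proof.
move=> a g g'; apply: tensor_lfun_ext => u v.
rewrite [RHS]add_lfunE [in RHS]scale_lfunE !tens_mapE add_lfunE scale_lfunE.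
by rewrite (tens_bilinear U' V').1.
Qed.

End TensorMap.

Lemma tens_map1 (k : fieldType) (U V : vectType k) :
  tens_map (\1%VF : 'End(U)) (\1%VF : 'End(V)) = \1%VF.
Proof. by apply: tensor_lfun_ext => u v; rewrite tens_mapE !id_lfunE. Qed.

Lemma tens_map_comp (k : fieldType) (U V U' V' U'' V'' : vectType k)
    (f' : 'Hom(U', U'')) (g' : 'Hom(V', V'')) (f : 'Hom(U, U')) (g : 'Hom(V, V')) :
  tens_map (f' \o f)%VF (g' \o g)%VF = (tens_map f' g' \o tens_map f g)%VF.
Proof.
by apply: tensor_lfun_ext => u v; rewrite comp_lfunE !tens_mapE !comp_lfunE.
Qed.

Section Quotient.

Variables (k : fieldType) (V : vectType k) (K : {vspace V}).

(* The quotient V / K is realized on a complement of K, the canonical surjection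
   being the projection along K. *)
Definition vquot : vectType k := subvs_of K^C.

Definition vquot_proj : 'Hom(V, vquot) :=
  (linfun (@vsproj k V K^C) \o daddv_pi K^C K)%VF.

Definition vquot_repr : 'Hom(vquot, V) := linfun (@vsval k V K^C).

Let capCK : (K^C :&: K = 0)%VS.
Proof. by rewrite capvC capv_compl. Qed.

Lemma vquot_reprE x : vquot_repr (vquot_proj x) = daddv_pi K^C K x.
Proof. by rewrite comp_lfunE !lfunE /= vsprojK ?memv_pi. Qed.

Lemma vquot_reprK : cancel vquot_repr vquot_proj.
Proof.
move=> q; rewrite comp_lfunE !lfunE /= daddv_pi_id ?subvsP //.
exact: vsvalK.
Qed.

Lemma vquot_repr_proj x : x - vquot_repr (vquot_proj x) \in K.
Proof.
rewrite vquot_reprE -{1}(@daddv_pi_add _ _ K^C K x) //.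
  by rewrite addrAC subrr add0r memv_pi.
by rewrite addvC addv_complf memvf.
Qed.

Lemma lker_vquot_proj : lker vquot_proj = K.
Proof.
apply/vspaceP=> x; rewrite memv_ker; apply/eqP/idP => [x0|xK].
  by have := vquot_repr_proj x; rewrite x0 linear0 subr0.
apply: (can_inj vquot_reprK); rewrite linear0 vquot_reprE.
have := daddv_pi_add capCK (_ : x \in _).
rewrite (@daddv_pi_id _ _ K K^C) ?capv_compl // => H.
by apply: (addIr x); rewrite add0r H // addvC addv_complf memvf.
Qed.

Definition vquot_map (f : 'End(V)) : 'End(vquot) :=
  (vquot_proj \o f \o vquot_repr)%VF.

Lemma vquot_mapE (f : 'End(V)) x : (f @: K <= K)%VS ->
  vquot_map f (vquot_proj x) = vquot_proj (f x).
Proof.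
move=> /subvP fK; rewrite 2!comp_lfunE; apply/eqP; rewrite eq_sym -subr_eq0.
rewrite -!linearB -memv_ker lker_vquot_proj fK // memv_img //.
exact: vquot_repr_proj.
Qed.

Lemma vquot_lfun_ext (W : vectType k) (f g : 'Hom(vquot, W)) :
  (forall x, f (vquot_proj x) = g (vquot_proj x)) -> f = g.
Proof. by move=> fg; apply/lfunP=> q; rewrite -(vquot_reprK q). Qed.

Lemma vquot_map_linear : linear vquot_map.
Proof.
move=> a f g; rewrite /vquot_map comp_lfunDr comp_lfunDl.
by rewrite -comp_lfunZr -comp_lfunZl.
Qed.

End Quotient.

Section Modules.

Variable k : fieldType.

Record lmodule (A : falgType k) := LModule {
  lmod_sort :> vectType k;
  lact : A -> 'End(lmod_sort);
  lact_linear : linear lact;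
  lact1 : lact 1 = \1%VF;
  lactM : forall a a', lact (a * a') = (lact a \o lact a')%VF
}.

Record rmodule (B : falgType k) := RModule {
  rmod_sort :> vectType k;
  ract : B -> 'End(rmod_sort);
  ract_linear : linear ract;
  ract1 : ract 1 = \1%VF;
  ractM : forall b b', ract (b * b') = (ract b' \o ract b)%VF
}.

Record bimodule (A B : falgType k) := BiModule {
  bimod_sort :> vectType k;
  blact : A -> 'End(bimod_sort);
  bract : B -> 'End(bimod_sort);
  blact_linear : linear blact;
  blact1 : blact 1 = \1%VF;
  blactM : forall a a', blact (a * a') = (blact a \o blact a')%VF;
  bract_linear : linear bract;
  bract1 : bract 1 = \1%VF;
  bractM : forall b b', bract (b * b') = (bract b' \o bract b)%VF;
  blactC : forall a b, (blact a \o bract b)%VF = (bract b \o blact a)%VF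
}.

Section Homs.

Variables A B : falgType k.

Definition lmod_hom (M N : lmodule A) (f : 'Hom(M, N)) : Prop :=
  forall a m, f (lact M a m) = lact N a (f m).

Definition rmod_hom (M N : rmodule B) (f : 'Hom(M, N)) : Prop :=
  forall b m, f (ract M b m) = ract N b (f m).

Definition bimod_hom (M N : bimodule A B) (f : 'Hom(M, N)) : Prop :=
  (forall a m, f (blact M a m) = blact N a (f m)) /\
  (forall b m, f (bract M b m) = bract N b (f m)).

Definition lmod_iso (M N : lmodule A) : Prop :=
  exists f : 'Hom(M, N), lmod_hom f /\ bijective f.

Definition bimod_iso (M N : bimodule A B) : Prop :=
  exists f : 'Hom(M, N), bimod_hom f /\ bijective f.

Definition lmod_projective (P : lmodule A) : Prop :=
  forall (M N : lmodule A) (f : 'Hom(M, N)) (g : 'Hom(P, N)),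
    lmod_hom f -> limg f = fullv -> lmod_hom g ->
  exists h : 'Hom(P, M), lmod_hom h /\ (f \o h)%VF = g.

Definition rmod_projective (P : rmodule B) : Prop :=
  forall (M N : rmodule B) (f : 'Hom(M, N)) (g : 'Hom(P, N)),
    rmod_hom f -> limg f = fullv -> rmod_hom g ->
  exists h : 'Hom(P, M), rmod_hom h /\ (f \o h)%VF = g.

Definition bimod_projective (P : bimodule A B) : Prop :=
  forall (M N : bimodule A B) (f : 'Hom(M, N)) (g : 'Hom(P, N)),
    bimod_hom f -> limg f = fullv -> bimod_hom g ->
  exists h : 'Hom(P, M), bimod_hom h /\ (f \o h)%VF = g.

Definition bimod_left (M : bimodule A B) : lmodule A :=
  LModule (@blact_linear A B M) (@blact1 A B M) (@blactM A B M).

Definition bimod_right (M : bimodule A B) : rmodule B :=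
  RModule (@bract_linear A B M) (@bract1 A B M) (@bractM A B M).

Definition pair_fun (V W : vectType k) (f : 'End(V)) (g : 'End(W))
    (x : V * W) : V * W := (f x.1, g x.2).

Lemma pair_fun_linear (V W : vectType k) (f : 'End(V)) (g : 'End(W)) :
  linear (pair_fun f g).
Proof. by move=> a x y; rewrite /pair_fun /= !linearP. Qed.

HB.instance Definition _ (V W : vectType k) (f : 'End(V)) (g : 'End(W)) :=
  GRing.isSemilinear.Build k (V * W)%type (V * W)%type _ (pair_fun f g)
    (GRing.semilinear_linear (pair_fun_linear f g)).

Definition lfun_pair (V W : vectType k) (f : 'End(V)) (g : 'End(W)) :
  'End((V * W)%type) := linfun (pair_fun f g).

Lemma lfun_pairE (V W : vectType k) (f : 'End(V)) (g : 'End(W)) x :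
  lfun_pair f g x = (f x.1, g x.2).
Proof. by rewrite lfunE. Qed.

Section DirectSum.

Variables M N : bimodule A B.

Fact bsum_lact_linear : linear (fun a => lfun_pair (blact M a) (blact N a)).
Proof.
move=> c a a'; apply/lfunP=> x; rewrite add_lfunE scale_lfunE !lfun_pairE.
by rewrite !blact_linear !add_lfunE !scale_lfunE.
Qed.

Fact bsum_ract_linear : linear (fun b => lfun_pair (bract M b) (bract N b)).
Proof.
move=> c b b'; apply/lfunP=> x; rewrite add_lfunE scale_lfunE !lfun_pairE.
by rewrite !bract_linear !add_lfunE !scale_lfunE.
Qed.

Fact bsum_lact1 : lfun_pair (blact M 1) (blact N 1) = \1%VF.
Proof.
by apply/lfunP=> -[x y]; rewrite lfun_pairE !blact1 !id_lfunE.
Qed.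

Fact bsum_ract1 : lfun_pair (bract M 1) (bract N 1) = \1%VF.
Proof.
by apply/lfunP=> -[x y]; rewrite lfun_pairE !bract1 !id_lfunE.
Qed.

Fact bsum_lactM a a' :
  lfun_pair (blact M (a * a')) (blact N (a * a')) =
  (lfun_pair (blact M a) (blact N a) \o lfun_pair (blact M a') (blact N a'))%VF.
Proof.
by apply/lfunP=> x; rewrite comp_lfunE !lfun_pairE !blactM !comp_lfunE.
Qed.

Fact bsum_ractM b b' :
  lfun_pair (bract M (b * b')) (bract N (b * b')) =
  (lfun_pair (bract M b') (bract N b') \o lfun_pair (bract M b) (bract N b))%VF.
Proof.
by apply/lfunP=> x; rewrite comp_lfunE !lfun_pairE !bractM !comp_lfunE.
Qed.

Fact bsum_lactC a b :
  (lfun_pair (blact M a) (blact N a) \o lfun_pair (bract M b) (bract N b) =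
   lfun_pair (bract M b) (bract N b) \o lfun_pair (blact M a) (blact N a))%VF.
Proof.
apply/lfunP=> x; rewrite !comp_lfunE !lfun_pairE /=.
by rewrite -![blact _ a _]comp_lfunE -![bract _ b _]comp_lfunE !blactC.
Qed.

Definition bimod_sum : bimodule A B :=
  BiModule bsum_lact_linear bsum_lact1 bsum_lactM
           bsum_ract_linear bsum_ract1 bsum_ractM bsum_lactC.

End DirectSum.

End Homs.

Section Regular.

Variable A : falgType k.

(* In falgebra, amulr a is x |-> x * a and amull a is x |-> a * x. *)

Fact amull_comp (a a' : A) : amull (a * a') = (amull a \o amull a')%VF.
Proof. by apply/lfunP=> x; rewrite comp_lfunE !lfunE /= mulrA. Qed.

Fact amulr_comp (a a' : A) : amulr (a * a') = (amulr a' \o amulr a)%VF.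
Proof. by apply/lfunP=> x; rewrite comp_lfunE !lfunE /= mulrA. Qed.

Fact amulr1 : amulr (1 : A) = \1%VF.
Proof. by apply/lfunP=> x; rewrite id_lfunE lfunE /= mulr1. Qed.

Fact amull_amulrC (a b : A) :
  (amull a \o amulr b)%VF = (amulr b \o amull a)%VF.
Proof. by apply/lfunP=> x; rewrite !comp_lfunE !lfunE /= mulrA. Qed.

Definition lmod_regular : lmodule A :=
  LModule (@amull_is_linear k A) (@amull1 k A) amull_comp.

Definition bimod_regular : bimodule A A :=
  BiModule (@amull_is_linear k A) (@amull1 k A) amull_comp
           (@amulr_is_linear k A) amulr1 amulr_comp amull_amulrC.

End Regular.

Section BimoduleTensor.

Variables (A B C : falgType k) (M : bimodule A B) (N : bimodule B C).

Definition btensor_defect (b : B) : 'End(tensor M N) :=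
  tens_map (bract M b) \1%VF - tens_map \1%VF (blact N b).

(* By linearity in b, this is the subspace spanned by all the elements
   mb (x) n - m (x) bn; see btensor_universal below. *)
Definition btensor_rel : {vspace tensor M N} :=
  (\sum_(i < \dim {:B}) limg (btensor_defect (vbasis {:B})`_i))%VS.

Definition btens (m : M) (n : N) : vquot btensor_rel :=
  vquot_proj btensor_rel (tens m n).

Let defectE b m n : btensor_defect b (tens m n) =
  tens (bract M b m) n - tens m (blact N b n).
Proof. by rewrite add_lfunE opp_lfunE !tens_mapE !id_lfunE. Qed.

Let rel_defect b x : btensor_defect b x \in btensor_rel.
Proof.
have lin : linear btensor_defect.
  move=> c b1 b2; rewrite /btensor_defect bract_linear blact_linear.
  by rewrite tens_map_linearl tens_map_linearr scalerBr opprD addrACA.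
pose d : {linear B -> 'End(tensor M N)} := HB.pack btensor_defect
  (GRing.isLinear.Build k B 'End(tensor M N) _ btensor_defect lin).
rewrite -[btensor_defect]/(d : _ -> _) (coord_vbasis (memvf b)) linear_sum.
rewrite sum_lfunE memv_suml // => i _; rewrite linearZ scale_lfunE memvZ //.
by apply: (subvP (sumv_sup i _ (subvv _))); rewrite ?memv_img ?memvf.
Qed.

Lemma btens_balanced m b n : btens (bract M b m) n = btens m (blact N b n).
Proof.
apply/eqP; rewrite -subr_eq0 -linearB -memv_ker lker_vquot_proj -defectE.
exact: rel_defect.
Qed.

Lemma btens_bilinear : bilinear_map btens.
Proof.
split=> [m c n n'|n c m m']; rewrite /btens.
  by rewrite (tens_bilinear M N).1 linearP.
by rewrite (tens_bilinear M N).2 linearP.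
Qed.

Lemma btensor_lfun_ext (W : vectType k) (f g : 'Hom(vquot btensor_rel, W)) :
  (forall m n, f (btens m n) = g (btens m n)) -> f = g.
Proof.
move=> fg; apply: vquot_lfun_ext => x; rewrite -2!comp_lfunE.
suff -> : (f \o vquot_proj _ = g \o vquot_proj _)%VF by [].
apply: tensor_lfun_ext => m n; rewrite [LHS]comp_lfunE [RHS]comp_lfunE.
exact: fg.
Qed.

Lemma btensor_universal (W : vectType k) (f : M -> N -> W) :
  bilinear_map f ->
  (forall m b n, f (bract M b m) n = f m (blact N b n)) ->
  exists g : 'Hom(vquot btensor_rel, W), forall m n, g (btens m n) = f m n.
Proof.
move=> bf ff; pose F : 'Hom(tensor M N, W) := linfun (tensor_lift f).
have FE m n : F (tens m n) = f m n by rewrite lfunE /= tensor_liftE.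
exists (F \o vquot_repr btensor_rel)%VF => m n; rewrite comp_lfunE -FE.
apply/eqP; rewrite eq_sym -subr_eq0 -linearB -memv_ker.
apply: (subvP _ _ (vquot_repr_proj _ _)); apply/subv_sumP => i _.
apply/subvP=> _ /memv_imgP[x _ ->]; rewrite memv_ker -comp_lfunE.
suff -> : (F \o btensor_defect (vbasis {:B})`_i)%VF = 0 by rewrite zero_lfunE.
apply: tensor_lfun_ext => m' n'; rewrite comp_lfunE defectE linearB /= !FE.
by rewrite ff subrr zero_lfunE.
Qed.

Let lactT (a : A) : 'End(tensor M N) := tens_map (blact M a) \1%VF.
Let ractT (c : C) : 'End(tensor M N) := tens_map \1%VF (bract N c).

Let commK (f : 'End(tensor M N)) :
  (forall b, (f \o btensor_defect b = btensor_defect b \o f)%VF) ->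
  (f @: btensor_rel <= btensor_rel)%VS.
Proof.
move=> fC; rewrite limg_sum; apply/subv_sumP => i _.
rewrite -limg_comp fC limg_comp (sumv_sup i) // limgS //.
exact: subvf.
Qed.

Let lactK a : (lactT a @: btensor_rel <= btensor_rel)%VS.
Proof.
apply: commK => b; rewrite comp_lfunDr comp_lfunDl comp_lfunNr comp_lfunNl.
by rewrite -!tens_map_comp !comp_lfun1l !comp_lfun1r blactC.
Qed.

Let ractK c : (ractT c @: btensor_rel <= btensor_rel)%VS.
Proof.
apply: commK => b; rewrite comp_lfunDr comp_lfunDl comp_lfunNr comp_lfunNl.
by rewrite -!tens_map_comp !comp_lfun1l !comp_lfun1r blactC.
Qed.

Definition btensor_lact (a : A) : 'End(vquot btensor_rel) :=
  vquot_map btensor_rel (tens_map (blact M a) \1%VF).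

Definition btensor_ract (c : C) : 'End(vquot btensor_rel) :=
  vquot_map btensor_rel (tens_map \1%VF (bract N c)).

Lemma btensor_lactE a m n : btensor_lact a (btens m n) = btens (blact M a m) n.
Proof.
rewrite /btensor_lact vquot_mapE; last exact: lactK.
by rewrite tens_mapE id_lfunE.
Qed.

Lemma btensor_ractE c m n : btensor_ract c (btens m n) = btens m (bract N c n).
Proof.
rewrite /btensor_ract vquot_mapE; last exact: ractK.
by rewrite tens_mapE id_lfunE.
Qed.

Fact btensor_lact_linear : linear btensor_lact.
Proof.
move=> c a a'.
by rewrite /btensor_lact blact_linear tens_map_linearl vquot_map_linear.
Qed.

Fact btensor_ract_linear : linear btensor_ract.
Proof.
move=> c a a'.
by rewrite /btensor_ract bract_linear tens_map_linearr vquot_map_linear.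
Qed.

Fact btensor_lact1 : btensor_lact 1 = \1%VF.
Proof.
by apply: btensor_lfun_ext => m n; rewrite btensor_lactE blact1 !id_lfunE.
Qed.

Fact btensor_ract1 : btensor_ract 1 = \1%VF.
Proof.
by apply: btensor_lfun_ext => m n; rewrite btensor_ractE bract1 !id_lfunE.
Qed.

Fact btensor_lactM a a' :
  btensor_lact (a * a') = (btensor_lact a \o btensor_lact a')%VF.
Proof.
apply: btensor_lfun_ext => m n.
by rewrite comp_lfunE !btensor_lactE blactM comp_lfunE.
Qed.

Fact btensor_ractM c c' :
  btensor_ract (c * c') = (btensor_ract c' \o btensor_ract c)%VF.
Proof.
apply: btensor_lfun_ext => m n.
by rewrite comp_lfunE !btensor_ractE bractM comp_lfunE.
Qed.

Fact btensor_lactC a c :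
  (btensor_lact a \o btensor_ract c = btensor_ract c \o btensor_lact a)%VF.
Proof.
apply: btensor_lfun_ext => m n.
rewrite [LHS]comp_lfunE [RHS]comp_lfunE.
by rewrite btensor_lactE !btensor_ractE btensor_lactE.
Qed.

Definition bimod_tensor : bimodule A C :=
  BiModule btensor_lact_linear btensor_lact1 btensor_lactM
           btensor_ract_linear btensor_ract1 btensor_ractM btensor_lactC.

End BimoduleTensor.

Definition stably_equiv_morita (A B : falgType k) : Prop :=
  exists (M : bimodule A B) (N : bimodule B A)
         (P : bimodule A A) (Q : bimodule B B),
  [/\ lmod_projective (bimod_left M) /\ rmod_projective (bimod_right M),
      lmod_projective (bimod_left N) /\ rmod_projective (bimod_right N),
      bimod_projective P /\ bimod_projective Q,
      bimod_iso (bimod_tensor M N) (bimod_sum (bimod_regular A) P)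
    & bimod_iso (bimod_tensor N M) (bimod_sum (bimod_regular B) Q)].

(* The factors A1 and A2 are nonzero because a falgType has 1 != 0. *)
Definition indecomposable_alg (A : falgType k) : Prop :=
  ~ exists (A1 A2 : falgType k) (f : {lrmorphism A -> (A1 * A2)%type}),
      bijective f.

Section Simple.

Variable A : falgType k.

Definition submodule (M : lmodule A) (U : {vspace M}) : Prop :=
  forall a, (lact M a @: U <= U)%VS.

Definition simple_submodule (M : lmodule A) (U : {vspace M}) : Prop :=
  [/\ submodule U, U != 0%VS
    & forall W : {vspace M}, submodule W -> (W <= U)%VS -> W = 0%VS \/ W = U].

Definition simple_module (M : lmodule A) : Prop :=
  simple_submodule (fullv : {vspace M}).

Definition semisimple_module (M : lmodule A) : Prop :=
  exists (n : nat) (U : 'I_n -> {vspace M}),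
  [/\ forall i, simple_submodule (U i), directv (\sum_i U i)
    & (\sum_i U i = fullv)%VS].

Definition semisimple_alg : Prop := semisimple_module (lmod_regular A).

Definition num_nonprojective_simples (n : nat) : Prop :=
  exists S : 'I_n -> lmodule A,
  [/\ forall i, simple_module (S i) /\ ~ lmod_projective (S i),
      forall i j, lmod_iso (S i) (S j) -> i = j
    & forall T : lmodule A, simple_module T -> ~ lmod_projective T ->
        exists i, lmod_iso T (S i)].

End Simple.

Definition auslander_reiten_holds (A B : falgType k) : Prop :=
  exists n, num_nonprojective_simples A n /\ num_nonprojective_simples B n.

End Modules.

(* Main.v *)
(** Let K(A) be the span of the commutators, l(A) the number of simple modules
    and R(A) the image of the radical in A/K(A), so that
    dim R(A) = dim A/K(A) - l(A), k being algebraically closed.  A bimodule M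
    which is projective over B induces a transfer A/K(A) -> B/K(B), a |-> the
    Hattori-Stallings trace of a acting on M.  It maps R(A) into R(B), it is
    functorial for tensor products, and for a projective bimodule it kills
    R(A); hence a stable equivalence of Morita type gives
    dim R(A) = dim R(B).  As C_p is an abelian p-group in characteristic p,
    A (x) kC_p has as many simple modules as A and its space A/K(A) is p times
    bigger.  Subtracting the two equalities, dim R(A) = dim R(B) and its
    analogue for the group algebras, gives l(A) = l(B).

    It remains to compare the simple projective modules.  The exact functors
    Hom_A(M, -) and Hom_B(N, -) preserve injective modules and are mutually
    inverse up to injective summands.  If S is simple projective and not
    injective, a composition factor T of Hom_A(M, S) such that
    Hom_B(N, T) maps onto S is again simple projective and not injective, and
    it determines S.  Finally, a simple module which is both projective and
    injective generates a matrix algebra block, which is excluded by the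
    hypotheses. *)
Require Import Defs.
From HB Require Import structures.
From mathcomp Require Import all_boot all_order all_fingroup all_solvable.
From mathcomp Require Import all_algebra all_field.
From mathcomp Require Import boolp zify.

Set Implicit Arguments.
Unset Strict Implicit.
Unset Printing Implicit Defensive.

Import GRing.Theory.
Local Open Scope ring_scope.

(** * Linear algebra *)

Section LinearAlgebra.
Variable k : fieldType.

(** A simple projective module becomes zero modulo projective modules, so the second half works
    modulo maps that factor through injective modules: there it survives unless it is injective,
    since a nonzero map onto it splits. Hom functors suit this choice, because a right dual basis of
    M is all that is needed for Hom_A(M, -) to respect such maps. No radical is ever built. R(A) is
    represented by the common kernel of the irreducible characters modulo K(A); density writes each
    element of that kernel as a sum of commutators plus an element killing all simple modules, and
    such an element is nilpotent. Transfers thus have to be understood only on commutators and on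
    nilpotent elements, where traces are controlled by linear algebra. Algebraic closure enters
    through Schur's lemma, the characteristic through the nilpotency of g - 1 in the group algebra.
    Both comparisons are proved as inequalities and then applied in the two directions. *)

Lemma linfunP (U V : vectType k) (f : U -> V) :
  linear f -> exists F : 'Hom(U, V), forall x, F x = f x.
Proof.
move=> lf; pose g : {linear U -> V} :=
  HB.pack f (GRing.isLinear.Build k U V _ f lf).
by exists (linfun g) => x; rewrite lfunE.
Qed.

Definition linear_pred (V : lmodType k) (P : V -> Prop) : Prop :=
  P 0 /\ forall c x y, P x -> P y -> P (c *: x + y).

Section PredSpace.
Variables (V : vectType k) (P : V -> Prop).

(** A subspace of largest dimension inside [P] contains every element satisfying [P], since
    adjoining a line does not leave [P]. The hypothesis stays under the existential so that a
    subspace can be chosen for every [P]. *)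
Lemma pred_vspace_exists : exists U : {vspace V},
  linear_pred P -> forall x, x \in U <-> P x.
Proof.
have [lP|nP] := pselect (linear_pred P); last by exists 0%VS.
case: lP => P0 PD.
pose Q n := `[< exists U : {vspace V}, \dim U = n /\ forall x, x \in U -> P x >].
have exQ : exists n, Q n.
  exists 0; apply/asboolP; exists 0%VS; rewrite dimv0; split=> // x.
  by rewrite memv0 => /eqP->.
have ubQ n : Q n -> (n <= \dim {:V})%N.
  by move=> /asboolP[U [<- _]]; rewrite dimvS ?subvf.
case: (ex_maxnP exQ ubQ) => n /asboolP[U [dU UP]] maxU.
exists U => _ x; split; first exact: UP.
move=> Px; have /asboolP : Q (\dim (U + <[x]>)).
  apply/asboolP; exists (U + <[x]>)%VS; split=> // y /memv_addP[u uU [v]].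
  move=> /vlineP[c ->] ->; rewrite addrC; apply: PD => //; exact: UP.
move=> /asboolP/maxU; rewrite -dU => le.
have /eqP -> : U == (U + <[x]>)%VS by rewrite eqEdim addvSl.
by rewrite memvE addvSr.
Qed.

(* An unspecified subspace when P is not closed under linear combinations. *)
Definition pred_vspace : {vspace V} := projT1 (cid pred_vspace_exists).

Lemma mem_pred_vspace x : linear_pred P -> x \in pred_vspace <-> P x.
Proof. by move=> lP; exact: (projT2 (cid pred_vspace_exists) lP x). Qed.

End PredSpace.

Definition ltrace (V : vectType k) (u : 'End(V)) : k :=
  \sum_i coord (vbasis {:V}) i (u (vbasis {:V})`_i).

(** The [e t] need not form a basis: any expression of the identity as a sum of maps of rank at most
    one computes the trace. *)
Lemma ltrace_dual_basis (V : vectType k) (I : finType) (e : I -> V)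
    (c : I -> 'Hom(V, k^o)) (u : 'End(V)) :
  (forall x, \sum_t c t x *: e t = x) -> ltrace u = \sum_t c t (u (e t)).
Proof.
move=> ec; transitivity
  (\sum_t \sum_(i < \dim {:V}) c t (u (vbasis {:V})`_i) * coord (vbasis {:V}) i (e t)).
  rewrite exchange_big; apply: eq_bigr => i _ /=.
  by rewrite -{1}(ec (u _)) linear_sum /=; apply: eq_bigr => t _; rewrite linearZ.
apply: eq_bigr => t _; rewrite [in RHS](coord_vbasis (memvf (e t))) !linear_sum.
by apply: eq_bigr => i _; rewrite /= !linearZ /= mulrC.
Qed.

Lemma ltraceC (V W : vectType k) (u : 'Hom(V, W)) (v : 'Hom(W, V)) :
  ltrace (v \o u)%VF = ltrace (u \o v)%VF.
Proof.
pose b := vbasis {:V}; pose d := vbasis {:W}.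
transitivity (\sum_(i < \dim {:V}) \sum_j coord d j (u b`_i) * coord b i (v d`_j)).
  apply: eq_bigr => i _; rewrite comp_lfunE {1}(coord_vbasis (memvf (u _))).
  by rewrite !linear_sum; apply: eq_bigr => j _; rewrite /= !linearZ.
rewrite exchange_big; apply: eq_bigr => j _ /=.
rewrite comp_lfunE {2}(coord_vbasis (memvf (v _))).
by rewrite !linear_sum; apply: eq_bigr => i _; rewrite /= !linearZ /= mulrC.
Qed.

Lemma ltraceD (V : vectType k) (u v : 'End(V)) :
  ltrace (u + v) = ltrace u + ltrace v.
Proof.
by rewrite /ltrace -big_split; apply: eq_bigr => i _; rewrite add_lfunE linearD.
Qed.

Lemma ltraceZ (V : vectType k) c (u : 'End(V)) : ltrace (c *: u) = c * ltrace u.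
Proof.
rewrite /ltrace mulr_sumr.
by apply: eq_bigr => i _; rewrite scale_lfunE linearZ.
Qed.

Lemma ltrace0 (V : vectType k) : ltrace (0 : 'End(V)) = 0.
Proof. by rewrite -(scale0r 0) ltraceZ mul0r. Qed.

(** [u] factors through its image as [i \o r], and [r \o i], the restriction of [u] to its image,
    has the same trace. The image is strictly smaller unless the space is zero, because a surjective
    nilpotent map forces the zero space. *)
Lemma ltrace_nilpotent (V : vectType k) (u : 'End(V)) n :
  (forall x, iter n u x = 0) -> ltrace u = 0.
Proof.
move: {2}(\dim {:V}) (leqnn (\dim {:V})) => d.
elim: d V u => [|d IHd] V u.
  rewrite leqn0 => /eqP d0 _; rewrite /ltrace big1 // => i _.
  by exfalso; have := ltn_ord i; rewrite [X in (_ < X)%N]d0.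
move=> led un; pose W : vectType k := subvs_of (limg u).
pose i : 'Hom(W, V) := linfun (@vsval k V (limg u)).
pose r : 'Hom(V, W) := (linfun (@vsproj k V (limg u)) \o u)%VF.
have ir x : i (r x) = u x.
  by rewrite lfunE comp_lfunE lfunE /= vsprojK // memv_img ?memvf.
have -> : u = (i \o r)%VF by apply/lfunP => x; rewrite comp_lfunE ir.
rewrite ltraceC; have [d0|] := posnP (\dim {:V}).
  rewrite /ltrace big1 // => j _; have : \dim {:W} = 0%N.
    apply/eqP; rewrite -leqn0 -d0 dimvf; exact: dimvS (subvf _).
  by move=> dW; exfalso; have := ltn_ord j; rewrite [X in (_ < X)%N]dW.
move=> dpos; apply: IHd => [|x].
  rewrite dimvf -ltnS; apply: leq_trans led.
  change (\dim (limg u) < \dim {:V})%N; rewrite ltnNge; apply/negP => le.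
  have sur : limg u = fullv by apply/eqP; rewrite eqEdim subvf.
  have surn m x : exists y, iter m u y = x.
    elim: m x => [|m IHm] x; first by exists x.
    have : x \in limg u by rewrite sur memvf.
    by move=> /memv_imgP[y _ ->]; have [z <-] := IHm y; exists z.
  suff : fullv = 0%VS :> {vspace V} by move=> V0; rewrite V0 dimv0 in dpos.
  apply/eqP; rewrite -subv0; apply/subvP => x _.
  by have [y <-] := surn n x; rewrite un mem0v.
have ii m y : i (iter m (r \o i)%VF y) = iter m u (i y).
  elim: m => //= m <-; by rewrite comp_lfunE ir.
apply/val_inj; rewrite -[LHS]/(val _); have := ii n x.
by rewrite un lfunE.
Qed.

End LinearAlgebra.

(** * Modules *)

Section LeftModules.
Variables (k : fieldType) (A : falgType k).
Implicit Types M N X Y S T : lmodule A.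

Lemma lactMx M a b m : lact M (a * b) m = lact M a (lact M b m).
Proof. by rewrite lactM comp_lfunE. Qed.

Lemma lact1x M m : lact M 1 m = m.
Proof. by rewrite lact1 id_lfunE. Qed.

Lemma lact_lin M c a b m : lact M (c *: a + b) m = c *: lact M a m + lact M b m.
Proof. by rewrite lact_linear add_lfunE scale_lfunE. Qed.

Lemma lact0x M m : lact M 0 m = 0.
Proof. by have := lact_lin (-1) 0 0 m; rewrite !scaleN1r !addNr. Qed.

Lemma lactDx M a b m : lact M (a + b) m = lact M a m + lact M b m.
Proof. by have := lact_lin 1 a b m; rewrite !scale1r. Qed.

Lemma lactZx M c a m : lact M (c *: a) m = c *: lact M a m.
Proof. by have := lact_lin c a 0 m; rewrite lact0x !addr0. Qed.

Lemma lactBx M a b m : lact M (a - b) m = lact M a m - lact M b m.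
Proof. by rewrite lactDx -scaleN1r lactZx scaleN1r. Qed.

Lemma lact_sumx M (I : Type) (r : seq I) (P : pred I) (F : I -> A) m :
  lact M (\sum_(i <- r | P i) F i) m = \sum_(i <- r | P i) lact M (F i) m.
Proof.
apply: (big_morph (fun a => lact M a m)) => [x y|]; first exact: lactDx.
exact: lact0x.
Qed.

Lemma lmod_hom_comp M N X (g : 'Hom(N, X)) (f : 'Hom(M, N)) :
  lmod_hom g -> lmod_hom f -> lmod_hom (g \o f)%VF.
Proof. by move=> hg hf a m; rewrite !comp_lfunE hf hg. Qed.

Lemma lmod_hom_id M : lmod_hom (\1%VF : 'Hom(M, M)).
Proof. by move=> a m; rewrite !id_lfunE. Qed.

Lemma lmod_hom0 M N : lmod_hom (0 : 'Hom(M, N)).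
Proof. by move=> a m; rewrite !zero_lfunE linear0. Qed.

Lemma lmod_homD M N (f g : 'Hom(M, N)) :
  lmod_hom f -> lmod_hom g -> lmod_hom (f + g).
Proof. by move=> hf hg a m; rewrite !add_lfunE hf hg linearD. Qed.

Lemma lmod_homZ M N c (f : 'Hom(M, N)) : lmod_hom f -> lmod_hom (c *: f).
Proof. by move=> hf a m; rewrite !scale_lfunE hf linearZ. Qed.

Lemma lmod_homB M N (f g : 'Hom(M, N)) :
  lmod_hom f -> lmod_hom g -> lmod_hom (f - g).
Proof.
by move=> hf hg; rewrite -scaleN1r; apply: lmod_homD => //; apply: lmod_homZ.
Qed.

Lemma submoduleP M (U : {vspace M}) :
  submodule U <-> forall a m, m \in U -> lact M a m \in U.
Proof.
split=> [sU a m mU | sU a]; first exact: (subvP (sU a)) (memv_img _ mU).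
by apply/subvP => _ /memv_imgP[m mU ->]; apply: sU.
Qed.

Lemma submodule_lker M N (f : 'Hom(M, N)) : lmod_hom f -> submodule (lker f).
Proof.
move=> hf; apply/submoduleP => a m; rewrite !memv_ker => /eqP fm.
by rewrite hf fm linear0.
Qed.

Lemma submodule_limg M N (f : 'Hom(M, N)) : lmod_hom f -> submodule (limg f).
Proof.
move=> hf; apply/submoduleP => a _ /memv_imgP[m _ ->].
by rewrite -hf memv_img ?memvf.
Qed.

Section Sub.
Variables (M : lmodule A) (U : {vspace M}) (sU : submodule U).

Definition sub_act (a : A) : 'End(subvs_of U) :=
  (linfun (@vsproj k M U) \o lact M a \o linfun (@vsval k M U))%VF.

Lemma sub_actE a u : vsval (sub_act a u) = lact M a (vsval u).
Proof.
rewrite 2!comp_lfunE !lfunE /= vsprojK //.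
by move/submoduleP: sU; apply; exact: subvsP.
Qed.

Fact sub_act_linear : linear sub_act.
Proof.
move=> c a b; apply/lfunP => u; apply: val_inj.
rewrite add_lfunE scale_lfunE.
transitivity (c *: vsval (sub_act a u) + vsval (sub_act b u)).
  by rewrite -[LHS]/(vsval _) !sub_actE lact_lin.
by rewrite -linearP.
Qed.

Fact sub_act1 : sub_act 1 = \1%VF.
Proof.
by apply/lfunP => u; apply: val_inj; rewrite /= sub_actE lact1x id_lfunE.
Qed.

Fact sub_actM a b : sub_act (a * b) = (sub_act a \o sub_act b)%VF.
Proof.
apply/lfunP => u; apply: val_inj.
by rewrite /= sub_actE lactMx comp_lfunE !sub_actE.
Qed.

Definition lmod_sub : lmodule A := LModule sub_act_linear sub_act1 sub_actM.

Definition sub_incl : 'Hom(lmod_sub, M) := linfun (@vsval k M U).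

Lemma sub_incl_hom : lmod_hom sub_incl.
Proof. by move=> a u; rewrite [LHS]lfunE [sub_incl u]lfunE; exact: sub_actE. Qed.

Lemma sub_inclP x : x \in U <-> exists u, sub_incl u = x.
Proof.
split=> [xU | [u <-]]; last by rewrite lfunE subvsP.
by exists (Subvs xU); rewrite lfunE.
Qed.

Lemma sub_incl_inj : injective sub_incl.
Proof. by move=> u v; rewrite !lfunE => /val_inj. Qed.

Lemma lmod_sub_simple : simple_submodule U -> simple_module lmod_sub.
Proof.
case=> _ U0 minU; split.
- by move=> a; exact: subvf.
- apply: contraNneq U0 => fU0; apply/eqP/eqP; rewrite -subv0; apply/subvP => x.
  move=> /sub_inclP[u <-].
  have /eqP-> : u == 0 by rewrite -memv0 -[0%VS]fU0 memvf.
  by rewrite linear0 mem0v.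
move=> W sW _; have sWM : submodule (sub_incl @: W)%VS.
  apply/submoduleP => a _ /memv_imgP[w wW ->]; rewrite -sub_incl_hom memv_img //.
  by move/submoduleP: sW; apply.
have leWU : (sub_incl @: W <= U)%VS.
  by apply/subvP => _ /memv_imgP[w _ ->]; apply/sub_inclP; exists w.
case: (minU _ sWM leWU) => eqW; [left|right].
  apply/eqP; rewrite -subv0; apply/subvP => w wW; rewrite memv0.
  have : sub_incl w \in 0%VS by rewrite -eqW memv_img.
  rewrite memv0 => /eqP iw; apply/eqP/sub_incl_inj.
  by rewrite iw linear0.
apply/eqP; rewrite eqEsubv subvf; apply/subvP => w _.
have : sub_incl w \in U by apply/sub_inclP; exists w.
by rewrite -eqW => /memv_imgP[w' w'W /sub_incl_inj->].
Qed.

Definition quot_act (a : A) : 'End(vquot U) := vquot_map U (lact M a).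

Lemma quot_actE a x : quot_act a (vquot_proj U x) = vquot_proj U (lact M a x).
Proof. by rewrite vquot_mapE //; apply: sU. Qed.

Fact quot_act_linear : linear quot_act.
Proof. by move=> c a b; rewrite /quot_act lact_linear vquot_map_linear. Qed.

Fact quot_act1 : quot_act 1 = \1%VF.
Proof.
by apply: vquot_lfun_ext => x; rewrite quot_actE lact1x id_lfunE.
Qed.

Fact quot_actM a b : quot_act (a * b) = (quot_act a \o quot_act b)%VF.
Proof.
by apply: vquot_lfun_ext => x; rewrite quot_actE lactMx comp_lfunE !quot_actE.
Qed.

Definition lmod_quot : lmodule A := LModule quot_act_linear quot_act1 quot_actM.

Definition quot_proj : 'Hom(M, lmod_quot) := vquot_proj U.

Lemma quot_proj_hom : lmod_hom quot_proj.
Proof. by move=> a x; rewrite -quot_actE. Qed.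

Lemma quot_proj_surj y : exists x, quot_proj x = y.
Proof. by exists (vquot_repr U y); rewrite /quot_proj vquot_reprK. Qed.

End Sub.

Lemma simple_submodule_exists M : fullv != 0%VS :> {vspace M} ->
  exists U : {vspace M}, simple_submodule U.
Proof.
move=> M0.
pose Q n := `[< exists U : {vspace M}, [/\ \dim U = n, submodule U & U != 0%VS] >].
have exQ : exists n, Q n.
  exists (\dim {:M}); apply/asboolP; exists fullv; split=> // a; exact: subvf.
case: (ex_minnP exQ) => n /asboolP[U [dU sU U0]] minn; exists U; split=> // W sW leW.
have [W0|W0] := eqVneq W 0%VS; [by left|right].
apply/eqP; rewrite eqEdim leW dU; apply: minn; apply/asboolP.
by exists W.
Qed.

(** Stands in for composition series: inductions on the dimension peel off a simple submodule and
    continue with the quotient. *)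
Lemma simple_extension M : fullv != 0%VS :> {vspace M} ->
  exists (U W : lmodule A) (i : 'Hom(U, M)) (p : 'Hom(M, W)),
    [/\ lmod_hom i, lmod_hom p, simple_module U & (\dim {:W} < \dim {:M})%N] /\
    [/\ injective i, forall y, exists x, p x = y
      & forall x, p x = 0 -> exists u, i u = x].
Proof.
move=> /simple_submodule_exists[U sU]; case: (sU) => mU U0 _.
exists (lmod_sub mU), (lmod_quot mU), (sub_incl mU), (quot_proj mU).
split; split.
- exact: sub_incl_hom.
- exact: quot_proj_hom.
- exact: lmod_sub_simple.
- rewrite [X in (X < _)%N]dimvf; change (\dim (U^C)%VS < \dim {:M})%N.
  rewrite dimv_compl ltn_subrL lt0n dimv_eq0 U0 /= lt0n dimv_eq0.
  by apply: contraNneq U0 => M0; rewrite -subv0 -M0 subvf.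
- exact: sub_incl_inj.
- exact: quot_proj_surj.
move=> x px0; apply/(sub_inclP mU); rewrite -(lker_vquot_proj U) memv_ker.
exact/eqP.
Qed.

Lemma simple_neq0 S : simple_module S -> exists s : S, s != 0.
Proof.
case=> _ S0 _; exists (vpick {:S}).
by rewrite vpick0.
Qed.

Lemma simple_sub S (U : {vspace S}) :
  simple_module S -> submodule U -> U = 0%VS \/ U = fullv.
Proof. by case=> _ _ minS sU; apply: minS; rewrite ?subvf. Qed.

Lemma hom_to_simple_surj M S (f : 'Hom(M, S)) m :
  simple_module S -> lmod_hom f -> f m != 0 -> forall y, exists x, f x = y.
Proof.
move=> sS hf fm y; case: (simple_sub sS (submodule_limg hf)) => imf.
  by case/negP: fm; rewrite -memv0 -imf memv_img ?memvf.
have : y \in limg f by rewrite imf memvf.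
by move=> /memv_imgP[x _ ->]; exists x.
Qed.

Lemma hom_from_simple_inj M S (f : 'Hom(S, M)) s :
  simple_module S -> lmod_hom f -> f s != 0 -> injective f.
Proof.
move=> sS hf fs; case: (simple_sub sS (submodule_lker hf)) => kf.
  by apply/lker0P; rewrite kf.
by case/negP: fs; rewrite -memv_ker kf memvf.
Qed.

Lemma lfun_bijective (U V : vectType k) (f : 'Hom(U, V)) :
  injective f -> (forall y, exists x, f x = y) -> bijective f.
Proof.
move=> fi fs; exists (f^-1)%VF => [|y]; first exact/lker0_lfunK/lker0P.
by apply: limg_lfunVK; have [x <-] := fs y; rewrite memv_img ?memvf.
Qed.

Lemma schur_bijective S T (f : 'Hom(S, T)) s :
  simple_module S -> simple_module T -> lmod_hom f -> f s != 0 -> bijective f.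
Proof.
move=> sS sT hf fs; apply: lfun_bijective; first exact: (hom_from_simple_inj sS hf fs).
exact: (hom_to_simple_surj sT hf fs).
Qed.

Lemma lmod_hom_inv M N (f : 'Hom(M, N)) : lmod_hom f -> bijective f ->
  exists g : 'Hom(N, M), [/\ lmod_hom g, cancel f g & cancel g f].
Proof.
move=> hf [g fK gK]; have lg : linear g.
  by move=> c x y; apply: (can_inj fK); rewrite linearP /= !gK.
have [G GE] := linfunP lg; exists G; split=> [a x|x|x]; rewrite ?GE //.
by apply: (can_inj fK); rewrite hf !gK.
Qed.

Lemma lmod_iso_sym M N : lmod_iso M N -> lmod_iso N M.
Proof.
case=> f [hf bf]; have [g [hg fK gK]] := lmod_hom_inv hf bf.
by exists g; split=> //; exists f.
Qed.

Lemma lmod_iso_trans M N X : lmod_iso M N -> lmod_iso N X -> lmod_iso M X.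
Proof.
case=> f [hf bf] [g [hg bg]]; exists (g \o f)%VF.
split; first exact: lmod_hom_comp.
by apply: (eq_bij (bij_comp bg bf)) => x; rewrite comp_lfunE.
Qed.

End LeftModules.

(** * Density *)

Lemma eigenvector_exists (k : closedFieldType) (V : vectType k) (u : 'End(V)) :
  fullv != 0%VS :> {vspace V} -> exists c x, x != 0 /\ u x = c *: x.
Proof.
move=> V0; pose b := vbasis {:V}.
pose B : 'M[k]_(\dim {:V}) := \matrix_(i, j) coord b j (u b`_i).
have : size (char_poly B) != 1%N by rewrite size_char_poly eqSS dimv_eq0.
move=> /closed_rootP[c]; rewrite -eigenvalue_root_char => /eigenvalueP[v vB v0].
exists c, (\sum_i v 0 i *: b`_i); split.
  apply: contraNneq v0 => x0; apply/eqP/matrixP => i j; rewrite ord1 mxE {i}.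
  have /freeP : free b := basis_free (vbasisP _).
  by apply; exact: x0.
rewrite linear_sum scaler_sumr /=.
transitivity (\sum_i \sum_j (v 0 i * B i j) *: b`_j).
  apply: eq_bigr => i _; rewrite linearZ /= {1}(coord_vbasis (memvf (u _))).
  by rewrite scaler_sumr; apply: eq_bigr => j _; rewrite mxE scalerA.
rewrite exchange_big; apply: eq_bigr => j _ /=.
rewrite -scaler_suml scalerA; congr (_ *: _).
by have /matrixP/(_ 0 j) := vB; rewrite !mxE.
Qed.

Section Density.
Variables (k : closedFieldType) (A : falgType k).
Implicit Types (M S T : lmodule A).

Lemma schur_scalar S (h : 'Hom(S, S)) :
  simple_module S -> lmod_hom h -> exists c, h = c *: \1%VF.
Proof.
move=> sS hh; have [c [x [x0 hx]]] := eigenvector_exists h (let: And3 _ p _ := sS in p).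
exists c; apply/eqP; rewrite -subr_eq0; apply/negPn/negP => nz.
have hg : lmod_hom (h - c *: \1%VF).
  by apply: lmod_homB => //; apply: lmod_homZ; apply: lmod_hom_id.
case: (simple_sub sS (submodule_lker hg)) => ker.
  case/negP: x0; rewrite -memv0 -ker memv_ker add_lfunE opp_lfunE scale_lfunE.
  by rewrite id_lfunE hx subrr.
case/negP: nz; apply/eqP/lfunP => y; rewrite [RHS]zero_lfunE.
by apply/eqP; rewrite -memv_ker ker memvf.
Qed.

Definition left_ideal (I : A -> Prop) : Prop :=
  linear_pred I /\ forall x a, I a -> I (x * a).

Lemma full_left_ideal : left_ideal (fun=> True).
Proof. by []. Qed.

Lemma linear_predD (V : lmodType k) (P : V -> Prop) x y :
  linear_pred P -> P x -> P y -> P (x + y).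
Proof. by case=> _ PD Px Py; rewrite -[x]scale1r; apply: PD. Qed.

Lemma linear_predZ (V : lmodType k) (P : V -> Prop) c x :
  linear_pred P -> P x -> P (c *: x).
Proof. by case=> P0 PD Px; rewrite -[_ *: _]addr0; apply: PD. Qed.

Lemma linear_predB (V : lmodType k) (P : V -> Prop) x y :
  linear_pred P -> P x -> P y -> P (x - y).
Proof.
move=> lP Px Py; apply: linear_predD => //; rewrite -scaleN1r.
exact: linear_predZ.
Qed.

Lemma ideal_orbit_full S (I : A -> Prop) s a : simple_module S ->
  left_ideal I -> I a -> lact S a s != 0 ->
  forall t, exists2 b, I b & lact S b s = t.
Proof.
move=> sS [lI mI] Ia as0 t.
pose P t := exists2 b, I b & lact S b s = t.
have lP : linear_pred P.
  split; first by exists 0; [case: lI | rewrite lact0x].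
  move=> c _ _ [b Ib <-] [b' Ib' <-]; exists (c *: b + b'); last exact: lact_lin.
  by case: lI => _; apply.
have sP : submodule (pred_vspace P).
  apply/submoduleP => x m /(mem_pred_vspace _ lP)[b Ib <-].
  by apply/(mem_pred_vspace _ lP); exists (x * b); [apply: mI | rewrite lactMx].
apply/(mem_pred_vspace _ lP).
case: (simple_sub sS sP) => eqW; last by rewrite eqW memvf.
by case/negP: as0; rewrite -memv0 -eqW; apply/(mem_pred_vspace _ lP); exists a.
Qed.

Lemma left_ideal_annihilator (I : A -> Prop) T (X : seq T) : left_ideal I ->
  left_ideal (fun a => I a /\ forall u, u \in X -> lact T a u = 0).
Proof.
case=> lI mI; split; [split|].
- by split=> [|u _]; [case: lI | rewrite lact0x].
- move=> c a b [Ia aX] [Ib bX]; split; first by case: lI => _; apply.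
  by move=> u uX; rewrite lact_lin aX // bX // scaler0 addr0.
by move=> x a [Ia aX]; split=> [|u uX]; [apply: mI | rewrite lactMx aX ?linear0].
Qed.

(** The map [a w |-> a s] is well defined because inside [I] annihilating [w] implies annihilating
    [s]; it is defined on all of [T] because [I w] is a nonzero submodule. *)
Lemma ideal_hom (I : A -> Prop) T S (w : T) (s : S) a : simple_module T ->
  left_ideal I -> (forall a, I a -> lact T a w = 0 -> lact S a s = 0) ->
  I a -> lact T a w != 0 ->
  exists h : 'Hom(T, S), lmod_hom h /\
    forall a, I a -> h (lact T a w) = lact S a s.
Proof.
move=> sT lmI ker Ia aw0; have [lI mI] := lmI.
have orb t : exists b, I b /\ lact T b w = t.
  by have [b Ib bw] := ideal_orbit_full sT lmI Ia aw0 t; exists b.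
have [g gP] := choice orb.
have ker2 b b' : I b -> I b' -> lact T b w = lact T b' w -> lact S b s = lact S b' s.
  move=> Ib Ib' eqb; apply/eqP; rewrite -subr_eq0 -lactBx; apply/eqP/ker.
    exact: (linear_predB lI Ib Ib').
  by rewrite lactBx eqb subrr.
have lg : linear (fun t => lact S (g t) s).
  move=> c t t'; rewrite -lact_lin; apply: ker2; first exact: (gP _).1.
    by case: lI => _; apply; apply: (gP _).1.
  by rewrite lact_lin !(gP _).2.
have [h hE] := linfunP lg; exists h.
have hw b : I b -> h (lact T b w) = lact S b s.
  by move=> Ib; rewrite hE; apply: ker2 => //; [apply: (gP _).1 | apply: (gP _).2].
split=> // x t; have [Ib bw] := gP t; rewrite -bw -lactMx !hw ?lactMx //.
exact: mI.
Qed.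

(** The core of the density theorem, by induction on [X]. If an element of [I] killing [X] moves the
    new vector [w], then [a w |-> a s] is a homomorphism, hence [c *: h0], and [s - c *: h0 w] falls
    under the induction hypothesis. Used with [h0 = 0] to separate non-isomorphic simple modules,
    and with [h0 = 1] on a single one. *)
Lemma ideal_separation (I : A -> Prop) T S (h0 : 'Hom(T, S)) (X : seq T) s :
  simple_module T -> left_ideal I -> lmod_hom h0 ->
  (forall h : 'Hom(T, S), lmod_hom h -> exists c, h = c *: h0) ->
  (forall a, I a -> (forall u, u \in X -> lact T a u = 0) -> lact S a s = 0) ->
  exists2 u, u \in <<X>>%VS & forall a, I a -> lact S a s = lact S a (h0 u).
Proof.
move=> sT lI hh0 hom1; elim: X s => [|w X IHX] s sX.
  by exists 0; rewrite ?mem0v // => a Ia; rewrite !linear0; apply: sX.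
pose J a := I a /\ forall u, u \in X -> lact T a u = 0.
have lJ : left_ideal J := left_ideal_annihilator X lI.
have sw a : J a -> lact T a w = 0 -> lact S a s = 0.
  move=> [Ia aX] aw; apply: sX => // u; rewrite inE => /orP[/eqP->//|].
  exact: aX.
have [[a [Ja aw]]|noa] := pselect (exists a, J a /\ lact T a w != 0).
  have [h [hh hw]] := ideal_hom sT lJ sw Ja aw.
  have [c hc] := hom1 h hh.
  have [|u uX su] := IHX (s - c *: h0 w).
    move=> b Ib bX; rewrite linearB linearZ /= -hh0 -hw //.
    by rewrite hc scale_lfunE subrr.
  exists (u + c *: w).
    by rewrite span_cons addrC memv_add // memvZ // memv_line.
  move=> b Ib; have := su b Ib; rewrite linearB /= => /eqP.
  rewrite subr_eq => /eqP ->.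
  have -> : h0 (u + c *: w) = h0 u + c *: h0 w by rewrite linearD linearZ.
  by rewrite linearD.
have [|u uX su] := IHX s.
  move=> a Ia aX; apply: sw => //; apply/eqP/negPn/negP => aw.
  by apply: noa; exists a.
exists u => //; rewrite span_cons; apply: subvP uX; exact: addvSr.
Qed.

Lemma simple_separate S T (s : S) : simple_module S -> simple_module T ->
  ~ lmod_iso T S -> s != 0 ->
  exists2 a, (forall t, lact T a t = 0) & lact S a s != 0.
Proof.
move=> sS sT nTS s0; apply: contrapT => nex.
have zhom (h : 'Hom(T, S)) : lmod_hom h -> exists c, h = c *: 0.
  move=> hh; exists 0; rewrite scaler0; apply/lfunP => t; rewrite zero_lfunE.
  apply/eqP/negPn/negP => ht; apply: nTS; exists h; split=> //.
  exact: (schur_bijective sT sS hh ht).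
have [||u _ /(_ 1 Logic.I)] :=
  @ideal_separation (fun=> True) T S 0 (vbasis {:T}) s sT full_left_ideal _ zhom.
- exact: lmod_hom0.
- move=> a _ aX; apply/eqP/negPn/negP => as0; apply: nex; exists a => // t.
  rewrite (coord_vbasis (memvf t)) linear_sum big1 // => i _.
  by rewrite linearZ /= aX ?scaler0 // mem_nth // size_tuple.
- by rewrite zero_lfunE linear0 lact1x => /eqP; apply/negP.
Qed.

Lemma simple_separate_seq (J : eqType) (r : seq J) (T : J -> lmodule A) S (s : S) :
  simple_module S -> (forall j, j \in r -> simple_module (T j)) ->
  (forall j, j \in r -> ~ lmod_iso (T j) S) -> s != 0 ->
  exists2 a, (forall j, j \in r -> forall t, lact (T j) a t = 0) & lact S a s != 0.
Proof.
move=> sS; elim: r => [|j r IHr] sT nT s0; first by exists 1; rewrite ?lact1x.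
have [||//|a aT as0] := IHr.
- by move=> i ir; apply: sT; rewrite inE ir orbT.
- by move=> i ir; apply: nT; rewrite inE ir orbT.
have [|b bT bas] := simple_separate sS (sT j (mem_head _ _)) _ as0.
  by apply: nT; rewrite mem_head.
exists (b * a); last by rewrite lactMx.
move=> i; rewrite inE => /orP[/eqP->|ir] t; first by rewrite lactMx bT.
by rewrite lactMx aT // linear0.
Qed.

Section MatrixUnits.
Variables (l : nat) (S : 'I_l -> lmodule A).
Hypothesis S_simple : forall i, simple_module (S i).
Hypothesis S_niso : forall i j, lmod_iso (S i) (S j) -> i = j.

(** Let [I] annihilate the other simple modules and [X] be the basis without its vector [v]. If all
    of [I] that kills [X] also killed that vector, it would agree under [I] with some [x] in the
    span of [X]; their difference is nonzero, yet every element killing the other modules would kill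
    it. So some element moves it, and a left multiple sends it to the vector [u]. *)
Lemma matrix_unit i (u v : 'I_(\dim {:S i})) : exists a,
  (forall j, j != i -> forall t, lact (S j) a t = 0) /\
  (forall w : 'I_(\dim {:S i}), lact (S i) a (vbasis {:S i})`_w = (w == v)%:R *: (vbasis {:S i})`_u).
Proof.
pose b := vbasis {:S i}; have fb : free b := basis_free (vbasisP _).
pose I a := forall j, j != i -> forall t, lact (S j) a t = 0.
have lI : left_ideal I.
  split; [split|] => [j ji t|c x y Ix Iy j ji t|x a Ia j ji t].
  - by rewrite lact0x.
  - by rewrite lact_lin Ix // Iy // scaler0 addr0.
  - by rewrite lactMx Ia // linear0.
pose X := [seq b`_(nat_of_ord w) | w <- [seq w <- enum 'I_(\dim {:S i}) | w != v]].
have bv0 : b`_v != 0.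
  by apply: (free_not0 fb); rewrite mem_nth // size_tuple.
have [a [Ia aX av]] : exists a,
    [/\ I a, forall u, u \in X -> lact (S i) a u = 0 & lact (S i) a b`_v != 0].
  apply: contrapT => nex.
  have [|||x xX sep] := @ideal_separation I (S i) (S i) \1%VF X b`_v (S_simple i) lI.
  - exact: lmod_hom_id.
  - by move=> h; apply: schur_scalar.
  - move=> a Ia aX; apply/eqP/negPn/negP => av; apply: nex.
    by exists a.
  have xv : coord b v x = 0.
    pose c : 'Hom(S i, k^o) := linfun (coord b v : S i -> k^o).
    have /span_subvP/subvP/(_ x xX) : {subset X <= lker c}.
      move=> y /mapP[w]; rewrite mem_filter => /andP[wv _] ->.
      by rewrite memv_ker lfunE /= coord_free // eq_sym (negPf wv).
    by rewrite memv_ker lfunE => /eqP.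
  have [|||a' Ia'] := @simple_separate_seq _ [seq j <- enum 'I_l | j != i] S (S i)
    (b`_v - x) (S_simple i).
  - by move=> j _; apply: S_simple.
  - by move=> j; rewrite mem_filter => /andP[/eqP ji _] /S_niso.
  - apply/negP => /eqP bx; have /eqP := oner_neq0 k; apply.
    have <- : coord b v (b`_v - x) = 1.
      by rewrite linearB /= xv subr0 coord_free // eqxx.
    by rewrite bx linear0.
  - rewrite linearB /= sep ?id_lfunE ?subrr ?eqxx // => j ji t.
    by apply: Ia'; rewrite mem_filter ji mem_enum.
have [c [Ic cX] cu] := ideal_orbit_full (S_simple i)
  (left_ideal_annihilator X lI) (conj Ia aX) av b`_u.
exists c; split=> // w; have [->|wv] := eqVneq w v; first by rewrite cu scale1r.
rewrite cX ?scale0r //; apply/mapP; exists w => //.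
by rewrite mem_filter wv mem_enum.
Qed.

End MatrixUnits.

End Density.

(** * Commutators and characters *)

Section CommutatorSpace.
Variables (k : fieldType) (A : falgType k).

Definition comm_space : {vspace A} :=
  <<[seq x * y - y * x | x <- vbasis {:A}, y <- vbasis {:A}]>>%VS.

Lemma mem_comm_space (x y : A) : x * y - y * x \in comm_space.
Proof.
have E : x * y - y * x = \sum_i \sum_j
   (coord (vbasis {:A}) i x * coord (vbasis {:A}) j y) *:
   ((vbasis {:A})`_i * (vbasis {:A})`_j - (vbasis {:A})`_j * (vbasis {:A})`_i).
  have xy (u v : A) : u * v = \sum_i \sum_j
      (coord (vbasis {:A}) i u * coord (vbasis {:A}) j v) *:
      ((vbasis {:A})`_i * (vbasis {:A})`_j).
    rewrite {1}(coord_vbasis (memvf u)) {1}(coord_vbasis (memvf v)) mulr_suml.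
    apply: eq_bigr => i _; rewrite mulr_sumr; apply: eq_bigr => j _.
    by rewrite -scalerAl -scalerAr scalerA.
  rewrite xy [y * x]xy [X in _ - X]exchange_big -sumrB; apply: eq_bigr => i _.
  rewrite -sumrB; apply: eq_bigr => j _.
  by rewrite scalerBr; congr (_ - _ *: _); rewrite mulrC.
rewrite E; apply: memv_suml => i _; apply: memv_suml => j _; apply: memvZ.
apply/memv_span/allpairsP; exists ((vbasis {:A})`_i, (vbasis {:A})`_j).
by split=> //=; rewrite mem_nth // size_tuple.
Qed.

Lemma comm_space_sub (U : {vspace A}) :
  (forall x y : A, x * y - y * x \in U) -> (comm_space <= U)%VS.
Proof.
by move=> UC; apply/span_subvP => _ /allpairsP[[x y] /= [_ _ ->]]; apply: UC.
Qed.

End CommutatorSpace.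

Section Characters.
Variables (k : closedFieldType) (A : falgType k).
Implicit Types (M S T : lmodule A).

Lemma character_linear M : linear (fun a => ltrace (lact M a) : k^o).
Proof. by move=> c a b; rewrite lact_linear ltraceD ltraceZ. Qed.

Lemma character_comm M a b :
  ltrace (lact M (a * b)) = ltrace (lact M (b * a)).
Proof. by rewrite !lactM ltraceC. Qed.

Variables (l : nat) (S : 'I_l -> lmodule A).
Hypothesis S_simple : forall i, simple_module (S i).
Hypothesis S_niso : forall i j, lmod_iso (S i) (S j) -> i = j.

(** For a complete list of simple modules this is K(A) plus the radical, so its quotient by
    [comm_space A] is R(A). *)
Definition char_kernel : {vspace A} :=
  pred_vspace (fun a => forall i, ltrace (lact (S i) a) = 0).

Lemma mem_char_kernel a :
  a \in char_kernel <-> forall i, ltrace (lact (S i) a) = 0.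
Proof.
apply: mem_pred_vspace; split=> [i|c x y x0 y0 i].
  have -> : lact (S i) 0 = 0 by apply/lfunP => t; rewrite lact0x zero_lfunE.
  exact: ltrace0.
by rewrite character_linear x0 y0 scaler0 addr0.
Qed.

Lemma comm_space_char_kernel : (comm_space A <= char_kernel)%VS.
Proof.
apply: comm_space_sub => x y; apply/mem_char_kernel => i.
by rewrite -scaleN1r addrC character_linear (character_comm _ x) scaleN1r addNr.
Qed.

(** For a complete list of simple modules, membership in the radical. *)
Definition kills a := forall i t, lact (S i) a t = 0.

Lemma kills_basis a :
  (forall i (w : 'I_(\dim {:S i})), lact (S i) a (vbasis {:S i})`_w = 0) -> kills a.
Proof.
move=> ab i t; rewrite (coord_vbasis (memvf t)) linear_sum big1 // => w _.
by rewrite linearZ /= ab scaler0.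
Qed.

Lemma kills_linear : linear_pred kills.
Proof.
split=> [i t|c x y kx ky i t]; first by rewrite lact0x.
by rewrite lact_lin kx ky scaler0 addr0.
Qed.

Lemma ltrace_unit i (u v : 'I_(\dim {:S i})) a :
  (forall w : 'I_(\dim {:S i}),
     lact (S i) a (vbasis {:S i})`_w = (w == v)%:R *: (vbasis {:S i})`_u) ->
  ltrace (lact (S i) a) = (u == v)%:R.
Proof.
move=> aE; rewrite /ltrace (bigD1 u) //= big1 => [|w wu].
  by rewrite aE linearZ /= coord_free ?eqxx ?mulr1 ?addr0 // (basis_free (vbasisP _)).
rewrite aE linearZ /= coord_free ?(basis_free (vbasisP _)) //.
by rewrite [u == w]eq_sym (negPf wu) mulr0.
Qed.

(** The characters are linearly independent in any characteristic: a diagonal matrix unit of [S i]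
    has trace 1 on [S i] and 0 on the other modules, so the joint character map onto [k^l] is
    surjective. *)
Lemma dim_char_kernel : (\dim char_kernel + l)%N = \dim {:A}.
Proof.
have lin : linear (fun a => \row_(i < l) ltrace (lact (S i) a)).
  by move=> c a b; apply/rowP => i; rewrite !mxE character_linear.
have [f fE] := linfunP lin.
have kf : lker f = char_kernel.
  apply/vspaceP => a; rewrite memv_ker; apply/eqP/idP => [fa|].
    apply/mem_char_kernel => i; have /rowP/(_ i) := fa.
    by rewrite fE !mxE.
  by move/mem_char_kernel => a0; rewrite fE; apply/rowP => i; rewrite !mxE a0.
have dimf : \dim (limg f) = l.
  suff -> : limg f = fullv by rewrite dimvf /= /dim /= mul1n.
  apply/eqP; rewrite eqEsubv subvf; apply/subvP => x _.
  rewrite [x]row_sum_delta; apply: memv_suml => i _; apply: memvZ.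
  have d0 : (0 < \dim {:S i})%N.
    by rewrite lt0n dimv_eq0; case: (S_simple i).
  have [a [a0 aE]] := matrix_unit S_simple S_niso (Ordinal d0) (Ordinal d0).
  have -> : delta_mx 0 i = f a; last by rewrite memv_img ?memvf.
  rewrite fE; apply/rowP => j; rewrite !mxE eqxx /=.
  have [->|ij] := eqVneq j i; first by rewrite (ltrace_unit aE).
  have -> : lact (S j) a = 0; last by rewrite ltrace0.
  by apply/lfunP => t; rewrite a0 // zero_lfunE.
by rewrite -kf -[X in (_ + X)%N]dimf -(limg_ker_dim f fullv) capfv.
Qed.

(** Up to elements killing all [S i], [a] is a combination of matrix units. An off-diagonal unit is
    the commutator of [E i u u] and [E i u v], and [E i u u - E i v v] that of [E i u v] and
    [E i v u]. What remains in each block is its trace times one diagonal unit, and this trace is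
    zero. *)
Lemma char_kernel_comm a : a \in char_kernel ->
  exists2 x, x \in comm_space A & kills (a - x).
Proof.
move=> /mem_char_kernel a0.
pose E i u v := projT1 (cid (@matrix_unit _ _ _ _ S_simple S_niso i u v)).
have Ej i j u v t : j != i -> lact (S j) (E i u v) t = 0.
  by move=> ji; exact: (projT2 (cid (matrix_unit S_simple S_niso u v))).1.
have Ei i u v (w : 'I_(\dim {:S i})) : lact (S i) (E i u v) (vbasis {:S i})`_w =
    (w == v)%:R *: (vbasis {:S i})`_u.
  exact: (projT2 (cid (matrix_unit S_simple S_niso u v))).2.
have LZ i x d t : lact (S i) x (d *: t) = d *: lact (S i) x t by rewrite linearZ.
pose J := pred_vspace kills.
have mJ x : x \in J <-> kills x := mem_pred_vspace x kills_linear.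
pose KJ := (comm_space A + J)%VS.
have KJC x y z : kills (x * y - y * x - z) -> z \in KJ.
  move=> kz; rewrite -[z](subKr (x * y - y * x)) memv_add ?mem_comm_space //.
  by rewrite memvN; apply/mJ.
have off i u v : u != v -> E i u v \in KJ.
  move=> uv; apply: (KJC (E i u u) (E i u v)); apply: kills_basis => j w.
  rewrite !lactBx !lactMx; case: (eqVneq j i) w => [->|ji] w; last first.
    by rewrite !Ej // !subr0.
  rewrite !Ei !LZ !Ei eqxx (negPf uv) scale0r scaler0 subr0 scale1r.
  by rewrite subrr.
have diag i u v : E i u u - E i v v \in KJ.
  apply: (KJC (E i u v) (E i v u)); apply: kills_basis => j w.
  rewrite !lactBx !lactMx; case: (eqVneq j i) w => [->|ji] w; last first.
    by rewrite !Ej // !subr0.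
  by rewrite !Ei !LZ !Ei !eqxx !scale1r subrr.
pose c i u v := coord (vbasis {:S i}) u (lact (S i) a (vbasis {:S i})`_v).
have aE : kills (a - \sum_i \sum_(u < \dim {:S i}) \sum_(v < \dim {:S i})
    c i u v *: E i u v).
  apply: kills_basis => j w; rewrite lactBx lact_sumx (bigD1 j) //=.
  rewrite [X in _ - (_ + X)]big1 => [|i ij]; last first.
    rewrite lact_sumx big1 // => u _; rewrite lact_sumx big1 // => v _.
    by rewrite lactZx Ej ?scaler0 // eq_sym.
  rewrite addr0 lact_sumx {1}(coord_vbasis (memvf (lact _ _ _))) -sumrB big1 // => u _.
  rewrite lact_sumx (bigD1 w) //= big1 => [|v vw]; last first.
    by rewrite lactZx Ei eq_sym (negPf vw) scale0r scaler0.
  by rewrite lactZx Ei eqxx scale1r addr0 subrr.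
have aKJ : a \in KJ.
  rewrite -[a](subrK (\sum_i \sum_(u < \dim {:S i}) \sum_(v < \dim {:S i})
    c i u v *: E i u v)) memvD //.
    by apply: subvP (addvSr _ _) _ _; apply/mJ.
  apply: memv_suml => i _.
  have d0 : (0 < \dim {:S i})%N by rewrite lt0n dimv_eq0; case: (S_simple i).
  pose o := Ordinal d0.
  (* Subtracting [c i u u *: E i o o] for every [u] changes nothing, as these coefficients add up to
     the trace of [a] on [S i], which vanishes. *)
  rewrite (_ : \sum_u _ = \sum_u ((\sum_(v | v != u) c i u v *: E i u v) +
      c i u u *: (E i u u - E i o o))); last first.
    rewrite big_split /= [X in _ + X](_ : _ = \sum_u c i u u *: E i u u); last first.
      under eq_bigr do rewrite scalerBr.
      rewrite sumrB -scaler_suml.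
      rewrite [X in _ - X *: _](_ : _ = 0) ?scale0r ?subr0 //.
      exact: a0 i.
    rewrite -big_split; apply: eq_bigr => u _ /=.
    by rewrite (bigD1 u) //= addrC.
  apply: memv_suml => u _; apply: memvD; last by apply: memvZ; apply: diag.
  by apply: memv_suml => v vu; apply/memvZ/off; rewrite eq_sym.
have [x xK [y /mJ yJ ->]] := memv_addP aKJ; exists x => //.
by rewrite addrAC subrr add0r.
Qed.

End Characters.

(** * Right dual bases and transfer *)

Section Tensors.
Variables (k : fieldType) (U V : vectType k).

Lemma tensDl (u u' : U) (v : V) : tens (u + u') v = tens u v + tens u' v.
Proof. by have := (tens_bilinear U V).2 v 1 u u'; rewrite !scale1r. Qed.

Lemma tensDr (u : U) (v v' : V) : tens u (v + v') = tens u v + tens u v'.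
Proof. by have := (tens_bilinear U V).1 u 1 v v'; rewrite !scale1r. Qed.

Lemma tens0l (v : V) : tens (0 : U) v = 0.
Proof. by apply: (addrI (tens 0 v)); rewrite -tensDl !addr0. Qed.

Lemma tens0r (u : U) : tens u (0 : V) = 0.
Proof. by apply: (addrI (tens u 0)); rewrite -tensDr !addr0. Qed.

Lemma tensZl c (u : U) (v : V) : tens (c *: u) v = c *: tens u v.
Proof. by have := (tens_bilinear U V).2 v c u 0; rewrite tens0l !addr0. Qed.

Lemma tensZr c (u : U) (v : V) : tens u (c *: v) = c *: tens u v.
Proof. by have := (tens_bilinear U V).1 u c v 0; rewrite tens0r !addr0. Qed.

Lemma tens_suml (I : Type) (r : seq I) (F : I -> U) (v : V) :
  tens (\sum_(i <- r) F i) v = \sum_(i <- r) tens (F i) v.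
Proof.
by apply: (big_morph (fun u => tens u v)) => [x y|]; [exact: tensDl|exact: tens0l].
Qed.

Lemma tens_sumr (I : Type) (r : seq I) (F : I -> V) (u : U) :
  tens u (\sum_(i <- r) F i) = \sum_(i <- r) tens u (F i).
Proof.
by apply: (big_morph (fun v => tens u v)) => [x y|]; [exact: tensDr|exact: tens0r].
Qed.

Lemma tensor_map (W : vectType k) (f : U -> V -> W) : bilinear_map f ->
  exists F : 'Hom(tensor U V, W), forall u v, F (tens u v) = f u v.
Proof.
move=> bf; have [F FE] := linfunP (tensor_lift_linear f).
by exists F => u v; rewrite FE tensor_liftE.
Qed.

Definition tens_coord (l : 'I_(\dim {:U})) : 'Hom(tensor U V, V) :=
  linfun (tensor_lift (fun u v => coord (vbasis {:U}) l u *: v)).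

Lemma tens_coordE l u v : tens_coord l (tens u v) = coord (vbasis {:U}) l u *: v.
Proof.
rewrite lfunE /= tensor_liftE //; split=> [u' c x y | v' c x y].
  by rewrite scalerDr !scalerA mulrC.
by rewrite linearP scalerDl scalerA.
Qed.

Lemma tens_coord_sum x :
  \sum_(l < \dim {:U}) tens (vbasis {:U})`_l (tens_coord l x) = x.
Proof.
elim/tensor_ind: x => [|c x y IHx IHy|u v].
- by rewrite big1 // => l _; rewrite linear0 tens0r.
- rewrite -[in RHS]IHx -[in RHS]IHy scaler_sumr -big_split; apply: eq_bigr => l _.
  by rewrite linearP tensDr tensZr.
rewrite [in RHS](coord_vbasis (memvf u)) tens_suml; apply: eq_bigr => l _.
by rewrite tens_coordE tensZr tensZl.
Qed.

End Tensors.

Section Bimodules.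
Variables (k : fieldType) (A B : falgType k).
Implicit Type M : bimodule A B.

Lemma blactMx M a a' m : blact M (a * a') m = blact M a (blact M a' m).
Proof. by rewrite blactM comp_lfunE. Qed.

Lemma bractMx M b b' m : bract M (b * b') m = bract M b' (bract M b m).
Proof. by rewrite bractM comp_lfunE. Qed.

Lemma blact1x M m : blact M 1 m = m. Proof. by rewrite blact1 id_lfunE. Qed.

Lemma bract1x M m : bract M 1 m = m. Proof. by rewrite bract1 id_lfunE. Qed.

Lemma blactCx M a b m : blact M a (bract M b m) = bract M b (blact M a m).
Proof. by rewrite -!comp_lfunE blactC. Qed.

Lemma blact_lin M c a b m : blact M (c *: a + b) m = c *: blact M a m + blact M b m.
Proof. by rewrite blact_linear add_lfunE scale_lfunE. Qed.

Lemma bract_lin M c a b m : bract M (c *: a + b) m = c *: bract M a m + bract M b m.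
Proof. by rewrite bract_linear add_lfunE scale_lfunE. Qed.

Lemma blact_sumx M (I : Type) (r : seq I) (F : I -> A) m :
  blact M (\sum_(i <- r) F i) m = \sum_(i <- r) blact M (F i) m.
Proof. exact: (@lact_sumx _ _ (bimod_left M)). Qed.

Definition right_dual_basis M (I : finType) (m : I -> M) (phi : I -> 'Hom(M, B)) :=
  (forall i b x, phi i (bract M b x) = phi i x * b) /\
  (forall x, \sum_i bract M (phi i x) (m i) = x).

(** The Hattori-Stallings trace, lifted to [B]. For right linear [u] only its class modulo
    [comm_space B] is independent of the dual basis. *)
Definition rtrace M (I : finType) (m : I -> M) (phi : I -> 'Hom(M, B))
    (u : 'End(M)) : B := \sum_i phi i (u (m i)).

Definition right_linear (M N : bimodule A B) (u : 'Hom(M, N)) :=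
  forall b x, u (bract M b x) = bract N b (u x).

(** Expanding each of [u (m i)] and [v (n j)] in the other dual basis turns both traces into double
    sums of the same products, taken in opposite orders. With [M = N] and [u] the identity this
    gives independence of the dual basis. *)
Lemma rtraceC (M N : bimodule A B) (I J : finType) (m : I -> M)
    (phi : I -> 'Hom(M, B)) (n : J -> N) (psi : J -> 'Hom(N, B))
    (u : 'Hom(M, N)) (v : 'Hom(N, M)) :
  right_dual_basis m phi -> right_dual_basis n psi ->
  right_linear u -> right_linear v ->
  rtrace m phi (v \o u)%VF - rtrace n psi (u \o v)%VF \in comm_space B.
Proof.
move=> [phir mphi] [psir npsi] ur vr.
have -> : rtrace m phi (v \o u)%VF =
    \sum_i \sum_j phi i (v (n j)) * psi j (u (m i)).
  apply: eq_bigr => i _; rewrite comp_lfunE -[in LHS](npsi (u (m i))) !linear_sum.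
  by apply: eq_bigr => j _; rewrite /= vr phir.
have -> : rtrace n psi (u \o v)%VF =
    \sum_i \sum_j psi j (u (m i)) * phi i (v (n j)).
  rewrite exchange_big; apply: eq_bigr => j _.
  rewrite comp_lfunE -[in LHS](mphi (v (n j))) !linear_sum.
  by apply: eq_bigr => i _; rewrite /= ur psir.
rewrite -sumrB; apply: memv_suml => i _; rewrite -sumrB; apply: memv_suml => j _.
exact: mem_comm_space.
Qed.

(** A direct summand of the free right module W (x) B inherits the dual basis given by a basis of
    [W]. *)
Lemma split_dual_basis M (W : vectType k) (Phi : 'Hom(M, tensor W B))
    (mu : 'Hom(tensor W B, M)) :
  (forall b x, Phi (bract M b x) = tens_map \1%VF (amulr b) (Phi x)) ->
  (forall b y, mu (tens_map \1%VF (amulr b) y) = bract M b (mu y)) ->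
  (forall x, mu (Phi x) = x) ->
  right_dual_basis (fun l : 'I_(\dim {:W}) => mu (tens (vbasis {:W})`_l 1))
                   (fun l => @tens_coord k W B l \o Phi)%VF.
Proof.
move=> PhiB muB muK; split=> [l b x|x].
  rewrite !comp_lfunE PhiB; elim/tensor_ind: (Phi x) => [|c y z IHy IHz|w b'].
  - by rewrite !linear0 mul0r.
  - by rewrite !linearP /= IHy IHz mulrDl scalerAl.
  by rewrite tens_mapE !tens_coordE id_lfunE lfunE /= scalerAl.
rewrite -[RHS]muK -[in RHS](tens_coord_sum (Phi x)) linear_sum.
apply: eq_bigr => l _; rewrite -muB tens_mapE id_lfunE lfunE /= mul1r.
by rewrite comp_lfunE.
Qed.

Lemma tens_actr_linear (W : vectType k) :
  linear (fun b : B => tens_map (\1%VF : 'End(W)) (amulr b)).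
Proof. by move=> c b b'; rewrite amulr_is_linear tens_map_linearr. Qed.

Lemma tens_actr1 (W : vectType k) :
  tens_map (\1%VF : 'End(W)) (amulr (1 : B)) = \1%VF.
Proof. by rewrite amulr1 tens_map1. Qed.

Lemma tens_actrM (W : vectType k) (b b' : B) :
  tens_map (\1%VF : 'End(W)) (amulr (b * b')) =
  (tens_map (\1%VF : 'End(W)) (amulr b') \o tens_map (\1%VF : 'End(W)) (amulr b))%VF.
Proof. by rewrite -tens_map_comp comp_lfun1l amulr_comp. Qed.

Definition rmod_free (W : vectType k) : rmodule B :=
  RModule (@tens_actr_linear W) (@tens_actr1 W) (@tens_actrM W).

Lemma bract_bilinear M : bilinear_map (fun m b => bract M b m).
Proof. by split=> [m c b b' | b c m m']; [exact: bract_lin|rewrite linearP]. Qed.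

Lemma right_dual_basis_exists M : rmod_projective (bimod_right M) ->
  exists (I : finType) (m : I -> M) (phi : I -> 'Hom(M, B)),
    right_dual_basis m phi.
Proof.
move=> pM; have [mu muE] := tensor_map (bract_bilinear M).
have muB b y : mu (tens_map \1%VF (amulr b) y) = bract M b (mu y).
  elim/tensor_ind: y => [|c y z IHy IHz|m b']; first by rewrite !linear0.
    by rewrite !linearP /= IHy IHz.
  by rewrite tens_mapE id_lfunE lfunE /= !muE bractMx.
have [||//|Phi [PhiB muPhi]] := pM (rmod_free M) (bimod_right M) mu \1%VF.
- by [].
- apply/eqP; rewrite eqEsubv subvf; apply/subvP => x _.
  by apply/memv_imgP; exists (tens x 1); rewrite ?memvf // muE bract1x.
- by move=> b m; rewrite !id_lfunE.
have muK x : mu (Phi x) = x by rewrite -[LHS]comp_lfunE muPhi id_lfunE.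
by eexists; eexists; eexists; exact: split_dual_basis PhiB muB muK.
Qed.

Definition transfer M (I : finType) (m : I -> M) (phi : I -> 'Hom(M, B)) (a : A) : B :=
  \sum_i phi i (blact M a (m i)).

Section Transfer.
Variables (M : bimodule A B) (I : finType) (m : I -> M) (phi : I -> 'Hom(M, B)).
Hypothesis dM : right_dual_basis m phi.

Lemma transfer_linear : linear (transfer m phi).
Proof.
move=> c a b; rewrite /transfer scaler_sumr -big_split; apply: eq_bigr => i _.
by rewrite blact_lin linearP.
Qed.

Lemma right_linear_blact a : right_linear (blact M a).
Proof. by move=> b x; rewrite blactCx. Qed.

Lemma transfer_comm a b :
  transfer m phi (a * b - b * a) \in comm_space B.
Proof.
rewrite (_ : transfer _ _ _ = rtrace m phi (blact M a \o blact M b)%VF -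
    rtrace m phi (blact M b \o blact M a)%VF).
  by apply: rtraceC => //; apply: right_linear_blact.
rewrite /rtrace -sumrB; apply: eq_bigr => i _.
by rewrite (@lactBx _ _ (bimod_left M)) linearB -!blactM.
Qed.

(** The trace of the transfer of [a] on [T] is the trace of [a] on M (x)_B T, where [a] acts
    nilpotently. That module is replaced by the power of [T] indexed by [I], of which it is a direct
    summand. *)
Lemma transfer_nilpotent (T : lmodule B) a n : a ^+ n = 0 ->
  ltrace (lact T (transfer m phi a)) = 0.
Proof.
move=> an0; have [phir mphi] := dM.
pose X : vectType k := {ffun I -> T}.
(* [th a] is the matrix with entries [phi i (a m_j)]. It is multiplicative in [a], and [th 1] is an
   idempotent whose image is a copy of M (x)_B T. *)
pose th a (v : X) : X := [ffun i => \sum_j lact T (phi i (blact M a (m j))) (v j)].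
have th_lin a' : linear (th a').
  move=> c v w; apply/ffunP => i; rewrite !ffunE scaler_sumr -big_split.
  by apply: eq_bigr => j _; rewrite !ffunE linearP.
have thM a1 a2 v : th a1 (th a2 v) = th (a1 * a2) v.
  apply/ffunP => i; rewrite !ffunE.
  transitivity (\sum_j \sum_l lact T (phi i (blact M a1 (m j)) *
     phi j (blact M a2 (m l))) (v l)).
    apply: eq_bigr => j _; rewrite ffunE linear_sum; apply: eq_bigr => l _.
    by rewrite lactMx.
  rewrite exchange_big; apply: eq_bigr => l _ /=.
  rewrite -lact_sumx; congr (lact T _ _).
  rewrite blactMx -[in RHS](mphi (blact M a2 (m l))) !linear_sum.
  by apply: eq_bigr => j _; rewrite /= blactCx phir.
have [F FE] := linfunP (th_lin a).
have -> : ltrace (lact T (transfer m phi a)) = ltrace F.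
  pose b := vbasis {:T}.
  pose e (t : I * 'I_(\dim {:T})) : X := [ffun i => if i == t.1 then b`_t.2 else 0].
  have [c cE] : exists c : I * 'I_(\dim {:T}) -> 'Hom(X, k^o),
      forall t v, c t v = coord b t.2 (v t.1).
    suff /choice[c cE] : forall t : I * 'I_(\dim {:T}),
        exists c : 'Hom(X, k^o), forall v, c v = coord b t.2 (v t.1).
      by exists c.
    move=> t; apply: (@linfunP _ X k^o) => d v w; rewrite !ffunE linearP.
    by [].
  rewrite (@ltrace_dual_basis _ _ _ e c) => [|v].
    rewrite /transfer; under [RHS]eq_bigr do rewrite cE FE ffunE.
    rewrite -(pair_big xpredT xpredT (fun i w =>
      coord b w (\sum_j lact T (phi i (blact M a (m j))) (e (i, w) j)))) /=.
    rewrite {1}/ltrace exchange_big /=; apply: eq_bigr => w _.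
    rewrite lact_sumx linear_sum; apply: eq_bigr => i _.
    rewrite (bigD1 i) //= ffunE eqxx big1 ?addr0 // => j ji.
    by rewrite ffunE (negPf ji) linear0.
  apply/ffunP => i; rewrite sum_ffunE.
  under eq_bigr do rewrite !ffunE cE.
  rewrite -(pair_big xpredT xpredT (fun j (w : 'I_(\dim {:T})) =>
     coord b w (v j) *: (if i == j then b`_w else 0))) /= (bigD1 i) //= eqxx.
  rewrite -(coord_vbasis (memvf (v i))) big1 ?addr0 // => j ji.
  by rewrite big1 // => w _; rewrite eq_sym (negPf ji) scaler0.
(* The extra iteration lets the induction start at exponent 1, since [th 1] need not be the
   identity. *)
apply: (@ltrace_nilpotent _ _ _ n.+1) => v.
have -> : iter n.+1 F v = th (a ^+ n.+1) v.
  elim: n {an0} => [|n IHn]; first by rewrite /= FE expr1.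
  by rewrite iterS IHn FE thM -exprS.
apply/ffunP => i; rewrite !ffunE big1 // => j _.
rewrite exprS an0 mulr0 (_ : blact M 0 (m j) = 0) ?linear0 ?lact0x //.
exact: (@lact0x _ _ (bimod_left M)).
Qed.

End Transfer.

End Bimodules.

(** * Additivity, composition and vanishing of transfers *)

Section Splitting.
Variables (k : fieldType) (A B : falgType k).

(** A full decomposition of [X] as the direct sum of [Y] and [Z]; the relations p j = 0 and q i = 0
    follow from the listed ones. *)
Definition bimod_retract (X Y Z : bimodule A B) : Prop :=
  exists (i : 'Hom(Y, X)) (p : 'Hom(X, Y)) (j : 'Hom(Z, X)) (q : 'Hom(X, Z)),
  [/\ bimod_hom i /\ bimod_hom p, bimod_hom j /\ bimod_hom q,
      forall y, p (i y) = y, forall z, q (j z) = z & forall x, i (p x) + j (q x) = x].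

Lemma bimod_iso_sum_retract (X Y Z : bimodule A B) :
  bimod_iso X (bimod_sum Y Z) -> bimod_retract X Y Z.
Proof.
case=> f [[fl fr] [g fK gK]].
have lg : linear g by move=> c x y; apply: (can_inj fK); rewrite linearP /= !gK.
have gl a x : g (blact (bimod_sum Y Z) a x) = blact X a (g x).
  by apply: (can_inj fK); rewrite fl !gK.
have gr a x : g (bract (bimod_sum Y Z) a x) = bract X a (g x).
  by apply: (can_inj fK); rewrite fr !gK.
have [i iE] : exists i : 'Hom(Y, X), forall y, i y = g (y, 0).
  apply: linfunP => c x y; rewrite -lg; congr g.
  by congr pair; rewrite -[RHS]/(c *: 0 + 0) scaler0 addr0.
have [j jE] : exists j : 'Hom(Z, X), forall y, j y = g (0, y).
  apply: linfunP => c x y; rewrite -lg; congr g.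
  by congr pair; rewrite -[RHS]/(c *: 0 + 0) scaler0 addr0.
have [p pE] : exists p : 'Hom(X, Y), forall x, p x = (f x).1.
  by apply: linfunP => c x y; rewrite linearP.
have [q qE] : exists q : 'Hom(X, Z), forall x, q x = (f x).2.
  by apply: linfunP => c x y; rewrite linearP.
exists i, p, j, q; split.
- split; split=> a x; rewrite ?iE ?pE.
  + by rewrite -gl /= lfun_pairE linear0.
  + by rewrite -gr /= lfun_pairE linear0.
  + by rewrite fl /= lfun_pairE.
  + by rewrite fr /= lfun_pairE.
- split; split=> a x; rewrite ?jE ?qE.
  + by rewrite -gl /= lfun_pairE linear0.
  + by rewrite -gr /= lfun_pairE linear0.
  + by rewrite fl /= lfun_pairE.
  + by rewrite fr /= lfun_pairE.
- by move=> y; rewrite pE iE gK.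
- by move=> z; rewrite qE jE gK.
move=> x; rewrite iE jE pE qE; have := lg 1 ((f x).1, 0) (0, (f x).2).
rewrite !scale1r => <-; rewrite -[RHS]fK; congr g.
by rewrite [RHS]surjective_pairing; congr pair; rewrite ?addr0 ?add0r.
Qed.

Lemma rtraceD (M : bimodule A B) (I : finType) (m : I -> M) phi u v :
  rtrace m phi (u + v) = rtrace m phi u + rtrace m phi v.
Proof.
by rewrite /rtrace -big_split; apply: eq_bigr => i _; rewrite add_lfunE linearD.
Qed.

(** The action of [a] on [X] is a sum of two maps, one factoring through [Y] and one through [Z];
    [rtraceC] moves each trace to its summand. *)
Lemma retract_transfer (X Y Z : bimodule A B) (I J L : finType)
    (x : I -> X) xi (y : J -> Y) eta (z : L -> Z) zeta a :
  right_dual_basis x xi -> right_dual_basis y eta -> right_dual_basis z zeta ->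
  bimod_retract X Y Z ->
  transfer x xi a - (transfer y eta a + transfer z zeta a) \in comm_space B.
Proof.
move=> dX dY dZ [i [p [j [q [[hi hp] [hj hq] pi qj ipjq]]]]].
have rl (U V : bimodule A B) (f : 'Hom(U, V)) : bimod_hom f -> right_linear f by case.
have split_act : blact X a = ((i \o (p \o blact X a)) + (j \o (q \o blact X a)))%VF.
  by apply/lfunP => t; rewrite add_lfunE !comp_lfunE ipjq.
have E (W : bimodule A B) (T : finType) (w : T -> W) c (h : 'Hom(X, W)) (u : 'Hom(W, X)) :
    right_dual_basis w c -> bimod_hom u -> bimod_hom h -> (forall t, h (u t) = t) ->
    rtrace x xi (u \o (h \o blact X a))%VF - transfer w c a \in comm_space B.
  move=> dW hu hh hK; have := rtraceC dX dW (_ : right_linear (h \o blact X a)%VF) (rl _ _ _ hu).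
  have -> : (h \o blact X a \o u)%VF = blact W a.
    by apply/lfunP => t; rewrite !comp_lfunE hh.1 hK.
  by apply=> b t; rewrite !comp_lfunE blactCx hh.2.
have EY := E _ _ _ _ _ _ dY hi hp pi; have EZ := E _ _ _ _ _ _ dZ hj hq qj.
rewrite -[transfer x xi a]/(rtrace x xi (blact X a)) split_act rtraceD.
by rewrite opprD addrACA memvD.
Qed.

End Splitting.

Section TensorActions.
Variables (k : fieldType) (A B C : falgType k).
Variables (M : bimodule A B) (N : bimodule B C).

Lemma blact_btens a m n :
  blact (bimod_tensor M N) a (btens m n) = btens (blact M a m) n.
Proof. exact: btensor_lactE. Qed.

Lemma bract_btens c m n :
  bract (bimod_tensor M N) c (btens m n) = btens m (bract N c n).
Proof. exact: btensor_ractE. Qed.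

End TensorActions.

(** The functionals send x (x) y to psi_j (phi_i(x) y). With this dual basis of M (x)_B N the
    transfers compose exactly, not merely modulo commutators. *)
Lemma comp_dual_basis (k : fieldType) (A B C : falgType k) (M : bimodule A B)
    (N : bimodule B C) (I J : finType) (m : I -> M) phi (n : J -> N) psi :
  right_dual_basis m phi -> right_dual_basis n psi ->
  exists chi : I * J -> 'Hom(bimod_tensor M N, C),
    right_dual_basis (fun t : I * J => btens (m t.1) (n t.2) : bimod_tensor M N) chi /\
    forall a, transfer (fun t : I * J => btens (m t.1) (n t.2) : bimod_tensor M N) chi a
      = transfer n psi (transfer m phi a).
Proof.
move=> [phir mphi] [psir npsi].
have /choice[chi chiE] : forall t : I * J, exists g : 'Hom(bimod_tensor M N, C),
    forall x y, g (btens x y) = psi t.2 (blact N (phi t.1 x) y).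
  move=> t; apply: (@btensor_universal _ _ _ _ M N).
    split=> [x c y y'|y c x x']; first by rewrite linearP /= linearP.
    by rewrite linearP /= blact_lin linearP.
  by move=> x b y; rewrite phir blactMx.
exists chi; split; last first.
  move=> a; rewrite /transfer.
  transitivity (\sum_i \sum_j
      chi (i, j) (blact (bimod_tensor M N) a (btens (m i) (n j)))).
    by rewrite pair_big; apply: eq_bigr => -[i j].
  rewrite exchange_big; apply: eq_bigr => j _ /=.
  rewrite blact_sumx linear_sum; apply: eq_bigr => i _.
  by rewrite blact_btens chiE.
have chir t c : (chi t \o bract (bimod_tensor M N) c = amulr c \o chi t)%VF.
  apply: btensor_lfun_ext => x y; rewrite [LHS]comp_lfunE [RHS]comp_lfunE bract_btens !chiE lfunE /=.
  by rewrite blactCx psir.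
split=> [t c x|x].
  have /lfunP/(_ x) := chir t c; rewrite [LHS]comp_lfunE [RHS]comp_lfunE => ->.
  by rewrite lfunE.
have [F FE] : exists F : 'End(bimod_tensor M N), forall x, F x =
   \sum_t bract (bimod_tensor M N) (chi t x) (btens (m t.1) (n t.2)).
  apply: linfunP => c u v; rewrite scaler_sumr -big_split; apply: eq_bigr => t _.
  by rewrite linearP bract_lin.
rewrite -FE -[RHS]id_lfunE; congr (fun_of_lfun _ x); apply: btensor_lfun_ext => u v.
rewrite id_lfunE FE.
transitivity (\sum_i \sum_j btens (m i)
   (bract N (psi j (blact N (phi i u) v)) (n j)) : bimod_tensor M N).
  rewrite pair_big; apply: eq_bigr => -[i j] _ /=.
  by rewrite chiE bract_btens.
have [br bl] := btens_bilinear M N.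
have bsumr u' (K : Type) (r : seq K) (G : K -> N) :
    \sum_(i <- r) btens u' (G i) = btens u' (\sum_(i <- r) G i) :> bimod_tensor M N.
  have [g gE] := linfunP (br u'); rewrite -gE linear_sum.
  by apply: eq_bigr => i _; exact/esym/gE.
under eq_bigr do rewrite bsumr npsi -btens_balanced.
have [g gE] := linfunP (bl v).
rewrite -[in RHS](mphi u) -gE linear_sum; apply: eq_bigr => i _.
exact/esym/gE.
Qed.

Section FreeBimodule.
Variables (k : fieldType) (A B : falgType k) (W : vectType k).

Definition free_lact (a : A) : 'End(tensor (tensor A W) B) :=
  tens_map (tens_map (amull a) \1%VF) \1%VF.

Definition free_ract (b : B) : 'End(tensor (tensor A W) B) :=
  tens_map \1%VF (amulr b).

Fact free_lact_linear : linear free_lact.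
Proof.
by move=> c a a'; rewrite /free_lact amull_is_linear !tens_map_linearl.
Qed.

Fact free_lact1 : free_lact 1 = \1%VF.
Proof. by rewrite /free_lact amull1 !tens_map1. Qed.

Fact free_lactM a a' : free_lact (a * a') = (free_lact a \o free_lact a')%VF.
Proof.
by rewrite /free_lact amull_comp -tens_map_comp -tens_map_comp !comp_lfun1l.
Qed.

Fact free_lactC a b : (free_lact a \o free_ract b = free_ract b \o free_lact a)%VF.
Proof. by rewrite -!tens_map_comp !comp_lfun1l !comp_lfun1r. Qed.

Definition bimod_free : bimodule A B :=
  BiModule free_lact_linear free_lact1 free_lactM
    (@tens_actr_linear _ B _) (@tens_actr1 _ B _) (@tens_actrM _ B _) free_lactC.

Lemma free_lactE a x w y :
  blact bimod_free a (tens (tens x w) y) = tens (tens (a * x) w) y.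
Proof. by rewrite tens_mapE id_lfunE tens_mapE id_lfunE lfunE. Qed.

Lemma free_ractE b u y : bract bimod_free b (tens u y) = tens u (y * b).
Proof. by rewrite tens_mapE id_lfunE lfunE. Qed.

End FreeBimodule.

Section ProjectiveBimodules.
Variables (k : fieldType) (A B : falgType k).

Lemma bimod_projective_split (P : bimodule A B) : bimod_projective P ->
  exists (Phi : 'Hom(P, bimod_free A B P)) (mu : 'Hom(bimod_free A B P, P)),
  [/\ bimod_hom Phi, bimod_hom mu,
      forall x p y, mu (tens (tens x p) y) = bract P y (blact P x p)
    & forall p, mu (Phi p) = p].
Proof.
move=> pP.
have [nu nuE] : exists nu : 'Hom(tensor A P, P), forall x p, nu (tens x p) = blact P x p.
  apply: tensor_map; split=> [x c p q|p c x y]; first by rewrite linearP.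
  exact: blact_lin.
have [mu muE] : exists mu : 'Hom(tensor (tensor A P) B, P),
    forall u y, mu (tens u y) = bract P y (nu u).
  apply: tensor_map; split=> [u c y z|y c u v]; first exact: bract_lin.
  by rewrite !linearP.
have hmu : @bimod_hom _ _ _ (bimod_free A B P) P mu.
  split=> a z; elim/tensor_ind: z => [|c u v IHu IHv|u y].
  - by rewrite !linear0.
  - by rewrite !linearP /= IHu IHv.
  - elim/tensor_ind: u => [|c u v IHu IHv|x p].
    + by rewrite tens0l !linear0.
    + by rewrite tensDl tensZl !linearP /= IHu IHv.
    by rewrite free_lactE !muE !nuE blactMx blactCx.
  - by rewrite !linear0.
  - by rewrite !linearP /= IHu IHv.
  by rewrite free_ractE !muE bractMx.
have [||Phi [hPhi muPhi]] := pP (bimod_free A B P) P mu \1%VF hmu.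
- apply/eqP; rewrite eqEsubv subvf; apply/subvP => x _.
  apply/memv_imgP; exists (tens (tens 1 x) 1); rewrite ?memvf //.
  by rewrite muE nuE bract1x blact1x.
- by split=> b m; rewrite !id_lfunE.
exists Phi, mu; split=> // [x p y|p]; first by rewrite muE nuE.
by have /lfunP/(_ p) := muPhi; rewrite [LHS]comp_lfunE id_lfunE.
Qed.

(** [P] is a summand of the free bimodule A (x) P (x) B, whose left action touches only the factor
    [A]. For the dual basis coming from this splitting, the transfer of a nilpotent element is zero
    itself and not only modulo commutators. *)
Lemma projective_transfer (P : bimodule A B) : bimod_projective P ->
  exists (I : finType) (p : I -> P) phi, right_dual_basis p phi /\
    forall a n, a ^+ n = 0 -> transfer p phi a = 0.
Proof.
move=> /bimod_projective_split[Phi [mu [hPhi hmu _ muK]]].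
pose W : vectType k := tensor A P; pose b := vbasis {:W}.
exists 'I_(\dim {:W}), (fun l : 'I_(\dim {:W}) => mu (tens b`_l 1)).
exists (fun l => @tens_coord k W B l \o Phi)%VF; split.
  exact: (split_dual_basis hPhi.2 hmu.2 muK).
move=> a n an0; rewrite [LHS](coord_vbasis (memvf _)) big1 // => j _.
suff -> : coord (vbasis {:B}) j (transfer (fun l : 'I_(\dim {:W}) => mu (tens b`_l 1))
    (fun l => @tens_coord k W B l \o Phi)%VF a) = 0 by rewrite scale0r.
(* Each coordinate of the transfer of a is the trace of [La \o v], where La is
   nilpotent and v commutes with La. *)
have [D DE] : exists D : 'Hom(tensor W B, W), forall w y,
    D (tens w y) = coord (vbasis {:B}) j y *: w.
  apply: tensor_map; split=> [u c y z|y c u v].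
    by rewrite linearP /= scalerDl scalerA.
  by rewrite scalerDr !scalerA mulrC.
pose La : 'End(W) := tens_map (amull a) \1%VF.
have Dcoord l z : coord b l (D z) = coord (vbasis {:B}) j (tens_coord B l z).
  elim/tensor_ind: z => [|c u v IHu IHv|u y]; first by rewrite !linear0.
    by rewrite !linearP /= IHu IHv.
  by rewrite DE tens_coordE !linearZ /= mulrC.
have DLa z : D (tens_map La \1%VF z) = La (D z).
  elim/tensor_ind: z => [|c u v IHu IHv|u y]; first by rewrite !linear0.
    by rewrite !linearP /= IHu IHv.
  by rewrite tens_mapE id_lfunE !DE linearZ.
(* [v] goes from W to [P] and back, then contracts [B] against its coordinate [j]; all these maps
   respect the left action of [A], hence [v] commutes with [La]. *)
have [v vE] : exists v : 'End(W), forall w, v w = D (Phi (mu (tens w 1))).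
  by apply: linfunP => c x y; rewrite tensDl tensZl !linearP.
have vLa w : v (La w) = La (v w).
  rewrite !vE -DLa; have -> : tens (La w) 1 = blact (bimod_free A B P) a (tens w 1).
    by rewrite tens_mapE id_lfunE.
  by rewrite hmu.1 hPhi.1.
have -> : coord (vbasis {:B}) j (transfer (fun l : 'I_(\dim {:W}) => mu (tens b`_l 1))
    (fun l => @tens_coord k W B l \o Phi)%VF a) = ltrace (La \o v)%VF.
  rewrite linear_sum; apply: eq_bigr => l _ /=.
  rewrite [in RHS]comp_lfunE vE -DLa Dcoord; congr (coord _ _ _).
  by rewrite [LHS]comp_lfunE; congr (tens_coord _ _ _); rewrite hPhi.1.
(* By commutation the [n]-th iterate of [La \o v] contains that of [La], which is left
   multiplication by [a ^+ n = 0]. *)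
apply: (@ltrace_nilpotent _ _ _ n) => w.
have itv m x : iter m (La \o v)%VF x = iter m La (iter m v x).
  have com m' y : v (iter m' La y) = iter m' La (v y).
    by elim: m' => //= m' <-; rewrite vLa.
  by elim: m => //= m ->; rewrite comp_lfunE com.
rewrite itv; have -> y : iter n La y = tens_map (amull (a ^+ n)) \1%VF y.
  elim: n {an0 itv} => [|m IHm] /=; first by rewrite expr0 amull1 tens_map1 id_lfunE.
  rewrite IHm -[LHS]comp_lfunE -tens_map_comp comp_lfun1l.
  by rewrite -[(_ \o _)%VF]amull_comp -exprS.
rewrite an0; elim/tensor_ind: (iter n v w) => [|c x y IHx IHy|x y].
- by rewrite linear0.
- by rewrite linearP /= IHx IHy scaler0 addr0.
by rewrite tens_mapE lfunE /= mul0r tens0l.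
Qed.

End ProjectiveBimodules.

(** * Complete lists of simple modules, and the comparison of R(A) with R(B) *)

Section SimpleLists.
Variables (k : closedFieldType) (A : falgType k).

Definition simple_list (l : nat) (S : 'I_l -> lmodule A) : Prop :=
  [/\ forall i, simple_module (S i), forall i j, lmod_iso (S i) (S j) -> i = j
    & forall T, simple_module T -> exists i, lmod_iso T (S i)].

(** Independence of characters bounds the number of pairwise non-isomorphic simple modules by the
    dimension of [A], so a family of maximal length exists, and it is complete. *)
Lemma simple_list_exists : exists l (S : 'I_l -> lmodule A), simple_list S.
Proof.
pose Q l := `[< exists S : 'I_l -> lmodule A,
  (forall i, simple_module (S i)) /\ forall i j, lmod_iso (S i) (S j) -> i = j >].
have exQ : exists l, Q l.
  (* The index type is empty here, so the regular module is a mere default. *)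
  exists 0; apply/asboolP; exists (fun=> lmod_regular A).
  by split; case.
have ubQ l : Q l -> (l <= \dim {:A})%N.
  by move=> /asboolP[S [sS nS]]; rewrite -(dim_char_kernel sS nS) leq_addl.
case: (ex_maxnP exQ ubQ) => l /asboolP[S [sS nS]] maxl.
exists l, S; split=> // T sT; apply: contrapT => nT.
suff /maxl : Q l.+1 by rewrite ltnn.
apply/asboolP; pose S' (i : 'I_l.+1) := oapp S T (unlift ord_max i).
exists S'; split=> [i|i j]; rewrite /S'; first by case: unliftP => [i' _|_] /=.
case: unliftP => [i' ->|->] /=; case: unliftP => [j' ->|->] //=.
- by move=> /nS ->.
- by move=> /lmod_iso_sym iso; case: nT; exists i'.
by move=> iso; case: nT; exists j'.
Qed.

(** An element killing every simple module lowers a composition series by one step at each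
    application. *)
Lemma kills_iter (a : A) : (forall T : lmodule A, simple_module T ->
    forall t, lact T a t = 0) ->
  forall M : lmodule A, exists n, forall x, iter n (lact M a) x = 0.
Proof.
move=> ka M; move: {2}(\dim {:M}) (leqnn (\dim {:M})) => d.
elim: d M => [|d IHd] M.
  rewrite leqn0 dimv_eq0 => /eqP M0; exists 0 => x /=.
  by apply/eqP; rewrite -memv0 -M0 memvf.
move=> led; have [M0|M0] := eqVneq (fullv : {vspace M}) 0%VS.
  by exists 0 => x /=; apply/eqP; rewrite -memv0 -M0 memvf.
have [U [W [i [p [[hi hp sU dW] [_ _ ex]]]]]] := simple_extension M0.
have [n an] := IHd W (leq_trans dW led); exists n.+1 => x.
have pit m y : p (iter m (lact M a) y) = iter m (lact W a) (p y).
  by elim: m => //= m <-; rewrite hp.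
rewrite iterS; have [u <-] : exists u, i u = iter n (lact M a) x.
  by apply: ex; rewrite pit an.
by rewrite -hi ka // linear0.
Qed.

Lemma kills_nilpotent l (S : 'I_l -> lmodule A) a : simple_list S -> kills S a ->
  exists n, a ^+ n = 0.
Proof.
move=> [_ _ exS] kS; have [|n an] := @kills_iter a _ (lmod_regular A).
  move=> T /exS[i [f [hf [g fK _]]]] t; apply: (can_inj fK).
  by rewrite hf kS linear0.
exists n; rewrite -(an 1); elim: n {an} => [|n IHn] //.
by rewrite iterS -IHn exprS /= lfunE.
Qed.

End SimpleLists.

(** The hypotheses say that [V] is the part of [U] sent into [V'], so that [f] induces an injection
    of U/V into U'/V'. *)
Lemma dim_sub_le (k : fieldType) (X Y : vectType k) (f : 'Hom(X, Y))
    (U V : {vspace X}) (U' V' : {vspace Y}) :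
  (V <= U :&: f @^-1: V')%VS -> (V' <= U')%VS -> (f @: U <= U')%VS ->
  (U :&: f @^-1: V' <= V)%VS -> (\dim U - \dim V <= \dim U' - \dim V')%N.
Proof.
move=> leV leV' leU leV2; pose q := vquot_proj V'.
have kq (W : {vspace X}) : (f @: W <= U')%VS -> (\dim (q @: (f @: W)) + \dim V' <= \dim U')%N.
  move=> leW; rewrite -(limg_ker_dim q U') addnC lker_vquot_proj.
  by rewrite (capv_idPr leV') leq_add2l dimvS // limgS.
have <- : (U :&: lker (q \o f) = V)%VS.
  suff -> : lker (q \o f)%VF = (f @^-1: V')%VS by apply/eqP; rewrite eqEsubv leV leV2.
  apply/vspaceP => x; rewrite memv_ker -memv_preim comp_lfunE -memv_ker.
  by rewrite lker_vquot_proj.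
rewrite -{1}(limg_ker_dim (q \o f) U) addKn limg_comp leq_subRL; last exact: dimvS.
by rewrite addnC; apply: kq.
Qed.

Section StableTransfer.
Variable k : closedFieldType.

(** M (x)_B N is the regular bimodule plus [P]. The first summand contributes the identity transfer,
    the second kills nilpotent elements; on these [tN] therefore undoes [tM] modulo commutators. *)
Lemma stable_transfer (A B : falgType k) : stably_equiv_morita A B ->
  exists (tM : 'Hom(A, B)) (tN : 'Hom(B, A)),
  [/\ forall a a', tM (a * a' - a' * a) \in comm_space B,
      forall b b', tN (b * b' - b' * b) \in comm_space A,
      forall (T : lmodule B) a n, a ^+ n = 0 -> ltrace (lact T (tM a)) = 0
    & forall a n, a ^+ n = 0 -> tN (tM a) - a \in comm_space A].
Proof.
case=> M [N [P [Q [[_ pM] [_ pN] [pP _] iso _]]]].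
have [I [m [phi dM]]] := right_dual_basis_exists pM.
have [J [n [psi dN]]] := right_dual_basis_exists pN.
have [L [p [zeta [dP tP]]]] := projective_transfer pP.
have [chi [dMN tMN]] := comp_dual_basis dM dN.
have [tM tME] := linfunP (transfer_linear m phi).
have [tN tNE] := linfunP (transfer_linear n psi).
exists tM, tN; split.
- by move=> a a'; rewrite tME; apply: transfer_comm.
- by move=> a a'; rewrite tNE; apply: transfer_comm.
- by move=> T a e ae; rewrite tME; apply: (transfer_nilpotent dM _ ae).
(* The regular bimodule has the one-element dual basis 1, whose transfer is the identity. *)
move=> a e ae; have dA : right_dual_basis (fun _ : 'I_1 => 1 : bimod_regular A)
    (fun=> \1%VF : 'Hom(bimod_regular A, A)).
  split=> [i b x|x]; first by rewrite !id_lfunE lfunE.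
  by rewrite big_ord1 id_lfunE lfunE /= mul1r.
have := retract_transfer a dMN dA dP (bimod_iso_sum_retract iso).
rewrite tMN -tME -tNE (tP _ _ ae) addr0.
by rewrite [X in _ - X]big_ord1 id_lfunE lfunE /= mulr1.
Qed.

(** [tM] induces a map from R(A) to R(B), injective because [tN] gives a left inverse: every class
    of R(A) has a nilpotent representative. *)
Lemma stable_comm_le (A B : falgType k) lA (SA : 'I_lA -> lmodule A)
    lB (SB : 'I_lB -> lmodule B) :
  simple_list SA -> simple_list SB -> stably_equiv_morita A B ->
  (\dim (char_kernel SA) - \dim (comm_space A) <=
   \dim (char_kernel SB) - \dim (comm_space B))%N.
Proof.
move=> cSA cSB /stable_transfer[tM [tN [tMC tNC tMn tNM]]].
have [sA nA _] := cSA; have [sB nB _] := cSB.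
have tMK x : x \in comm_space A -> tM x \in comm_space B.
  move=> xK; rewrite memv_preim; apply: subvP xK; apply: comm_space_sub => a a'.
  by rewrite -memv_preim.
have tNK x : x \in comm_space B -> tN x \in comm_space A.
  move=> xK; rewrite memv_preim; apply: subvP xK; apply: comm_space_sub => a a'.
  by rewrite -memv_preim.
have split_nil x : x \in char_kernel SA ->
    exists y z n, [/\ x = y + z, y \in comm_space A & z ^+ n = 0].
  move=> /(char_kernel_comm sA nA)[y yK kz].
  have [n zn] := kills_nilpotent cSA kz.
  by exists y, (x - y), n; rewrite addrC subrK.
have KB := comm_space_char_kernel SB.
apply: (@dim_sub_le _ _ _ tM) => //.
- by apply/subvP => x xK; rewrite memv_cap (subvP (comm_space_char_kernel SA)) //= -memv_preim tMK.
- apply/subvP => _ /memv_imgP[x /split_nil[y [z [n [-> yK zn]]]] ->].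
  rewrite linearD memvD //; first by apply: subvP KB _ _; apply: tMK.
  by apply/mem_char_kernel => i; apply: tMn zn.
apply/subvP => x; rewrite memv_cap -memv_preim => /andP[/split_nil[y [z [n [-> yK zn]]]]].
move=> /tNK; rewrite !linearD /= => h.
have hz : tN (tM z) \in comm_space A.
  by rewrite -[tN (tM z)](addKr (tN (tM y))) memvD // memvN tNK // tMK.
rewrite memvD // -[z](subKr (tN (tM z))) memvB //.
exact: tNM zn.
Qed.

End StableTransfer.

(** * Tensoring with the group algebra of a p-group *)

Section GroupAlgebraTensor.
Variables (k : fieldType) (gT : finGroupType) (A : falgType k).
Local Notation kG := (group_alg k gT).
Local Notation L := (tensor A kG).

Lemma galg_sum (f : kG) : f = \sum_g f g *: galg_elt k g.
Proof.
apply/ffunP => x; rewrite sum_ffunE (bigD1 x) //= !ffunE eqxx big1 ?addr0 => [|y yx].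
  by rewrite [RHS]mulr1.
by rewrite !ffunE eq_sym (negPf yx) [LHS]mulr0.
Qed.

Lemma tens_algM (a a' : A) (f f' : kG) :
  tens a f * tens a' f' = tens (a * a') (f * f') :> L.
Proof. exact: tens_mulE. Qed.

Definition tens_eval (g : gT) : 'Hom(L, A) :=
  linfun (tensor_lift (fun a (f : kG) => f g *: a)).

Lemma tens_evalE g a f : tens_eval g (tens a f) = f g *: a.
Proof.
rewrite lfunE /= tensor_liftE //; split=> [u c x y|y c u v].
  by rewrite !ffunE scalerDl scalerA.
by rewrite scalerDr !scalerA mulrC.
Qed.

Definition augmentation : 'Hom(L, A) := \sum_g tens_eval g.

Lemma augmentationE a f : augmentation (tens a f) = (\sum_g f g) *: a.
Proof.
by rewrite sum_lfunE scaler_suml; apply: eq_bigr => g _; rewrite tens_evalE.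
Qed.

Lemma galg_elt_sum (g : gT) : \sum_h (galg_elt k g) h = 1.
Proof.
rewrite (bigD1 g) //= ffunE eqxx big1 ?addr0 // => h hg.
by rewrite ffunE (negPf hg).
Qed.

Lemma augmentation_elt a (g : gT) : augmentation (tens a (galg_elt k g)) = a.
Proof. by rewrite augmentationE galg_elt_sum scale1r. Qed.

Lemma augmentation1 a : augmentation (tens a 1) = a.
Proof. exact: augmentation_elt. Qed.

Lemma tens_elt_ind (P : L -> Prop) :
  P 0 -> (forall c x y, P x -> P y -> P (c *: x + y)) ->
  (forall a g, P (tens a (galg_elt k g))) -> forall x, P x.
Proof.
move=> P0 PD Pt; apply: tensor_ind => // a f; rewrite [f]galg_sum tens_sumr.
elim/big_ind: _ => // [x y Px Py|g _]; first by rewrite -[x]scale1r; apply: PD.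
by rewrite tensZr -[_ *: _]addr0; apply: PD.
Qed.

Lemma augmentationM x y : augmentation (x * y) = augmentation x * augmentation y.
Proof.
elim/tens_elt_ind: x => [|c x x' IHx IHx'|a g]; first by rewrite mul0r linear0 mul0r.
  by rewrite mulrDl -scalerAl !linearP /= IHx IHx' mulrDl -scalerAl.
elim/tens_elt_ind: y => [|c y y' IHy IHy'|b h]; first by rewrite mulr0 linear0 mulr0.
  by rewrite mulrDr -scalerAr !linearP /= IHy IHy' mulrDr -scalerAr.
by rewrite tens_algM -galg_eltM !augmentation_elt.
Qed.

Section Inflation.
Variable M : lmodule A.

Fact inflate_linear : linear (fun x : L => lact M (augmentation x)).
Proof. by move=> c x y; rewrite linearP lact_linear. Qed.

Fact inflate1 : lact M (augmentation 1) = \1%VF.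
Proof. by rewrite augmentation1 lact1. Qed.

Fact inflateM x y : lact M (augmentation (x * y)) =
  (lact M (augmentation x) \o lact M (augmentation y))%VF.
Proof. by rewrite augmentationM lactM. Qed.

Definition inflate : lmodule L := LModule inflate_linear inflate1 inflateM.

Lemma inflate_simple : simple_module M -> simple_module inflate.
Proof.
case=> _ M0 minM; split=> // [x|U sU _]; first exact: subvf.
by apply: minM; rewrite ?subvf // => a; have := sU (tens a 1); rewrite /= augmentation1.
Qed.

End Inflation.

Lemma inflate_iso (M M' : lmodule A) :
  lmod_iso (inflate M) (inflate M') <-> lmod_iso M M'.
Proof.
split=> -[f [hf bf]]; exists f; split=> // a m; last exact: hf.
by have := hf (tens a 1) m; rewrite /= augmentation1.
Qed.

Section Restriction.
Variable T : lmodule L.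

Fact restrict_linear : linear (fun a : A => lact T (tens a 1)).
Proof. by move=> c x y; rewrite tensDl tensZl lact_linear. Qed.

Fact restrictM a b : lact T (tens (a * b) 1) =
  (lact T (tens a 1) \o lact T (tens b 1))%VF.
Proof. by rewrite -lactM tens_algM mulr1. Qed.

Definition restrict : lmodule A := LModule restrict_linear (lact1 T) restrictM.

End Restriction.

End GroupAlgebraTensor.

(** The kernel of a central element is a submodule; were it zero, the powers of [z] would act
    injectively on a nonzero module. *)
Lemma central_nilpotent_simple (k : fieldType) (A : falgType k) (T : lmodule A) z n :
  simple_module T -> (forall x, z * x = x * z) -> z ^+ n = 0 ->
  forall t, lact T z t = 0.
Proof.
move=> sT zC zn; have sker : submodule (lker (lact T z)).
  apply/submoduleP => a m; rewrite !memv_ker => /eqP zm.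
  by rewrite -lactMx zC lactMx zm linear0.
case: (simple_sub sT sker) => ker t; last by apply/eqP; rewrite -memv_ker ker memvf.
have /lker0P zinj : lker (lact T z) == 0%VS by rewrite ker.
have [s s0] := simple_neq0 sT; case/negP: s0; apply/eqP.
have {zn} : lact T (z ^+ n) s = 0 by rewrite zn lact0x.
elim: n => [|n IHn]; first by rewrite lact1x.
by rewrite exprS lactMx => h; apply/IHn/zinj; rewrite h linear0.
Qed.

Section PGroup.
Variables (k : closedFieldType) (p : nat) (gT : finGroupType) (A : falgType k).
Hypotheses (p_char : p \in [pchar k]) (gT_abelian : abelian [set: gT])
  (gT_order : #|[set: gT]| = p).
Local Notation kG := (group_alg k gT).
Local Notation L := (tensor A kG).

Lemma galg_mulC (f g : kG) : f * g = g * f.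
Proof.
apply/ffunP => x; rewrite !ffunE (reindex_inj (inj_comp (mulgI x) invg_inj)) /=.
apply: eq_bigr => y _; rewrite mulrC invMg invgK mulgKV; congr (g _ * f _).
by have /centsP := gT_abelian; apply; rewrite inE.
Qed.

Lemma galg_elt_sub1_nilpotent (g : gT) : (galg_elt k g - 1 : kG) ^+ p = 0.
Proof.
have pL : p \in [pchar kG] by rewrite (pchar_lalg kG).
have := pFrobenius_autB_comm pL (GRing.commr1 (galg_elt k g : kG)).
rewrite !pFrobenius_autE => ->.
have -> : (galg_elt k g : kG) ^+ p = galg_elt k (g ^+ p)%g.
  elim: {pL} p => // n IHn; by rewrite exprS expgS galg_eltM IHn.
by rewrite -gT_order expg_cardG ?inE // expr1n subrr.
Qed.

(** As the group is abelian, the elements 1 (x) (g - 1) are central, and they are nilpotent since (g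
    - 1)^p = g^p - 1 = 0. They act as zero, so a simple module sees only the augmentation. *)
Lemma simple_augmentation (T : lmodule L) : simple_module T ->
  forall x, lact T x = lact T (tens (augmentation gT A x) 1).
Proof.
move=> sT; apply: tens_elt_ind => [|c x y IHx IHy|a g].
- by rewrite linear0 tens0l.
- by rewrite lact_linear IHx IHy -lact_linear linearP tensDl tensZl.
rewrite augmentation_elt; apply/lfunP => t; apply/eqP; rewrite -subr_eq0 -lactBx.
have -> : tens a (galg_elt k g) - tens a 1 = tens a 1 * tens 1 (galg_elt k g - 1) :> L.
  rewrite tens_algM mulr1 mul1r tensDr; congr (_ + _).
  by rewrite -[in RHS]scaleN1r tensZr scaleN1r.
rewrite lactMx (@central_nilpotent_simple _ _ _ (tens 1 (galg_elt k g - 1)) p) ?linear0 // => [x|].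
  elim/tensor_ind: x => [|c x y IHx IHy|b f]; first by rewrite mulr0 mul0r.
    by rewrite mulrDr mulrDl -scalerAr -scalerAl IHx IHy.
  by rewrite !tens_algM mul1r mulr1; congr (tens _ _); exact: galg_mulC.
have -> : forall n (f : kG), (tens 1 f : L) ^+ n = tens 1 (f ^+ n).
  by move=> n f; elim: n => // n IHn; rewrite !exprS IHn tens_algM mulr1.
by rewrite galg_elt_sub1_nilpotent tens0r.
Qed.

Lemma inflate_simple_list l (S : 'I_l -> lmodule A) :
  simple_list S -> simple_list (fun i => inflate gT (S i)).
Proof.
move=> [sS nS exS]; split=> [i|i j|T sT]; first exact: inflate_simple.
  by move/inflate_iso/nS.
have TE := simple_augmentation sT.
have sR : simple_module (restrict T).
  case: (sT) => _ T0 minT; split=> // [a|U sU _]; first exact: subvf.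
  by apply: minT; rewrite ?subvf // => x; rewrite TE; apply: sU.
have [i [f [hf bf]]] := exS _ sR; exists i, f; split=> // x t.
by rewrite TE; apply: hf.
Qed.

Lemma dim_galg_tensor : \dim {:L} = (p * \dim {:A})%N.
Proof.
transitivity (\dim {:A} * \dim {:kG})%N; first by rewrite dimvf.
rewrite mulnC; congr (_ * _)%N; rewrite dimvf -gT_order cardsT.
exact: muln1.
Qed.

(** For an abelian group the commutator of a (x) g and b (x) h is [a, b] (x) gh. Hence K(A (x) kG)
    is the direct sum of the copies K(A) (x) g, and taking h = 1 reaches all of each copy. *)
Lemma dim_comm_space_galg : \dim (comm_space L) = (p * \dim (comm_space A))%N.
Proof.
have /choice[i iE] : forall g : gT, exists f : 'Hom(A, L),
    forall a, f a = tens a (galg_elt k g).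
  by move=> g; apply: linfunP => c x y; rewrite tensDl tensZl.
have -> : comm_space L = (\sum_g i g @: comm_space A)%VS.
  apply/eqP; rewrite eqEsubv; apply/andP; split.
    apply: comm_space_sub => x y.
    elim/tens_elt_ind: x => [|c x x' IHx IHx'|a g].
    - by rewrite mul0r mulr0 subrr mem0v.
    - rewrite mulrDl mulrDr -scalerAl -scalerAr opprD addrACA -scalerBr.
      by rewrite memvD ?memvZ.
    elim/tens_elt_ind: y => [|c y y' IHy IHy'|b h].
    - by rewrite mul0r mulr0 subrr mem0v.
    - rewrite mulrDl mulrDr -scalerAl -scalerAr opprD addrACA -scalerBr.
      by rewrite memvD ?memvZ.
    rewrite !tens_algM (_ : galg_elt k h * galg_elt k g = galg_elt k g * galg_elt k h);
      last exact: galg_mulC.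
    rewrite -galg_eltM.
    rewrite -!iE -linearB; apply: (subvP (sumv_sup (g * h)%g _ (subvv _))) => //.
    exact/memv_img/mem_comm_space.
  apply/subv_sumP => g _; apply/subvP => _ /memv_imgP[a aK ->].
  rewrite memv_preim; apply: subvP aK; apply: comm_space_sub => {}a b.
  rewrite -memv_preim linearB /= !iE.
  have -> : tens (a * b) (galg_elt k g) = tens a (galg_elt k g) * tens b 1 :> L.
    by rewrite tens_algM mulr1.
  have -> : tens (b * a) (galg_elt k g) = tens b 1 * tens a (galg_elt k g) :> L.
    by rewrite tens_algM mul1r.
  exact: mem_comm_space.
(* Reading off the coefficient at [g] recovers the [g]-th component, which shows both that the sum
   is direct and that each [i g] is injective. *)
have evi g h a : tens_eval A g (i h a) = (g == h)%:R *: a.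
  by rewrite iE tens_evalE ffunE.
have /directvP -> /= : directv (\sum_g i g @: comm_space A).
  apply/directv_sum_independent => us usK us0 g _.
  have [a _ ua] := memv_imgP (usK g isT); rewrite ua.
  have := congr1 (tens_eval A g) us0; rewrite linear0 linear_sum (bigD1 g) //= ua evi.
  rewrite eqxx scale1r big1 ?addr0 => [->|h hg]; first by rewrite linear0.
  have [b _ ->] := memv_imgP (usK h isT).
  by rewrite evi eq_sym (negPf hg) scale0r.
rewrite -gT_order cardsT -sum_nat_const; apply: eq_bigr => g _.
apply: limg_dim_eq; apply/eqP; rewrite -subv0; apply/subvP => a.
rewrite memv_cap memv_ker => /andP[_ /eqP ia0].
by rewrite memv0 -[a]scale1r -[1]/((true : bool)%:R) -(eqxx g) -evi ia0 linear0.
Qed.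

End PGroup.

(** * Hom modules and null homomorphisms *)

Section LinearMaps.
Variables (k : fieldType) (U V : vectType k) (f : U -> V).
Hypothesis lf : linear f.

Definition lfun_of : 'Hom(U, V) := projT1 (cid (linfunP lf)).

Lemma lfun_ofE x : lfun_of x = f x.
Proof. exact: (projT2 (cid (linfunP lf))). Qed.

End LinearMaps.

Section HomModule.
Variables (k : fieldType) (A B : falgType k) (M : bimodule A B) (X : lmodule A).

Definition left_hom (f : 'Hom(M, X)) : Prop :=
  forall a m, f (blact M a m) = lact X a (f m).

Lemma left_hom_linear : linear_pred left_hom.
Proof.
split=> [a m|c f g hf hg a m]; first by rewrite !zero_lfunE linear0.
by rewrite !add_lfunE !scale_lfunE hf hg linearP.
Qed.

Definition hom_space : {vspace 'Hom(M, X)} := pred_vspace left_hom.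

Definition hom_carrier : vectType k := subvs_of hom_space.

Definition hom_app (f : hom_carrier) : 'Hom(M, X) := vsval f.

(** A total projection, so that linearity holds without side conditions; it inverts [hom_app] only
    on maps satisfying [left_hom]. *)
Definition hom_mk (f : 'Hom(M, X)) : hom_carrier := vsproj hom_space f.

Lemma hom_appP f a m : hom_app f (blact M a m) = lact X a (hom_app f m).
Proof.
by move: a m; apply/(mem_pred_vspace _ left_hom_linear); exact: subvsP.
Qed.

Lemma hom_mkK f : left_hom f -> hom_app (hom_mk f) = f.
Proof.
by move=> hf; apply: vsprojK; apply/(mem_pred_vspace _ left_hom_linear).
Qed.

Lemma hom_ext f g : (forall m, hom_app f m = hom_app g m) -> f = g.
Proof. by move=> fg; apply: val_inj; apply/lfunP. Qed.

Lemma hom_appL c f g m : hom_app (c *: f + g) m = c *: hom_app f m + hom_app g m.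
Proof. by rewrite /hom_app linearP add_lfunE scale_lfunE. Qed.

Lemma hom_mkL c f g : hom_mk (c *: f + g) = c *: hom_mk f + hom_mk g.
Proof. by rewrite /hom_mk linearP. Qed.

Fact hom_act_subproof b : linear (fun f => hom_mk (hom_app f \o bract M b)%VF).
Proof.
move=> c f g; rewrite -hom_mkL; congr hom_mk; apply/lfunP => m.
by rewrite add_lfunE scale_lfunE !comp_lfunE hom_appL.
Qed.

Definition hom_act b : 'End(hom_carrier) := lfun_of (hom_act_subproof b).

Lemma hom_actE b f m : hom_app (hom_act b f) m = hom_app f (bract M b m).
Proof.
rewrite lfun_ofE hom_mkK ?comp_lfunE // => a x.
by rewrite !comp_lfunE -blactCx hom_appP.
Qed.

Fact hom_act_linear : linear hom_act.
Proof.
move=> c b b'; apply/lfunP => f; apply: hom_ext => m.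
by rewrite add_lfunE scale_lfunE hom_appL !hom_actE bract_lin linearP.
Qed.

Fact hom_act1 : hom_act 1 = \1%VF.
Proof.
by apply/lfunP => f; apply: hom_ext => m; rewrite hom_actE bract1x id_lfunE.
Qed.

Fact hom_actM b b' : hom_act (b * b') = (hom_act b \o hom_act b')%VF.
Proof.
apply/lfunP => f; apply: hom_ext => m.
by rewrite [in RHS]comp_lfunE !hom_actE bractMx.
Qed.

Definition hom_mod : lmodule B := LModule hom_act_linear hom_act1 hom_actM.

Lemma hom_modE b (f : hom_mod) m : hom_app (lact hom_mod b f) m = hom_app f (bract M b m).
Proof. exact: hom_actE. Qed.

Lemma hom_modL c (f g : hom_mod) m :
  hom_app (c *: f + g) m = c *: hom_app f m + hom_app g m.
Proof. exact: hom_appL. Qed.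

End HomModule.

Section HomMap.
Variables (k : fieldType) (A B : falgType k) (M : bimodule A B).
Implicit Types X Y Z : lmodule A.

Fact hmap_subproof X Y (h : 'Hom(X, Y)) :
  linear (fun f : hom_mod M X => hom_mk (h \o hom_app f)%VF : hom_mod M Y).
Proof.
move=> c f g; rewrite -[RHS]hom_mkL; congr hom_mk; apply/lfunP => m.
by rewrite add_lfunE scale_lfunE !comp_lfunE hom_modL linearP.
Qed.

Definition hmap X Y (h : 'Hom(X, Y)) : 'Hom(hom_mod M X, hom_mod M Y) :=
  lfun_of (hmap_subproof h).

Lemma hmapE X Y (h : 'Hom(X, Y)) f m : lmod_hom h ->
  hom_app (hmap h f) m = h (hom_app f m).
Proof.
move=> hh; rewrite lfun_ofE hom_mkK ?comp_lfunE // => a x.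
by rewrite !comp_lfunE hom_appP hh.
Qed.

Lemma hmap_hom X Y (h : 'Hom(X, Y)) : lmod_hom h -> lmod_hom (hmap h).
Proof.
by move=> hh b f; apply: hom_ext => m; rewrite hmapE // !hom_modE hmapE.
Qed.

Lemma hmap_comp X Y Z (g : 'Hom(Y, Z)) (h : 'Hom(X, Y)) :
  lmod_hom g -> lmod_hom h -> hmap (g \o h)%VF = (hmap g \o hmap h)%VF.
Proof.
move=> hg hh; apply/lfunP => f; apply: hom_ext => m.
by rewrite comp_lfunE !hmapE ?comp_lfunE //; apply: lmod_hom_comp.
Qed.

Lemma hmap1 X : hmap (\1%VF : 'Hom(X, X)) = \1%VF.
Proof.
apply/lfunP => f; apply: hom_ext => m.
by rewrite hmapE ?id_lfunE //; apply: lmod_hom_id.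
Qed.

Lemma hmap_surj X Y (h : 'Hom(X, Y)) : lmod_projective (bimod_left M) ->
  lmod_hom h -> (forall y, exists x, h x = y) ->
  forall g, exists f, hmap h f = g.
Proof.
move=> pM hh sh g; have [||f [hf hfg]] := pM X Y h (hom_app g) hh.
- apply/eqP; rewrite eqEsubv subvf; apply/subvP => y _.
  by have [x <-] := sh y; rewrite memv_img ?memvf.
- exact: hom_appP.
exists (hom_mk f); apply: hom_ext => m.
by rewrite hmapE // hom_mkK // -hfg comp_lfunE.
Qed.

End HomMap.

Section Null.
Variables (k : fieldType) (A : falgType k).
Implicit Types X Y Z W : lmodule A.

(* A homomorphism is null when it extends along the embedding of its source X
   into the coinduced, hence injective, module Hom_k(A, X), that is, when it
   factors through an injective module. *)
Definition null X Y (h : 'Hom(X, Y)) : Prop :=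
  exists w : 'Hom('Hom(A, X), Y),
    (forall a (u : 'Hom(A, X)), w (u \o amulr a)%VF = lact Y a (w u)) /\
    (forall x (u : 'Hom(A, X)), (forall a, u a = lact X a x) -> w u = h x).

Lemma null_compl X Y Z (g : 'Hom(Y, Z)) (h : 'Hom(X, Y)) :
  lmod_hom g -> null h -> null (g \o h)%VF.
Proof.
move=> hg [w [wA wx]]; exists (g \o w)%VF; split=> [a u|x u ux].
  by rewrite !comp_lfunE wA hg.
by rewrite !comp_lfunE (wx x).
Qed.

Lemma null_compr W X Y (h : 'Hom(X, Y)) (f : 'Hom(W, X)) :
  lmod_hom f -> null h -> null (h \o f)%VF.
Proof.
move=> hf [w [wA wx]].
have lw : linear (fun u : 'Hom(A, W) => w (f \o u)%VF).
  by move=> c u v; rewrite comp_lfunDr -comp_lfunZr linearP.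
exists (lfun_of lw); split=> [a u|x u ux]; rewrite !lfun_ofE.
  by rewrite comp_lfunA wA.
by rewrite comp_lfunE; apply: wx => a; rewrite comp_lfunE ux hf.
Qed.

End Null.

Section NullHom.
Variables (k : fieldType) (A B : falgType k) (M : bimodule A B).

(** An extension [w] of [h] to Hom_k(A, X) yields one of [hmap M h] to Hom_k(B, Hom_A(M, X)): [u]
    goes to the map sending [x] to [w] of a |-> sum_i u(phi_i(a x))(m_i). When u(b) = b g, the dual
    basis identity collapses the sum to g(a x). *)
Lemma hmap_null (I : finType) (m : I -> M) phi (X Y : lmodule A) (h : 'Hom(X, Y)) :
  right_dual_basis m phi -> lmod_hom h -> null h -> null (hmap M h).
Proof.
move=> [phir mphi] hh [w [wA wx]].
have lG (u : 'Hom(B, hom_mod M X)) x : linear (fun a : A =>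
    \sum_i hom_app (u (phi i (blact M a x))) (m i)).
  move=> c a b; rewrite scaler_sumr -big_split; apply: eq_bigr => i _.
  by rewrite blact_lin !linearP hom_modL.
pose G u x := lfun_of (lG u x).
have GE u x a : G u x a = \sum_i hom_app (u (phi i (blact M a x))) (m i).
  exact: lfun_ofE.
have lO u : linear (fun x => w (G u x)).
  move=> c x y; rewrite -linearP; congr (w _); apply/lfunP => a.
  rewrite add_lfunE scale_lfunE !GE scaler_sumr -big_split; apply: eq_bigr => i _.
  by rewrite !linearP hom_modL.
have hO u : left_hom (lfun_of (lO u)).
  move=> a x; rewrite !lfun_ofE -wA; congr (w _); apply/lfunP => b.
  rewrite comp_lfunE !GE lfunE /=; apply: eq_bigr => i _.
  by rewrite blactMx.
have lW : linear (fun u => hom_mk (lfun_of (lO u)) : hom_mod M Y).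
  move=> c u v; apply: hom_ext => x; rewrite hom_modL !hom_mkK // !lfun_ofE.
  rewrite -linearP; congr (w _); apply/lfunP => a.
  rewrite add_lfunE scale_lfunE !GE scaler_sumr -big_split; apply: eq_bigr => i _.
  by rewrite add_lfunE scale_lfunE hom_modL.
exists (lfun_of lW); split=> [b u|g u ug]; apply: hom_ext => x.
  rewrite hom_modE !lfun_ofE !hom_mkK // !lfun_ofE; congr (w _).
  apply/lfunP => a; rewrite !GE; apply: eq_bigr => i _.
  by rewrite comp_lfunE lfunE /= blactCx phir.
rewrite lfun_ofE hom_mkK // lfun_ofE hmapE //; apply: wx => a.
rewrite GE -hom_appP -[in RHS](mphi (blact M a x)) linear_sum.
by apply: eq_bigr => i _; rewrite ug hom_modE.
Qed.

(** Hom_A(P, X) is a summand of Hom_A(A (x) P (x) B, X), a module coinduced from [k]. Concretely [u]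
    defines T(x (x) p (x) y) = x u(y)(p), to be composed with the splitting [Phi]; when u(b) = b g,
    [T] is [g] after [mu], and [Phi] returns [g]. *)
Lemma projective_hom_null (P : bimodule A B) (X : lmodule A) :
  bimod_projective P -> null (\1%VF : 'End(hom_mod P X)).
Proof.
move=> /bimod_projective_split[Phi [mu [hPhi hmu muE muK]]].
have exT (u : 'Hom(B, hom_mod P X)) : exists T : 'Hom(tensor (tensor A P) B, X),
    forall x p y, T (tens (tens x p) y) = lact X x (hom_app (u y) p).
  have exN y : exists F : 'Hom(tensor A P, X),
      forall x p, F (tens x p) = lact X x (hom_app (u y) p).
    apply: tensor_map; split=> [x c p q|p c x z]; first by rewrite !linearP.
    exact: lact_lin.
  have [F FE] := choice exN.
  have [T TE] : exists T : 'Hom(tensor (tensor A P) B, X),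
      forall z y, T (tens z y) = F y z.
    apply: tensor_map; split=> [z c y y'|y c z z']; last by rewrite linearP.
    elim/tensor_ind: z => [|d z z' IHz IHz'|x p]; first by rewrite !linear0 ?scaler0 ?addr0.
      rewrite !linearP /= IHz IHz' !scalerDr !scalerA addrACA.
      by rewrite [d * c]mulrC.
    by rewrite !FE linearP hom_modL linearP.
  by exists T => x p y; rewrite TE FE.
have [T TE] := choice exT.
have Text (F G : 'Hom(tensor (tensor A P) B, X)) :
    (forall x p y, F (tens (tens x p) y) = G (tens (tens x p) y)) -> F = G.
  move=> FG; apply: tensor_lfun_ext => z y.
  elim/tensor_ind: z => [|d z z' IHz IHz'|x p]; last exact: FG.
    by rewrite tens0l !linear0.
  by rewrite tensDl tensZl !linearP /= IHz IHz'.
have TA u a z : T u (blact (bimod_free A B P) a z) = lact X a (T u z).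
  have /lfunP/(_ z) : (T u \o blact (bimod_free A B P) a)%VF = (lact X a \o T u)%VF.
    apply: Text => x p y; rewrite [LHS]comp_lfunE [RHS]comp_lfunE free_lactE !TE.
    by rewrite lactMx.
  by rewrite [LHS]comp_lfunE [RHS]comp_lfunE.
have hT u : left_hom (T u \o Phi)%VF.
  by move=> a p; rewrite [LHS]comp_lfunE hPhi.1 TA comp_lfunE.
have lW : linear (fun u => hom_mk (T u \o Phi)%VF : hom_mod P X).
  move=> c u v; apply: hom_ext => p; rewrite hom_modL !hom_mkK //.
  rewrite [LHS]comp_lfunE.
  have -> : T (c *: u + v) = c *: T u + T v.
    apply: Text => x q y; rewrite add_lfunE scale_lfunE !TE add_lfunE scale_lfunE.
    by rewrite hom_modL linearP.
  by rewrite add_lfunE scale_lfunE !comp_lfunE.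
exists (lfun_of lW); split=> [b u|g u ug]; apply: hom_ext => p.
  rewrite hom_modE !lfun_ofE !hom_mkK // [LHS]comp_lfunE [RHS]comp_lfunE hPhi.2.
  have /lfunP/(_ (Phi p)) : (T u \o bract (bimod_free A B P) b)%VF = T (u \o amulr b)%VF.
    apply: Text => x q y; rewrite [LHS]comp_lfunE free_ractE !TE comp_lfunE.
    by rewrite lfunE.
  by rewrite [LHS]comp_lfunE => ->.
rewrite lfun_ofE hom_mkK // comp_lfunE id_lfunE -[in RHS](muK p).
have /lfunP/(_ (Phi p)) : T u = (hom_app g \o mu)%VF.
  apply: Text => x q y; rewrite [RHS]comp_lfunE muE TE ug hom_modE.
  by rewrite -blactCx hom_appP.
by rewrite comp_lfunE.
Qed.

End NullHom.

(** * Tensor-Hom adjunction and the unit of the stable equivalence *)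

Section Currying.
Variables (k : fieldType) (A B C : falgType k).
Variables (M : bimodule A B) (N : bimodule B C) (X : lmodule A).
Local Notation MN := (bimod_tensor M N).
Local Notation HH := (hom_mod N (hom_mod M X)).

Lemma btens_linl (n : N) : linear (fun m : M => btens m n : MN).
Proof. exact: (btens_bilinear M N).2. Qed.

Lemma btens_linr (m : M) : linear (fun n : N => btens m n : MN).
Proof. exact: (btens_bilinear M N).1. Qed.

Lemma bimod_tensor_ext (W : vectType k) (f g : 'Hom(MN, W)) :
  (forall m n, f (btens m n) = g (btens m n)) -> f = g.
Proof. exact: btensor_lfun_ext. Qed.

Lemma uncurry_exists (F : HH) : exists G : 'Hom(MN, X),
  forall m n, G (btens m n) = hom_app (hom_app F n) m.
Proof.
apply: (@btensor_universal _ _ _ _ M N).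
  split=> [m c n n'|n c m m']; last by rewrite linearP.
  by rewrite linearP hom_modL.
by move=> m b n; rewrite hom_appP hom_modE.
Qed.

Definition uncurry F : 'Hom(MN, X) := projT1 (cid (uncurry_exists F)).

Lemma uncurryE F m n : uncurry F (btens m n) = hom_app (hom_app F n) m.
Proof. exact: (projT2 (cid (uncurry_exists F))). Qed.

Lemma uncurryL c F G : uncurry (c *: F + G) = c *: uncurry F + uncurry G.
Proof.
apply: bimod_tensor_ext => m n; rewrite add_lfunE scale_lfunE !uncurryE.
by rewrite hom_modL hom_modL.
Qed.

Lemma uncurry_left F a z : uncurry F (blact MN a z) = lact X a (uncurry F z).
Proof.
have /lfunP/(_ z) : (uncurry F \o blact MN a)%VF = (lact X a \o uncurry F)%VF.
  apply: bimod_tensor_ext => m n; rewrite [LHS]comp_lfunE [RHS]comp_lfunE.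
  by rewrite blact_btens !uncurryE hom_appP.
by rewrite [LHS]comp_lfunE [RHS]comp_lfunE.
Qed.

Lemma uncurry_right F c z : uncurry (lact HH c F) z = uncurry F (bract MN c z).
Proof.
have /lfunP/(_ z) : uncurry (lact HH c F) = (uncurry F \o bract MN c)%VF.
  apply: bimod_tensor_ext => m n; rewrite [RHS]comp_lfunE.
  by rewrite bract_btens !uncurryE hom_modE.
by rewrite [RHS]comp_lfunE.
Qed.

Fact curry_inner (G : 'Hom(MN, X)) n : linear (fun m : M => G (btens m n)).
Proof. by move=> c m m'; rewrite btens_linl linearP. Qed.

Fact curry_outer (G : 'Hom(MN, X)) :
  linear (fun n : N => hom_mk (lfun_of (curry_inner G n)) : hom_mod M X).
Proof.
move=> c n n'; rewrite -[RHS]hom_mkL; congr hom_mk; apply/lfunP => m.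
by rewrite add_lfunE scale_lfunE !lfun_ofE btens_linr linearP.
Qed.

(** Total in [G], but inverse to [uncurry] only on maps commuting with the left action of [A]. *)
Definition curry (G : 'Hom(MN, X)) : HH := hom_mk (lfun_of (curry_outer G)).

Lemma curryE (G : 'Hom(MN, X)) m n :
  (forall a z, G (blact MN a z) = lact X a (G z)) ->
  hom_app (hom_app (curry G) n) m = G (btens m n).
Proof.
move=> hG; have lG n' : left_hom (lfun_of (curry_inner G n')).
  by move=> a m'; rewrite !lfun_ofE -blact_btens hG.
have hC : left_hom (lfun_of (curry_outer G)).
  move=> b n'; apply: hom_ext => m'.
  by rewrite hom_modE !lfun_ofE !hom_mkK // !lfun_ofE btens_balanced.
by rewrite hom_mkK // lfun_ofE hom_mkK // lfun_ofE.
Qed.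

Lemma uncurry_ext F G : uncurry F = uncurry G -> F = G.
Proof.
by move=> FG; apply: hom_ext => n; apply: hom_ext => m; rewrite -!uncurryE FG.
Qed.

Lemma uncurryK (G : 'Hom(MN, X)) : (forall a z, G (blact MN a z) = lact X a (G z)) ->
  uncurry (curry G) = G.
Proof.
by move=> hG; apply: bimod_tensor_ext => m n; rewrite uncurryE curryE.
Qed.

End Currying.

Section StableUnit.
Variables (k : fieldType) (A B : falgType k).
Variables (M : bimodule A B) (N : bimodule B A).
Implicit Types X Y : lmodule A.

(** By adjunction Hom_B(N, Hom_A(M, X)) is Hom_A(M (x)_B N, X), hence the sum of Hom_A(A, X) = X and
    Hom_A(P, X). The maps [j] and [q] are the injection and projection of the first summand. *)
Lemma stable_unit (P : bimodule A A) : bimod_projective P ->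
  bimod_retract (bimod_tensor M N) (bimod_regular A) P ->
  exists (j : forall X, 'Hom(X, hom_mod N (hom_mod M X)))
    (q : forall X, 'Hom(hom_mod N (hom_mod M X), X)),
  [/\ forall X, lmod_hom (j X) /\ lmod_hom (q X),
      forall X x, q X (j X x) = x,
      forall X Y (h : 'Hom(X, Y)), lmod_hom h ->
        (j Y \o h = hmap N (hmap M h) \o j X)%VF
    & forall X, null (\1%VF - (j X \o q X)%VF : 'End(hom_mod N (hom_mod M X)))].
Proof.
move=> pP [io [pi [ip [pp [[[iol ior] [pil pir]] [[ipl ipr] [ppl ppr]] piK _ sumK]]]]].
have lpi X x : linear (fun z => lact X (pi z : A) x).
  by move=> c z z'; rewrite linearP lact_lin.
have hpi X x a z : lfun_of (lpi X x) (blact (bimod_tensor M N) a z) =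
    lact X a (lfun_of (lpi X x) z).
  by rewrite !lfun_ofE pil /= lfunE lactMx.
have lj X : linear (fun x => curry (lfun_of (lpi X x)) : hom_mod N (hom_mod M X)).
  move=> c x y; apply: uncurry_ext; rewrite uncurryL !uncurryK //.
  by apply/lfunP => z; rewrite add_lfunE scale_lfunE !lfun_ofE linearP.
have lq X : linear (fun F : hom_mod N (hom_mod M X) => uncurry F (io 1)).
  by move=> c F G; rewrite uncurryL add_lfunE scale_lfunE.
pose j X := lfun_of (lj X); pose q X := lfun_of (lq X).
have jE X x z : uncurry (j X x) z = lact X (pi z) x.
  by rewrite /j lfun_ofE uncurryK // lfun_ofE.
have qE X F : q X F = uncurry F (io 1) by exact: lfun_ofE.
have hj X : lmod_hom (j X).
  move=> a x; apply/uncurry_ext/lfunP => z; rewrite jE uncurry_right jE pir.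
  by rewrite /= lfunE lactMx.
have hq X : lmod_hom (q X).
  move=> a F; rewrite !qE uncurry_right -ior -uncurry_left -iol.
  by rewrite /= !lfunE /= mulr1 mul1r.
have uh X Y (h : 'Hom(X, Y)) F : lmod_hom h ->
    uncurry (hmap N (hmap M h) F) = (h \o uncurry F)%VF.
  move=> hh; apply: bimod_tensor_ext => m n; rewrite [RHS]comp_lfunE !uncurryE.
  by rewrite !hmapE //; apply: hmap_hom.
exists j, q; split=> // [X x|X Y h hh|X].
- by rewrite qE jE piK lact1x.
- apply/lfunP => x; rewrite !comp_lfunE; apply/uncurry_ext/lfunP => z.
  by rewrite jE uh // comp_lfunE jE hh.
have ls : linear (fun F : hom_mod N (hom_mod M X) =>
    hom_mk (uncurry F \o ip)%VF : hom_mod P X).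
  move=> c F G; rewrite -[RHS]hom_mkL uncurryL; congr hom_mk; apply/lfunP => z.
  by rewrite add_lfunE scale_lfunE !comp_lfunE add_lfunE scale_lfunE.
have hs F : left_hom (uncurry F \o ip)%VF.
  by move=> a z; rewrite !comp_lfunE ipl uncurry_left.
have hg (g : hom_mod P X) a z : (hom_app g \o pp)%VF (blact (bimod_tensor M N) a z) =
    lact X a ((hom_app g \o pp)%VF z).
  by rewrite [LHS]comp_lfunE ppl hom_appP [in RHS]comp_lfunE.
have lr : linear (fun g : hom_mod P X =>
    curry (hom_app g \o pp)%VF : hom_mod N (hom_mod M X)).
  move=> c g g'; apply: uncurry_ext; rewrite uncurryL !uncurryK //.
  by apply/lfunP => z; rewrite add_lfunE scale_lfunE !comp_lfunE hom_modL.
pose s := lfun_of ls; pose r := lfun_of lr.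
have sE F z : hom_app (s F) z = uncurry F (ip z).
  by rewrite /s lfun_ofE hom_mkK // comp_lfunE.
have rE g z : uncurry (r g) z = hom_app g (pp z).
  by rewrite /r lfun_ofE uncurryK // comp_lfunE.
have hhs : lmod_hom s.
  by move=> a F; apply: hom_ext => z; rewrite hom_modE !sE uncurry_right ipr.
have hhr : lmod_hom r.
  move=> a g; apply/uncurry_ext/lfunP => z; rewrite uncurry_right !rE.
  by rewrite hom_modE ppr.
(* The complementary projection factors through Hom_A(P, X), whose identity is null. *)
suff -> : \1%VF - (j X \o q X)%VF = (r \o (\1%VF \o s))%VF.
  apply: null_compl => //; apply: null_compr => //.
  exact: projective_hom_null.
apply/lfunP => F; apply/uncurry_ext/lfunP => z.
have -> : (\1%VF - (j X \o q X)%VF) F = (-1) *: j X (q X F) + F.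
  by rewrite add_lfunE opp_lfunE comp_lfunE id_lfunE scaleN1r addrC.
rewrite uncurryL add_lfunE scale_lfunE scaleN1r jE qE -uncurry_left -iol.
have -> : (r \o (\1%VF \o s))%VF F = r (s F) by rewrite !comp_lfunE id_lfunE.
rewrite rE sE -{2}(sumK z) linearD /= lfunE /= mulr1.
by rewrite addKr.
Qed.

End StableUnit.

(** * Simple projective modules *)

Section ProjectiveModules.
Variables (k : fieldType) (A : falgType k).
Implicit Types S T X Y : lmodule A.

Lemma limg_full X Y (f : 'Hom(X, Y)) : (forall y, exists x, f x = y) -> limg f = fullv.
Proof.
move=> sf; apply/eqP; rewrite eqEsubv subvf; apply/subvP => y _.
by have [x <-] := sf y; rewrite memv_img ?memvf.
Qed.

Lemma projective_section X Y (f : 'Hom(X, Y)) : lmod_projective Y -> lmod_hom f ->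
  (forall y, exists x, f x = y) ->
  exists s : 'Hom(Y, X), lmod_hom s /\ (f \o s)%VF = \1%VF.
Proof. by move=> pY hf /limg_full sf; apply: pY => //; apply: lmod_hom_id. Qed.

Lemma projective_retract X Y (f : 'Hom(X, Y)) (s : 'Hom(Y, X)) :
  lmod_projective X -> lmod_hom f -> lmod_hom s -> (f \o s)%VF = \1%VF ->
  lmod_projective Y.
Proof.
move=> pX hf hs fs M N e g he se hg.
have [h [hh eh]] := pX M N e (g \o f)%VF he se (lmod_hom_comp hg hf).
exists (h \o s)%VF; split; first exact: lmod_hom_comp.
by rewrite comp_lfunA eh -comp_lfunA fs comp_lfun1r.
Qed.

Lemma orbit_linear X x : linear (fun a => lact X a x).
Proof. by move=> c a b; rewrite lact_lin. Qed.

Definition orbit_map X (x : X) : 'Hom(lmod_regular A, X) := lfun_of (orbit_linear x).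

Lemma orbit_mapE X (x : X) a : orbit_map x a = lact X a x.
Proof. exact: lfun_ofE. Qed.

Lemma orbit_map_hom X (x : X) : lmod_hom (orbit_map x).
Proof. by move=> a b; rewrite !orbit_mapE /= lfunE lactMx. Qed.

Lemma regular_projective : lmod_projective (lmod_regular A).
Proof.
move=> M N f g hf sf hg.
have : g 1 \in limg f by rewrite sf memvf.
move=> /memv_imgP[m _ gm]; exists (orbit_map m); split; first exact: orbit_map_hom.
apply/lfunP => a; rewrite comp_lfunE orbit_mapE hf -gm -hg /=.
by rewrite lfunE /= mulr1.
Qed.

(** A nonzero map onto a simple projective module splits; if it were null, so would be the identity
    of [S]. *)
Lemma null_to_simple_projective S X (f : 'Hom(X, S)) : simple_module S ->
  lmod_projective S -> ~ null (\1%VF : 'End(S)) -> lmod_hom f -> null f ->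
  forall x, f x = 0.
Proof.
move=> sS pS nS hf nf x; apply/eqP/negPn/negP => fx; apply: nS.
have [s [hs <-]] := projective_section pS hf (hom_to_simple_surj sS hf fx).
exact: null_compr.
Qed.

Lemma null_endo_simple T (f : 'Hom(T, T)) : simple_module T ->
  ~ null (\1%VF : 'End(T)) -> lmod_hom f -> null f -> f = 0.
Proof.
move=> sT nT hf nf; apply/lfunP => x; rewrite zero_lfunE.
apply/eqP/negPn/negP => fx; apply: nT.
have [g [hg fK gK]] := lmod_hom_inv hf (schur_bijective sT sT hf fx).
suff <- : (f \o g)%VF = \1%VF by exact: null_compr.
by apply/lfunP => t; rewrite comp_lfunE gK id_lfunE.
Qed.

End ProjectiveModules.

(** Devissage along the exact functor Hom_B(N, -): with [U] a simple submodule of [Y], either [g] is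
    nonzero on Hom_B(N, U), or it factors through Hom_B(N, Y/U), of smaller dimension. *)
Lemma simple_constituent (k : fieldType) (A B : falgType k) (N : bimodule B A)
    (S : lmodule A) (Y : lmodule B) (g : 'Hom(hom_mod N Y, S)) F :
  lmod_projective (bimod_left N) -> lmod_hom g -> g F != 0 ->
  exists (T : lmodule B) (g' : 'Hom(hom_mod N T, S)) F',
    [/\ simple_module T, lmod_hom g' & g' F' != 0].
Proof.
move=> pN; move: {2}(\dim {:Y}) (leqnn (\dim {:Y})) => d.
elim: d Y g F => [|d IHd] Y g F led hg gF.
  case/negP: gF; suff -> : F = 0 by rewrite linear0.
  apply: hom_ext => n; rewrite /hom_app linear0 zero_lfunE.
  move: led; rewrite leqn0 dimv_eq0 => /eqP Y0.
  by apply/eqP; rewrite -memv0 -Y0 memvf.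
have [Y0|Y0] := eqVneq (fullv : {vspace Y}) 0%VS.
  by apply: (IHd Y g F) => //; rewrite Y0 dimv0.
have [U [W [i [p [[hi hp sU dW] [ii sp ex]]]]]] := simple_extension Y0.
have [[F' gF']|nF] := pselect (exists F', (g \o hmap N i)%VF F' != 0).
  exists U, (g \o hmap N i)%VF, F'; split=> //.
  exact/lmod_hom_comp/hmap_hom.
have gi F' : g (hmap N i F') = 0.
  by apply/eqP/negPn/negP => h; apply: nF; exists F'; rewrite comp_lfunE.
have sLp := hmap_surj pN hp sp.
have ker G : hmap N p G = 0 -> g G = 0.
  move=> pG; have pG0 n : p (hom_app G n) = 0.
    by rewrite -hmapE // pG /hom_app linear0 zero_lfunE.
  have iV n : i ((i^-1)%VF (hom_app G n)) = hom_app G n.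
    by apply: limg_lfunVK; have [u <-] := ex _ (pG0 n); rewrite memv_img ?memvf.
  have hG : left_hom ((i^-1)%VF \o hom_app G)%VF.
    by move=> b n; apply: ii; rewrite hi !comp_lfunE !iV hom_appP.
  rewrite (_ : G = hmap N i (hom_mk ((i^-1)%VF \o hom_app G)%VF)) //.
  by apply: hom_ext => n; rewrite hmapE // hom_mkK // comp_lfunE iV.
have qK G : hmap N p ((hmap N p)^-1%VF G) = G.
  by apply: limg_lfunVK; rewrite (limg_full sLp) memvf.
(* The inverse is only a linear section of [hmap N p]; [g'] is a module homomorphism because [g]
   vanishes on the kernel of [hmap N p]. *)
pose g' := (g \o (hmap N p)^-1)%VF.
have g'p G : g' (hmap N p G) = g G.
  apply/eqP; rewrite comp_lfunE -subr_eq0 -linearB; apply/eqP/ker.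
  by rewrite linearB /= qK subrr.
have hg' : lmod_hom g'.
  move=> a G; have [G' <-] := sLp G.
  by rewrite -(hmap_hom hp) !g'p hg.
by apply: (IHd W g' (hmap N p F)) => //; [rewrite -ltnS (leq_trans dW)|rewrite g'p].
Qed.

Section StableSimples.
Variables (k : fieldType) (A B : falgType k).
Variables (M : bimodule A B) (N : bimodule B A).
Variables (I : finType) (m : I -> M) (phi : I -> 'Hom(M, B)).
Variables (J : finType) (n : J -> N) (psi : J -> 'Hom(N, A)).
Hypotheses (dM : right_dual_basis m phi) (dN : right_dual_basis n psi).
Hypothesis pN : lmod_projective (bimod_left N).
Variables (j : forall X : lmodule A, 'Hom(X, hom_mod N (hom_mod M X)))
  (q : forall X : lmodule A, 'Hom(hom_mod N (hom_mod M X), X)).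
Hypotheses (jq_hom : forall X, lmod_hom (j X) /\ lmod_hom (q X))
  (jK : forall X x, q X (j X x) = x)
  (jq_null : forall X, null (\1%VF - (j X \o q X)%VF : 'End(hom_mod N (hom_mod M X)))).
Variables (j' : forall Y : lmodule B, 'Hom(Y, hom_mod M (hom_mod N Y)))
  (q' : forall Y : lmodule B, 'Hom(hom_mod M (hom_mod N Y), Y)).
Hypotheses (jq'_hom : forall Y, lmod_hom (j' Y) /\ lmod_hom (q' Y))
  (j'K : forall Y y, q' Y (j' Y y) = y)
  (j'_nat : forall (X Y : lmodule B) (h : 'Hom(X, Y)), lmod_hom h ->
     (j' Y \o h = hmap M (hmap N h) \o j' X)%VF)
  (jq'_null : forall Y, null (\1%VF - (j' Y \o q' Y)%VF : 'End(hom_mod M (hom_mod N Y)))).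

Local Notation R := (hmap M).
Local Notation L := (hmap N).
Implicit Types (S X : lmodule A) (T Y : lmodule B).

(** The passage from [h] to its adjoint [q X \o L h] is injective modulo null maps: if the adjoint
    is zero, [L h] equals its composite with the null map 1 - j q, and naturality of [j'] recovers
    [h] from [R (L h)]. *)
Lemma null_of_adjoint X Y (h : 'Hom(Y, hom_mod M X)) : lmod_hom h ->
  (q X \o L h)%VF = 0 -> null h.
Proof.
move=> hh qh; have hLh : lmod_hom (L h) := hmap_hom hh.
have nLh : null (L h).
  suff -> : L h = ((\1%VF - (j X \o q X)%VF) \o L h)%VF by exact: null_compr.
  by rewrite comp_lfunDl comp_lfunNl comp_lfun1l -comp_lfunA qh comp_lfun0r subr0.
have -> : h = (q' (hom_mod M X) \o (R (L h) \o j' Y))%VF.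
  by rewrite -j'_nat //; apply/lfunP => y; rewrite !comp_lfunE j'K.
apply: null_compl; first exact: (jq'_hom _).2.
by apply: null_compr; [exact: (jq'_hom _).1 | apply: hmap_null dM _ _].
Qed.

Lemma not_null_hom_mod S : ~ null (\1%VF : 'End(S)) ->
  ~ null (\1%VF : 'End(hom_mod M S)).
Proof.
move=> nS nR; apply: nS.
have -> : \1%VF = (q S \o (L (\1%VF : 'End(hom_mod M S)) \o j S))%VF.
  by apply/lfunP => s; rewrite !comp_lfunE hmap1 !id_lfunE jK.
apply: null_compl; first exact: (jq_hom _).2.
apply: null_compr; first exact: (jq_hom _).1.
by apply: (hmap_null dN) => //; apply: lmod_hom_id.
Qed.

(** An honest direct summand of Hom_A(M, S), not merely one up to null maps. *)
Definition stable_summand S T : Prop :=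
  exists (a : 'Hom(T, hom_mod M S)) (b : 'Hom(hom_mod M S, T)),
  [/\ lmod_hom a, lmod_hom b & (b \o a)%VF = \1%VF].

(** If the identity of [X] factors through [L h], then modulo null maps that of [R X] factors
    through [h]: apply [R], then replace [R (L h)] by [h] using naturality of [j'] and the nullity
    of 1 - j' q'. *)
Lemma stable_factor X Y Y' (h : 'Hom(Y', Y)) (s : 'Hom(X, hom_mod N Y'))
    (g : 'Hom(hom_mod N Y, X)) :
  lmod_hom h -> lmod_hom s -> lmod_hom g -> (g \o (L h \o s))%VF = \1%VF ->
  null (\1%VF - ((R g \o j' Y) \o (h \o (q' Y' \o R s)))%VF).
Proof.
move=> hh hs hg gs.
have -> : \1%VF - ((R g \o j' Y) \o (h \o (q' Y' \o R s)))%VF =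
    (R g \o (R (L h) \o ((\1%VF - (j' Y' \o q' Y')%VF) \o R s)))%VF.
  rewrite comp_lfunDl comp_lfunNl comp_lfun1l !comp_lfunDr !comp_lfunNr.
  congr (_ - _).
    by rewrite -!hmap_comp ?gs ?hmap1 //; [exact: lmod_hom_comp (hmap_hom hh) hs|exact: hmap_hom].
  rewrite !comp_lfunA; congr (_ \o _ \o _)%VF.
  by rewrite -!comp_lfunA j'_nat.
apply: null_compl; first exact: hmap_hom.
apply: null_compl; first by apply/hmap_hom/hmap_hom.
by apply: null_compr => //; apply: hmap_hom.
Qed.

(** [T] is a simple constituent of Hom_A(M, S) for which [L T] maps onto [S]. Statements valid
    modulo null maps become exact on [T], because a null endomorphism of a simple module with
    non-null identity is zero. *)
Lemma stable_simple_projective S : simple_module S -> lmod_projective S ->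
  ~ null (\1%VF : 'End(S)) ->
  exists T, [/\ simple_module T, lmod_projective T, ~ null (\1%VF : 'End(T))
    & stable_summand S T].
Proof.
move=> sS pS nS; have [s0 s0n] := simple_neq0 sS.
have [|T [g [F0 [sT hg gF0]]]] := @simple_constituent _ _ _ N S (hom_mod M S) (q S)
  (j S s0) pN (jq_hom S).2; first by rewrite jK.
have sg := hom_to_simple_surj sS hg gF0.
have [s [hs gs]] := projective_section pS hg sg.
have := @stable_factor S T T \1%VF s g (@lmod_hom_id _ _ T) hs hg.
rewrite hmap1 !comp_lfun1l => /(_ gs).
set al := (R g \o j' T)%VF; set be := (q' T \o R s)%VF => nab.
have hal : lmod_hom al by apply: lmod_hom_comp; [exact: hmap_hom|exact: (jq'_hom _).1].
have hbe : lmod_hom be by apply: lmod_hom_comp; [exact: (jq'_hom _).2|exact: hmap_hom].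
have [t bat] : exists t, (be \o al)%VF t != 0.
  apply: contrapT => nex; apply: (not_null_hom_mod nS).
  have ba0 : (be \o al)%VF = 0.
    apply/lfunP => t; rewrite zero_lfunE; apply/eqP/negPn/negP => bt.
    by apply: nex; exists t.
  (* If [be \o al] were zero, [al \o be] would square to zero, and this factorization would make the
     identity of Hom_A(M, S) null. *)
  have -> : \1%VF = ((\1%VF + (al \o be)) \o (\1%VF - (al \o be)))%VF.
    have abab : ((al \o be) \o (al \o be))%VF = 0.
      by rewrite -comp_lfunA [(be \o (al \o be))%VF]comp_lfunA ba0 comp_lfun0l comp_lfun0r.
    rewrite comp_lfunDl comp_lfun1l comp_lfunDr comp_lfunNr comp_lfun1r abab.
    by rewrite subr0 subrK.
  apply: null_compl => //; apply: lmod_homD; first exact: lmod_hom_id.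
  exact: lmod_hom_comp.
have hba := lmod_hom_comp hbe hal.
have [c [hc baK cK]] := lmod_hom_inv hba (schur_bijective sT sT hba bat).
pose b := (c \o be)%VF; have hb : lmod_hom b := lmod_hom_comp hc hbe.
have bal : (b \o al)%VF = \1%VF.
  by apply/lfunP => x; rewrite -comp_lfunA comp_lfunE baK id_lfunE.
have nT : ~ null (\1%VF : 'End(T)).
  move=> nT; case/negP: gF0; apply/eqP.
  apply: (null_to_simple_projective sS pS nS hg).
  rewrite -[g]comp_lfun1r -(hmap1 N T); apply: null_compl => //.
  by apply: (hmap_null dN) => //; apply: lmod_hom_id.
exists T; split=> //; last by exists al, b.
have [t0 t0n] := simple_neq0 sT.
(* Projectivity of [T] amounts to splitting this surjection from the regular module. The map from
   [L] of the regular module to [S] adjoint to [al \o pi] is nonzero, hence split, and the splitting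
   is carried back to [pi]. *)
pose pi := orbit_map t0; have hpi : lmod_hom pi := orbit_map_hom t0.
have pi1 : pi 1 != 0 by rewrite orbit_mapE lact1x.
have spi := hom_to_simple_surj sT hpi pi1.
have hapi := lmod_hom_comp hal hpi; have hLapi : lmod_hom (L (al \o pi)%VF) := hmap_hom hapi.
have [qh0|[G qG]] : (q S \o L (al \o pi))%VF = 0 \/
    exists G, (q S \o L (al \o pi))%VF G != 0.
  have [ex|nex] := pselect (exists G, (q S \o L (al \o pi))%VF G != 0); first by right.
  left; apply/lfunP => G; rewrite zero_lfunE; apply/eqP/negPn/negP => h.
  by apply: nex; exists G.
  have npi : null pi.
    rewrite -[pi]comp_lfun1l -bal -comp_lfunA; apply: null_compl => //.
    exact: null_of_adjoint.
  have [F1 F1E] := hmap_surj pN hpi spi F0.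
  case/negP: gF0; rewrite -F1E -[g _]comp_lfunE; apply/eqP.
  apply: (null_to_simple_projective sS pS nS).
    by apply: lmod_hom_comp => //; apply: hmap_hom.
  by apply: null_compl => //; apply: (hmap_null dN).
have hq := (jq_hom S).2; have hqL := lmod_hom_comp hq hLapi.
have [s' [hs' qs']] := projective_section pS hqL (hom_to_simple_surj sS hqL qG).
have := stable_factor hapi hs' hq; rewrite comp_lfunA => /(_ qs').
set ka := (R (q S) \o j' _)%VF; set si := (q' _ \o R s')%VF => nks.
have hka : lmod_hom ka by apply: lmod_hom_comp; [exact: hmap_hom|exact: (jq'_hom _).1].
have hsi : lmod_hom si by apply: lmod_hom_comp; [exact: (jq'_hom _).2|exact: hmap_hom].
(* Compressing to [T], through [al] and [b], the factorization of the identity of Hom_A(M, S)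
   through [al \o pi]. Then [v] is invertible and passes through [pi], which gives the section. *)
pose u := (b \o (ka \o al))%VF; pose v := (pi \o (si \o al))%VF.
have hu : lmod_hom u := lmod_hom_comp hb (lmod_hom_comp hka hal).
have hv : lmod_hom v := lmod_hom_comp hpi (lmod_hom_comp hsi hal).
have uv : (u \o v)%VF = \1%VF.
  apply/eqP; rewrite eq_sym -subr_eq0; apply/eqP.
  apply: (null_endo_simple sT nT); first by apply: lmod_homB; [exact: lmod_hom_id|exact: lmod_hom_comp].
  have -> : \1%VF - (u \o v)%VF =
      (b \o ((\1%VF - (ka \o ((al \o pi) \o si))) \o al))%VF.
    rewrite comp_lfunDl comp_lfunNl comp_lfun1l comp_lfunDr comp_lfunNr bal.
    by rewrite /u /v !comp_lfunA.
  by apply: null_compl => //; apply: null_compr.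
have vt0 : v t0 != 0.
  apply: contraNneq t0n => v0; rewrite -[t0]id_lfunE -uv comp_lfunE v0.
  by rewrite linear0.
have [w [hw vK wK]] := lmod_hom_inv hv (schur_bijective sT sT hv vt0).
apply: (@projective_retract _ _ _ _ pi ((si \o al) \o w)%VF (@regular_projective _ B) hpi).
  exact: lmod_hom_comp (lmod_hom_comp hsi hal) hw.
by apply/lfunP => x; rewrite comp_lfunA comp_lfunE wK id_lfunE.
Qed.

(** The isomorphism gives a non-null map [h] from [R S] to [R S'], so its adjoint to [S'] is
    nonzero. It must stay nonzero on [S] embedded by [j S]: otherwise it would factor through the
    null map 1 - j q and vanish, [S'] being simple projective with non-null identity. *)
Lemma stable_simple_inj S S' T T' : simple_module S -> simple_module S' ->
  lmod_projective S' -> ~ null (\1%VF : 'End(S')) ->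
  ~ null (\1%VF : 'End(T)) -> 
  stable_summand S T -> stable_summand S' T' -> lmod_iso T T' -> lmod_iso S S'.
Proof.
move=> sS sS' pS' nS' nT [a [b [ha hb ba]]] [a' [b' [ha' hb' ba']]] [t [ht bt]].
have [t' [ht' tK _]] := lmod_hom_inv ht bt.
pose h := (a' \o (t \o b))%VF; have hh : lmod_hom h := lmod_hom_comp ha' (lmod_hom_comp ht hb).
have hqL : lmod_hom (q S' \o L h)%VF.
  by apply: lmod_hom_comp; [exact: (jq_hom _).2|exact: hmap_hom].
have nz : (q S' \o L h)%VF <> 0.
  move=> /(null_of_adjoint hh) nh; apply: nT.
  have -> : \1%VF = ((t' \o b') \o (h \o a))%VF.
    apply/lfunP => x; rewrite !comp_lfunE id_lfunE.
    have /lfunP/(_ x) := ba; rewrite comp_lfunE id_lfunE => ->.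
    have /lfunP/(_ (t x)) := ba'; rewrite comp_lfunE id_lfunE => ->.
    by rewrite tK.
  apply: null_compl; first exact: lmod_hom_comp.
  exact: null_compr.
have hf := lmod_hom_comp hqL (jq_hom S).1.
have [[s fs]|nf] := pselect (exists s, (q S' \o L h \o j S)%VF s != 0).
  exists (q S' \o L h \o j S)%VF; split=> //.
  exact: (schur_bijective sS sS' hf fs).
have f0 : (q S' \o L h \o j S)%VF = 0.
  apply/lfunP => s; rewrite zero_lfunE; apply/eqP/negPn/negP => fs.
  by apply: nf; exists s.
case: nz; apply/lfunP => F; rewrite zero_lfunE.
apply: (null_to_simple_projective sS' pS' nS' hqL).
have -> : (q S' \o L h)%VF = ((q S' \o L h) \o (\1%VF - (j S \o q S)))%VF.
  by rewrite comp_lfunDr comp_lfunNr comp_lfun1r comp_lfunA f0 comp_lfun0l subr0.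
exact: null_compl.
Qed.

End StableSimples.

(** * Central idempotents, and simple modules that are both projective and injective *)

Section CentralIdempotent.
Variables (k : fieldType) (A : falgType k).

Section Corner.
Variable e : A.
Hypotheses (eC : forall a, e * a = a * e) (ee : e * e = e) (e0 : e != 0).

Lemma mem_corner a : (a \in limg (amull e)) = (e * a == a).
Proof.
apply/idP/eqP => [/memv_imgP[b _ ->]|<-]; first by rewrite lfunE /= mulrA ee.
by apply/memv_imgP; exists a; rewrite ?memvf ?lfunE.
Qed.

Fact corner_is_aspace : is_aspace (limg (amull e)).
Proof.
apply/andP; split.
  apply/has_algidP; exists e; split=> //; first by rewrite mem_corner ee.
  by move=> u; rewrite mem_corner => /eqP eu; rewrite -eC eu.
apply/prodvP => u v; rewrite !mem_corner => /eqP eu _.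
by rewrite mulrA eu.
Qed.

Definition corner : {aspace A} := ASpace corner_is_aspace.

Lemma algid_corner : algid corner = e.
Proof.
have ec : e \in corner by rewrite mem_corner ee.
have := memv_algid corner; rewrite mem_corner => /eqP <-.
by rewrite eC algidl.
Qed.

Definition corner_proj (a : A) : subvs_of corner := vsproj corner (e * a).

Lemma corner_projE a : vsval (corner_proj a) = e * a.
Proof. by rewrite vsprojK // mem_corner mulrA ee. Qed.

Lemma corner_projL c a b : corner_proj (c *: a + b) = c *: corner_proj a + corner_proj b.
Proof. by rewrite /corner_proj mulrDr -scalerAr linearP. Qed.

Lemma corner_projM a b : corner_proj (a * b) = corner_proj a * corner_proj b.
Proof.
apply: val_inj; rewrite -[LHS]/(vsval _) corner_projE.
transitivity (vsval (corner_proj a) * vsval (corner_proj b)) => //.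
by rewrite !corner_projE -mulrA [a * (e * b)]mulrA -eC !mulrA ee.
Qed.

Lemma corner_proj1 : corner_proj 1 = 1.
Proof.
apply: val_inj; rewrite -[LHS]/(vsval _) corner_projE mulr1.
by rewrite -[RHS]/(algid corner) algid_corner.
Qed.

Lemma corner_val (x : subvs_of corner) : e * vsval x = vsval x.
Proof. by apply/eqP; rewrite -mem_corner; exact: subvsP. Qed.

End Corner.

Lemma central_idempotent_decomposes (e : A) : (forall a, e * a = a * e) ->
  e * e = e -> e != 0 -> e != 1 -> ~ indecomposable_alg A.
Proof.
move=> eC ee e0 e1 indec; apply: indec.
pose d := 1 - e; have dC a : d * a = a * d by rewrite mulrBl mulrBr mul1r mulr1 eC.
have ed : e * d = 0 by rewrite mulrBr mulr1 ee subrr.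
have dd : d * d = d by rewrite {1}/d mulrBl mul1r ed subr0.
have d0 : d != 0 by rewrite subr_eq0 eq_sym.
pose B1 : falgType k := subvs_of (corner eC ee e0).
pose B2 : falgType k := subvs_of (corner dC dd d0).
pose f (a : A) : (B1 * B2)%type := (corner_proj eC ee e0 a, corner_proj dC dd d0 a).
have lf : linear f by move=> c a b; rewrite /f !corner_projL.
have mf : monoid_morphism f.
  by split=> [|a b]; rewrite /f ?corner_proj1 ?corner_projM.
pose F : {lrmorphism A -> (B1 * B2)%type} := HB.pack f
  (GRing.isLinear.Build k A (B1 * B2)%type _ f lf)
  (GRing.isMonoidMorphism.Build A (B1 * B2)%type f mf).
exists B1, B2, F; exists (fun x => vsval x.1 + vsval x.2) => [a|[x y]].
  by rewrite /= !corner_projE -mulrDl addrC subrK mul1r.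
have xe := corner_val x; have yd := corner_val y.
rewrite /= /f; congr pair; apply: val_inj; rewrite -[LHS]/(vsval _) corner_projE mulrDr.
  by rewrite xe -yd mulrA ed mul0r addr0.
by rewrite yd -xe mulrA dC ed mul0r add0r.
Qed.

End CentralIdempotent.

Section NullSimpleProjective.
Variables (k : closedFieldType) (A : falgType k) (S : lmodule A).
Hypotheses (sS : simple_module S) (pS : lmod_projective S).

Lemma simple_image (X : lmodule A) (f : 'Hom(S, X)) : lmod_hom f -> injective f ->
  simple_submodule (limg f).
Proof.
move=> hf fi; split; first exact: submodule_limg.
  have [s s0] := simple_neq0 sS; apply: contraNneq s0 => im0.
  apply/eqP/fi; apply/eqP; rewrite linear0 -memv0 -im0 memv_img ?memvf //.
move=> W sW leW.
have sV : submodule (f @^-1: W)%VS.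
  apply/submoduleP => a s; rewrite -!memv_preim hf.
  by move/submoduleP: sW; apply.
case: (simple_sub sS sV) => fV; [left|right]; apply/eqP.
  rewrite -subv0; apply/subvP => w wW.
  have /memv_imgP[s _ ws] := subvP leW _ wW.
  have : s \in (f @^-1: W)%VS by rewrite -memv_preim -ws.
  by rewrite fV memv0 ws => /eqP->; rewrite linear0 mem0v.
rewrite eqEsubv leW; apply/subvP => _ /memv_imgP[s _ ->].
by rewrite memv_preim fV memvf.
Qed.

(** Projectivity embeds [S] in [A] by [sg], density provides the [E i], and together they build the
    unit [e] of the matrix block of [S]. Injectivity makes [e] central; indecomposability then
    forces [e = 1], and right multiplication by the [E i] splits [A] into copies of [S]. *)
Lemma null_simple_projective : null (\1%VF : 'End(S)) ->
  indecomposable_alg A -> semisimple_alg A.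
Proof.
move=> [w [wA wx]] indec.
pose b := vbasis {:S}; have fb : free b := basis_free (vbasisP _).
have d0 : (0 < \dim {:S})%N by rewrite lt0n dimv_eq0; case: sS.
pose o := Ordinal d0.
have bo0 : b`_o != 0 by apply: (free_not0 fb); rewrite mem_nth // size_tuple.
have /choice[E EE] : forall i : 'I_(\dim {:S}), exists a : A,
    forall v : 'I_(\dim {:S}), lact S a b`_v = (v == i)%:R *: b`_o.
  move=> i; have [||a [_ aE]] := @matrix_unit k A 1 (fun=> S) _ _ ord0 o i.
  - by [].
  - by move=> x y _; rewrite !ord1.
  by exists a.
have [sg [hsg sgE]] : exists sg : 'Hom(S, lmod_regular A),
    (forall a s, sg (lact S a s) = a * sg s) /\ forall s, lact S (sg s) b`_o = s.
  have bo1 : orbit_map b`_o 1 != 0 by rewrite orbit_mapE lact1x.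
  have [s [hs ps]] := projective_section pS (orbit_map_hom b`_o)
    (hom_to_simple_surj sS (orbit_map_hom b`_o) bo1).
  exists s; split=> [a t|t]; first by rewrite hs /= lfunE.
  by have /lfunP/(_ t) := ps; rewrite comp_lfunE id_lfunE orbit_mapE.
(* Since S is injective, the left ideal generated by sg s cannot be carried
   isomorphically onto another copy of S by an element annihilating S. *)
have sg_kill s y : (forall t, lact S y t = 0) -> sg s * y = 0 :> A.
  move=> yS; pose tau : 'Hom(S, lmod_regular A) := (amulr y \o sg)%VF.
  have tauE t : tau t = sg t * y by rewrite comp_lfunE lfunE.
  have htau : lmod_hom tau.
    by move=> a t; rewrite !tauE hsg /= lfunE /= mulrA.
  apply/eqP/negPn/negP => ts; have ts' : tau s != 0 by rewrite tauE.
  have ti := hom_from_simple_inj sS htau ts'.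
  have rK : cancel tau tau^-1%VF by exact/lker0_lfunK/lker0P.
  (* Injectivity extends the inverse of [tau] to a homomorphism [rho] on all of [A]. But [rho] sends
     [sg s * y] to a multiple of [y] acting on [rho 1], which is zero. *)
  have lrho : linear (fun x : A => w (tau^-1%VF \o amulr x)%VF).
    by move=> c x z; rewrite amulr_is_linear comp_lfunDr -comp_lfunZr linearP.
  pose rho x := w (tau^-1%VF \o amulr x)%VF.
  have rhoM a x : rho (a * x) = lact S a (rho x).
    rewrite /rho -wA; congr (w _); apply/lfunP => z.
    by rewrite !comp_lfunE !lfunE /= mulrA.
  have rhoT t : rho (tau t) = t.
    rewrite /rho (wx t) ?id_lfunE // => a; rewrite comp_lfunE lfunE /=.
    by rewrite tauE mulrA -hsg -tauE rK.
  suff s0 : s = 0 by rewrite s0 linear0 eqxx in ts'.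
  by rewrite -(rhoT s) tauE -[sg s * y]mulr1 rhoM lactMx yS linear0.
pose e : A := \sum_(i < \dim {:S}) sg b`_i * E i.
have eS s : lact S e s = s.
  rewrite [in LHS](coord_vbasis (memvf s)) linear_sum [RHS](coord_vbasis (memvf s)).
  apply: eq_bigr => j _; rewrite linearZ /=; congr (_ *: _).
  rewrite lact_sumx (bigD1 j) //= big1 ?addr0 => [|i ij].
    by rewrite lactMx EE eqxx scale1r sgE.
  by rewrite lactMx EE eq_sym (negPf ij) scale0r linear0.
have xe x : x * e = \sum_(i < \dim {:S}) sg (lact S x b`_i) * E i.
  by rewrite mulr_sumr; apply: eq_bigr => i _; rewrite hsg mulrA.
have ee : e * e = e by rewrite xe; apply: eq_bigr => i _; rewrite eS.
(* Both products are sums of [sg b_j] times some element; the two elements for the same [j] act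
   alike on [S], so [sg_kill] identifies the terms. *)
have eC x : e * x = x * e.
  pose c (i j : 'I_(\dim {:S})) := coord b j (lact S x b`_i).
  have xb (i : 'I_(\dim {:S})) : lact S x b`_i = \sum_j c i j *: b`_j := coord_vbasis (memvf _).
  have -> : x * e = \sum_(j < \dim {:S}) sg b`_j * \sum_i c i j *: E i.
    rewrite xe; under eq_bigr => i _ do rewrite xb linear_sum mulr_suml.
    rewrite exchange_big; apply: eq_bigr => j _ /=.
    rewrite mulr_sumr; apply: eq_bigr => i _.
    by rewrite linearZ /= -scalerAl -scalerAr.
  rewrite mulr_suml; apply: eq_bigr => j _; apply/eqP; rewrite -subr_eq0.
  rewrite -mulrA -mulrBr sg_kill // => t.
  rewrite (coord_vbasis (memvf t)) linear_sum big1 // => v _.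
  rewrite linearZ /= lactBx lactMx xb lact_sumx linear_sum.
  rewrite (bigD1 j) //= [X in _ - X](bigD1 v) //= big1 => [|i ij]; last first.
    by rewrite linearZ /= EE (negPf ij) scale0r scaler0.
  rewrite [X in _ - (_ + X)]big1 => [|i iv]; last first.
    by rewrite lactZx EE eq_sym (negPf iv) scale0r scaler0.
  by rewrite !addr0 lactZx linearZ /= !EE !eqxx subrr scaler0.
have e0 : e != 0.
  apply: contraNneq bo0 => e0; rewrite -(eS b`_o) e0 lact0x //.
have [e1|e1] := eqVneq e 1; last by case: (central_idempotent_decomposes eC ee e0 e1 indec).
have tau_lin (i : 'I_(\dim {:S})) : linear (fun s => sg s * E i : lmod_regular A).
  by move=> c s t; rewrite linearP mulrDl -scalerAl.
pose tau i := lfun_of (tau_lin i).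
have tauE i s : tau i s = sg s * E i by exact: lfun_ofE.
have tau_coord (i j : 'I_(\dim {:S})) s : lact S (tau i s) b`_j = (j == i)%:R *: s.
  rewrite tauE lactMx EE linearZ /=; congr (_ *: _); exact: sgE.
have htau i : lmod_hom (tau i).
  by move=> a s; rewrite !tauE hsg /= lfunE /= mulrA.
exists (\dim {:S}), (fun i => limg (tau i)); split.
- move=> i; apply: simple_image => // s t st.
  have : lact S (tau i s) b`_i = lact S (tau i t) b`_i by rewrite st.
  by rewrite !tau_coord eqxx !scale1r.
- apply/directv_sum_independent => us usi us0 i _.
  have /choice[t tE] : forall j, exists t : S, us j = tau j t.
    by move=> j; have /memv_imgP[t _ ->] := usi j isT; exists t.
  rewrite tE; suff -> : t i = 0 by rewrite linear0.
  have : lact S (\sum_j us j) b`_i = 0 by rewrite us0 lact0x.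
  rewrite lact_sumx (bigD1 i) //= big1 => [|j ji].
    by rewrite addr0 tE tau_coord eqxx scale1r.
  by rewrite tE tau_coord eq_sym (negPf ji) scale0r.
apply/eqP; rewrite eqEsubv subvf; apply/subvP => x _.
rewrite -[x]mulr1 -e1 xe; apply: memv_suml => i _.
by rewrite -tauE (subvP (sumv_sup i _ (subvv _))) // memv_img ?memvf.
Qed.

End NullSimpleProjective.

(** * The number of simple modules *)

Section Counting.
Variable k : closedFieldType.

Lemma stably_equiv_morita_sym (A B : falgType k) :
  stably_equiv_morita A B -> stably_equiv_morita B A.
Proof.
by case=> M [N [P [Q [pM pN [pP pQ] isoP isoQ]]]]; exists N, M, Q, P; split.
Qed.

Lemma projective_iso (A : falgType k) (X Y : lmodule A) :
  lmod_iso X Y -> lmod_projective X -> lmod_projective Y.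
Proof.
move=> [f [hf bf]] pX; have [g [hg fK gK]] := lmod_hom_inv hf bf.
apply: (projective_retract pX hf hg); apply/lfunP => y.
by rewrite comp_lfunE gK id_lfunE.
Qed.

Definition nonnull_simple_projective (A : falgType k) (S : lmodule A) : Prop :=
  [/\ simple_module S, lmod_projective S & ~ null (\1%VF : 'End(S))].

(** The relation hides the bimodules: it says that [T] is a summand of Hom_A(M, S) with non-null
    identity. *)
Lemma stable_simple_projectives (A B : falgType k) : stably_equiv_morita A B ->
  exists rel : lmodule A -> lmodule B -> Prop,
  (forall S, nonnull_simple_projective S ->
     exists T, [/\ simple_module T, lmod_projective T & rel S T]) /\
  (forall S S' T T', nonnull_simple_projective S -> nonnull_simple_projective S' ->
     rel S T -> rel S' T' -> lmod_iso T T' -> lmod_iso S S').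
Proof.
case=> M [N [P [Q [[_ rM] [lN rN] [pP pQ] isoP isoQ]]]].
have [I [m [phi dM]]] := right_dual_basis_exists rM.
have [J [n [psi dN]]] := right_dual_basis_exists rN.
have [j [q [jq jK _ jqn]]] := stable_unit pP (bimod_iso_sum_retract isoP).
have [j' [q' [jq' jK' jn' jqn']]] := stable_unit pQ (bimod_iso_sum_retract isoQ).
exists (fun S T => stable_summand M S T /\ ~ null (\1%VF : 'End(T))); split.
  move=> S [sS pS nS].
  have [T [sT pT nT ST]] := stable_simple_projective dM dN lN jq jK jqn jq' jK' jn' jqn' sS pS nS.
  by exists T.
move=> S S' T T' [sS pS nS] [sS' pS' nS'] [ST nT] [ST' nT'].
exact: (stable_simple_inj dM jq jqn jq' jK' jn' sS sS' pS' nS' nT ST ST').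
Qed.

(** By [null_simple_projective] no simple projective module over [A] has a null identity, so the
    stable correspondence covers all of them and is injective on isomorphism classes. *)
Lemma simple_projectives_le (A B : falgType k) lA (SA : 'I_lA -> lmodule A)
    lB (SB : 'I_lB -> lmodule B) :
  simple_list SA -> simple_list SB -> stably_equiv_morita A B ->
  indecomposable_alg A -> ~ semisimple_alg A ->
  (#|[set i | `[< lmod_projective (SA i) >]]| <=
   #|[set i | `[< lmod_projective (SB i) >]]|)%N.
Proof.
move=> [sA nA _] [sB _ exB] eqv iA nsA.
have [rel [relT relI]] := stable_simple_projectives eqv.
have nn i : lmod_projective (SA i) -> nonnull_simple_projective (SA i).
  by move=> pS; split=> // nS; apply: nsA; apply: null_simple_projective nS iA.
(* The option type supplies a value at non-projective indices. *)
have exj (i : 'I_lA) : exists j : option 'I_lB, lmod_projective (SA i) ->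
    exists j' T, [/\ j = Some j', lmod_projective (SB j'), rel (SA i) T & lmod_iso T (SB j')].
  have [pS|nS] := pselect (lmod_projective (SA i)); last by exists None.
  have [T [sT pT rT]] := relT _ (nn i pS); have [j iT] := exB T sT.
  by exists (Some j) => _; exists j, T; split=> //; apply: projective_iso pT.
have [f fP] := choice exj.
set PA := [set i | _]; set PB := [set i | _].
have finj : {in PA &, injective f}.
  move=> i i'; rewrite !inE => /asboolP pi /asboolP pi' ff.
  have [j [T [fi _ rT iT]]] := fP i pi; have [j' [T' [fi' _ rT' iT']]] := fP i' pi'.
  apply/nA/(relI _ _ _ _ (nn i pi) (nn i' pi') rT rT').
  apply: lmod_iso_trans iT _; apply: lmod_iso_sym.
  by move: ff; rewrite fi fi' => -[->].
rewrite -(card_in_imset finj) -(card_imset PB Some_inj); apply: subset_leq_card.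
apply/subsetP => z /imsetP[i]; rewrite inE => /asboolP pi ->.
have [j [T [-> pj _ _]]] := fP i pi.
by apply: imset_f; rewrite inE; apply/asboolP.
Qed.

Lemma num_nonprojective_simples_list (A : falgType k) l (S : 'I_l -> lmodule A) :
  simple_list S ->
  num_nonprojective_simples A (l - #|[set i | `[< lmod_projective (S i) >]]|).
Proof.
move=> [sS nS exS]; set PS := [set i | _].
have cS : (l - #|PS|)%N = #|~: PS| by rewrite [RHS]cardsCs setCK card_ord.
rewrite cS; exists (fun i => S (enum_val i)); split=> [i|i j|T sT nT].
- split=> // pi; have := enum_valP i; rewrite !inE.
  by move=> /negP; apply; apply/asboolP.
- by move=> /nS/enum_val_inj.
have [i iT] := exS T sT; have iP : i \in ~: PS.
  rewrite !inE; apply/negP => /asboolP pi; apply: nT.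
  by apply: projective_iso pi; apply: lmod_iso_sym.
by exists (enum_rank_in iP i); rewrite enum_rankK_in.
Qed.

(** The equality of dim R(A) and dim R(B), with the numbers of simple modules moved across to avoid
    truncated subtraction. *)
Lemma stable_num_simples (A B : falgType k) lA (SA : 'I_lA -> lmodule A)
    lB (SB : 'I_lB -> lmodule B) :
  simple_list SA -> simple_list SB -> stably_equiv_morita A B ->
  ((\dim {:A} - \dim (comm_space A)) + lB = (\dim {:B} - \dim (comm_space B)) + lA)%N.
Proof.
move=> cA cB eqv.
have le1 := stable_comm_le cA cB eqv.
have le2 := stable_comm_le cB cA (stably_equiv_morita_sym eqv).
have [sA nA _] := cA; have [sB nB _] := cB.
have dA := dim_char_kernel sA nA; have dB := dim_char_kernel sB nB.
have kA := dimvS (comm_space_char_kernel SA).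
have kB := dimvS (comm_space_char_kernel SB).
rewrite -dA -dB; move: kA kB le1 le2.
move: (\dim (char_kernel SA)) (\dim (char_kernel SB)) => x y.
move: (\dim (comm_space A)) (\dim (comm_space B)) => u v.
by lia.
Qed.

End Counting.

Theorem proposition1p3 (k : closedFieldType) (p : nat) (p_char : p \in [pchar k]%R)
    (Cp : finGroupType) (Cp_cyclic : cyclic [set: Cp])
    (Cp_order : #|[set: Cp]| = p)
    (A B : falgType k)
    (A_indecomposable : indecomposable_alg A)
    (B_indecomposable : indecomposable_alg B)
    (A_nonsemisimple : ~ semisimple_alg A)
    (B_nonsemisimple : ~ semisimple_alg B)
    (AB_stable : stably_equiv_morita A B)
    (ACp_BCp_stable : stably_equiv_morita (tensor A (group_alg k Cp))
                                          (tensor B (group_alg k Cp))) :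
  auslander_reiten_holds A B.
Proof.
have Cp_abelian := cyclic_abelian Cp_cyclic.
have [lA [SA cA]] := simple_list_exists A.
have [lB [SB cB]] := simple_list_exists B.
have p_gt1 : (1 < p)%N by have /andP[/prime_gt1] := p_char.
have lAB : lA = lB.
  have := stable_num_simples cA cB AB_stable.
  have := stable_num_simples (inflate_simple_list p_char Cp_abelian Cp_order cA)
    (inflate_simple_list p_char Cp_abelian Cp_order cB) ACp_BCp_stable.
  rewrite !(dim_galg_tensor _ Cp_order) !(dim_comm_space_galg _ Cp_abelian Cp_order).
  rewrite -!mulnBr; move: (_ - _)%N (_ - _)%N => x y.
  (* From p x + lB = p y + lA and x + lB = y + lA one gets (p - 1)(x - y) = 0, and [p > 1] yields x
     = y. *)
  nia.
have leAB := simple_projectives_le cA cB AB_stable A_indecomposable A_nonsemisimple.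
have leBA := simple_projectives_le cB cA (stably_equiv_morita_sym AB_stable)
  B_indecomposable B_nonsemisimple.
have eq_proj : #|[set i | `[< lmod_projective (SB i) >]]| =
    #|[set i | `[< lmod_projective (SA i) >]]|.
  by apply/eqP; rewrite eqn_leq leAB leBA.
exists (lA - #|[set i | `[< lmod_projective (SA i) >]]|)%N.
split; first exact: num_nonprojective_simples_list.
by have := num_nonprojective_simples_list cB; rewrite eq_proj -lAB.
Qed.
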